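(* A function $f:\mathbb R^{n+1}\to\mathbb R_n$ belongs to $\mathcal M_0$ if and only if it has an expansion $$f(x)=\sum_{j,k\in\mathbb N_0}X^{(j)}_k(x)P_{k,j}(\underline x)$$ for some $k$-homogeneous monogenic polynomials $P_{k,j}:\mathbb R^n\to\mathbb R_n$ satisfying $$\limsup_{j+k\to\infty}\sqrt[j+k]{\|P_{k,j}\|}=0,$$ where $\|\cdot\|$ is either $\|\cdot\|_{L_2}$ or $\|\cdot\|_\infty$ on $S^{n-1}$; such an expansion is unique.
   Context: $\mathbb R_n$ is the real Clifford algebra generated by $e_1,\dots,e_n$ with $e_ie_j+e_je_i=-2\delta_{ij}$; $|\cdot|$ its Euclidean norm. Identify $\underline x\in\mathbb R^n$ with $\sum_jx_je_j$ and $x=(x_0,\underline x)$ with $x_0+\underline x$. A function is monogenic if $(\partial_{x_0}+\sum_je_j\partial_{x_j})f=0$; $\mathcal M_0$ is the right $\mathbb R_n$-module of monogenic functions on $\mathbb R^{n+1}$. A $k$-homogeneous monogenic polynomial (spherical monogenic) is a homogeneous polynomial $P:\mathbb R^n\to\mathbb R_n$ of degree $k$ with $\sum_je_j\partial_{x_j}P=0$. Norms on $S^{n-1}$: $\|g\|^2_{L_2}=\frac1{A_n}\int_{S^{n-1}}|g(\underline\omega)|^2d\underline\omega$ ($A_n$ the area of $S^{n-1}$) and $\|g\|_\infty=\sup_{S^{n-1}}|g|$. Gegenbauer polynomials $C^\nu_j(z)=\sum_{i=0}^{[j/2]}\frac{(-1)^i(\nu)_{j-i}}{i!(j-2i)!}(2z)^{j-2i}$,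 $(\nu)_j=\nu(\nu+1)\cdots(\nu+j-1)$. $X^{(0)}_k=1$ and, for $j\ge1$, $X^{(j)}_k(x)=\mu^j_k|x|^j\big(C^{(n-1)/2+k}_j(\frac{x_0}{|x|})+\frac{n+2k-1}{n+2k+j-1}C^{(n+1)/2+k}_{j-1}(\frac{x_0}{|x|})\frac{\underline x}{|x|}\big)$ with $\mu^{2l}_k=(-1)^l(C^{(n-1)/2+k}_{2l}(0))^{-1}$, $\mu^{2l+1}_k=(-1)^l\frac{n+2k+2l}{n+2k-1}(C^{(n+1)/2+k}_{2l}(0))^{-1}$. *)

(* Defs.v *)
From mathcomp Require Import all_boot all_order all_algebra.
From mathcomp Require Import all_classical all_reals all_analysis.
Import Order.TTheory GRing.Theory Num.Theory.
Import numFieldNormedType.Exports.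
Set Implicit Arguments. Unset Strict Implicit. Unset Printing Implicit Defensive.
Local Open Scope ring_scope.

Section Clifford.
Variable R : realType.

(* An element of R_n is a real linear combination of the basis blades e_A,
   A ⊆ {1..n} (here {set 'I_n}), e_A = e_{a1}...e_{ap} with a1 < ... < ap. *)
Definition Cl (n : nat) := {ffun {set 'I_n} -> R}.

Definition cl_blade n (A : {set 'I_n}) : Cl n := [ffun B => (B == A)%:R].
Definition cl_one n : Cl n := cl_blade (finset.set0 : {set 'I_n}).
Definition cl_e n (j : 'I_n) : Cl n := cl_blade (finset.set1 j).

(* e_A e_B = (-1)^(#{(a,b) in A x B | b < a} + #|A :&: B|) e_(A Δ B),
   which encodes e_i e_j = - e_j e_i (i <> j) and e_i^2 = -1. *)
Definition blade_sign n (A B : {set 'I_n}) : R :=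
  (-1) ^+ (#|finset.finset (fun p : 'I_n * 'I_n => (p.1 \in A) && (p.2 \in B) && (p.2 < p.1)%N)|
           + #|A :&: B|).
Definition symdiff n (A B : {set 'I_n}) := (A :\: B) :|: (B :\: A).

Definition cl_mul n (a b : Cl n) : Cl n :=
  [ffun C => \sum_(A : {set 'I_n}) \sum_(B : {set 'I_n} | symdiff A B == C)
               blade_sign A B * a A * b B].

Definition cl_norm n (a : Cl n) : R := Num.sqrt (\sum_(A : {set 'I_n}) a A ^+ 2).

(* x in R^{n+1} is a row vector 'rV_(n.+1), x = (x_0, x_1..x_n) with x_0 = x 0 ord0
   and x_j = x 0 (lift ord0 j) for j : 'I_n (i.e. the paper's x_{j+1}). *)
Definition x0 n (x : 'rV[R]_(n.+1)) : R := x 0 ord0.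
Definition xvec n (x : 'rV[R]_(n.+1)) : 'rV[R]_n := \row_(j < n) x 0 (lift ord0 j).
Definition eucl m (v : 'rV[R]_m) : R := Num.sqrt (\sum_(j < m) v 0 j ^+ 2).

Definition vecCl n (v : 'rV[R]_n) : Cl n := \sum_(j < n) v 0 j *: cl_e j.

Definition unitv m (i : 'I_m) : 'rV[R]_m := delta_mx 0 i.

Definition cl_partial m n (f : 'rV[R]_m -> Cl n) (i : 'I_m) (x : 'rV[R]_m) : Cl n :=
  [ffun A => 'D_(unitv i) (fun y => f y A) x].

Definition C1 m n (f : 'rV[R]_m -> Cl n) : Prop :=
  (forall (A : {set 'I_n}) (i : 'I_m) (x : 'rV[R]_m),
      derivable (fun y => f y A) x (unitv i)) /\
  (forall (A : {set 'I_n}) (i : 'I_m),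
      continuous (fun x => 'D_(unitv i) (fun y => f y A) x)).

Definition monogenic n (f : 'rV[R]_(n.+1) -> Cl n) : Prop :=
  C1 f /\
  forall x, cl_partial f ord0 x
            + \sum_(j < n) cl_mul (cl_e j) (cl_partial f (lift ord0 j) x) = 0.

Definition M0 n : set ('rV[R]_(n.+1) -> Cl n) := [set f | monogenic f].

Definition hom_poly n k (P : 'rV[R]_n -> Cl n) : Prop :=
  exists c : {ffun {ffun 'I_n -> 'I_k.+1} -> Cl n},
    forall x, P x = \sum_(a : {ffun 'I_n -> 'I_k.+1} | (\sum_(j < n) (a j : nat))%N == k)
                     (\prod_(j < n) x 0 j ^+ a j) *: c a.

Definition dirac_x n (P : 'rV[R]_n -> Cl n) (x : 'rV[R]_n) : Cl n :=
  \sum_(j < n) cl_mul (cl_e j) (cl_partial P j x).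

Definition spherical_monogenic n k (P : 'rV[R]_n -> Cl n) : Prop :=
  hom_poly k P /\ forall x, dirac_x P x = 0.

(* iterated Lebesgue integral over R^m of a nonnegative function of
   (x_0, ..., x_{m-1}) *)
Fixpoint iint (m : nat) (g : (nat -> R) -> \bar R) : \bar R :=
  match m with
  | 0 => g (fun _ => 0)
  | m'.+1 => (\int[@lebesgue_measure R]_(t in setT)
               iint m' (fun s => g (fun i => if i == m' then t else s i)))%E
  end.

Definition row_of m (s : nat -> R) : 'rV[R]_m := \row_(j < m) s j.

(* normalized surface integral (1/A_m) \int_{S^{m-1}} g dω, defined through
   the cone construction of the surface measure:
   \int_{S^{m-1}} g dω = m \int_{B} g(x/|x|) dx  and  A_m = m |B|. *)
Definition sphere_avg m (g : 'rV[R]_m -> R) : R :=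
  fine (iint m (fun s => (((eucl (row_of m s) <= 1)%R)%:R
                          * g ((eucl (row_of m s))^-1 *: row_of m s))%:E))
  / fine (iint m (fun s => (((eucl (row_of m s) <= 1)%R)%:R : R)%:E)).

Definition L2norm n (P : 'rV[R]_n -> Cl n) : R :=
  Num.sqrt (sphere_avg (fun w => cl_norm (P w) ^+ 2)).

Definition supnorm n (P : 'rV[R]_n -> Cl n) : R :=
  sup [set cl_norm (P w) | w in [set w : 'rV[R]_n | eucl w = 1]].

Definition poch (nu : R) (m : nat) : R := \prod_(i < m) (nu + i%:R).

Definition gegenbauer (nu : R) (j : nat) (z : R) : R :=
  \sum_(i < (j./2).+1) (-1) ^+ i * poch nu (j - i) / ((i`!)%:R * ((j - 2 * i)`!)%:R)
                       * (2 * z) ^+ (j - 2 * i).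

(* |x|^j C^nu_j(x0/|x|) written as the homogeneous polynomial
   sum_i (-1)^i (nu)_{j-i} / (i!(j-2i)!) (2 x0)^{j-2i} |x|^{2i}
   (this agrees with the paper's expression for x <> 0 and is its
   continuous extension to x = 0). *)
Definition hgeg (nu : R) (j : nat) (z r2 : R) : R :=
  \sum_(i < (j./2).+1) (-1) ^+ i * poch nu (j - i) / ((i`!)%:R * ((j - 2 * i)`!)%:R)
                       * (2 * z) ^+ (j - 2 * i) * r2 ^+ i.

Definition mu (n k j : nat) : R :=
  if odd j then
    (-1) ^+ (j./2) * ((n + 2 * k + 2 * j./2)%:R / (n + 2 * k - 1)%:R)
    / gegenbauer ((n%:R + 1) / 2 + k%:R) (2 * j./2) 0
  else (-1) ^+ (j./2) / gegenbauer ((n%:R - 1) / 2 + k%:R) j 0.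

(* X^{(j)}_k(x) = mu^j_k |x|^j ( C^{(n-1)/2+k}_j(x0/|x|)
     + (n+2k-1)/(n+2k+j-1) C^{(n+1)/2+k}_{j-1}(x0/|x|) xvec/|x| ) *)
Definition Xjk n (k j : nat) (x : 'rV[R]_(n.+1)) : Cl n :=
  if j is 0 then cl_one n
  else
    let r2 := eucl x ^+ 2 in
    mu n k j *:
      (hgeg ((n%:R - 1) / 2 + k%:R) j (x0 x) r2 *: cl_one n
       + ((n + 2 * k - 1)%:R / (n + 2 * k + j - 1)%:R
          * hgeg ((n%:R + 1) / 2 + k%:R) j.-1 (x0 x) r2) *: vecCl (xvec x)).

Inductive sph_norm := NormL2 | NormSup.
Definition sph_normf (nm : sph_norm) n (P : 'rV[R]_n -> Cl n) : R :=
  match nm with NormL2 => L2norm P | NormSup => supnorm P end.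

(* limsup_{j+k -> oo} ||P_{k,j}||^{1/(j+k)} = 0 (all terms are >= 0) *)
Definition root_decay (nm : sph_norm) n (P : nat -> nat -> 'rV[R]_n -> Cl n) : Prop :=
  forall eps : R, 0 < eps -> exists N : nat, forall k j : nat, (N <= j + k)%N ->
    sph_normf nm (P k j) `^ ((j + k)%:R^-1) <= eps.

Definition expansion n (P : nat -> nat -> 'rV[R]_n -> Cl n)
    (f : 'rV[R]_(n.+1) -> Cl n) : Prop :=
  forall (x : 'rV[R]_(n.+1)) (A : {set 'I_n}),
    let u : nat -> R :=
      fun N => (\sum_(j < N) \sum_(k < N) cl_mul (Xjk k j x) (P k j (xvec x))) A in
    (u @ \oo --> (f x A : R))%classic.

End Clifford.

(* Main.v *)
(* Coordinates of monogenic functions are harmonic.  For a harmonic polynomial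
   the maximum principle gives a gradient estimate on cubes, which bounds the
   degree-m homogeneous part of a harmonic sum by C^m / r^m times its maximum on
   the cube of size r.  A C^1 monogenic function is a locally uniform limit of
   harmonic polynomials (Steklov averages, Bernstein polynomials, and the
   Dirichlet problem on spheres for polynomial data), so it is a sum of
   homogeneous monogenic polynomials F_m that decay faster than any geometric
   sequence.

   On x_0 = 0 the Dirac operator acts on F_m as - d/dx_0, hence the Fischer
   decomposition F_m(0, x) = \sum_j x^j P_(m-j,j)(x) has components bounded by
   C^m times F_m.  Each X_k^(j) P_(k,j) is the unique monogenic polynomial
   restricting to x^j P_(k,j), so F_m = \sum_j X_(m-j)^(j) P_(m-j,j).
   Conversely locally uniform limits of monogenic polynomials are monogenic, by
   the gradient estimate again, and uniqueness follows from that of power series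
   along rays and of the Fischer decomposition.

   On spherical monogenics of degree k, both norms and the maximum of the
   coordinates on the unit cube agree up to factors C^(k+1), which the decay
   condition absorbs. *)

Require Import Defs.
From mathcomp Require Import all_boot all_order all_algebra.
From mathcomp Require Import all_classical all_reals all_analysis.
From mathcomp Require Import ring lra zify measurable_realfun.
Import Order.TTheory GRing.Theory Num.Theory.
Import numFieldNormedType.Exports.
Set Implicit Arguments. Unset Strict Implicit. Unset Printing Implicit Defensive.
Local Open Scope ring_scope.
Local Open Scope classical_set_scope.

(** * Laplacian, maximum principle and homogeneous polynomials *)

Section Calculus.
Variables (R : realType) (m : nat).
Implicit Types (u p q : 'rV[R]_m -> R) (x v : 'rV[R]_m) (i j : 'I_m).

(** Monogenic functions are only assumed of class C^1, so second derivatives have to be produced: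
    averages commute with a system that has constant coefficients, and they gain one derivative.

    Polynomials approximating an entire function have degrees out of control, so a bound for their
    homogeneous parts must not see the top degree. Iterating a first-order estimate k times at scale
    r / k loses k^k, which the k! in front of the degree-k part turns into a geometric factor.
    Approximants of different degrees can then be compared degree by degree.

    Every estimate may lose a factor C^m in degree m, because the decay beats all geometric
    sequences. Cubes can therefore replace balls, and constants stay crude.

    The factorials of the iterated Dirac operator have to cancel in the Fischer decomposition; this
    is why its components are extracted by an explicit projection instead of an inner product.

    The inequality 2 <= n keeps (n-1)/2 + k positive, so that [mu] never divides by 0.

    The expansion is a limit over squares j, k < N, while degrees group terms by j + k; the decay
    makes the difference of the two partial sums exponentially small. *)

Definition pd i u : 'rV[R]_m -> R := fun x => 'D_(unitv R i) u x.

Lemma derivable_line u x v t :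
  derivable u (x + t *: v) v <-> derivable (fun s : R => u (x + s *: v)) t 1.
Proof.
rewrite /derivable; have -> : (fun h : R => h^-1 *: ((u \o shift (x + t *: v)) (h *: v) - u (x + t *: v)))
  = (fun h : R => h^-1 *: (((fun s : R => u (x + s *: v)) \o shift t) (h *: 1) - u (x + t *: v))) => //.
by apply/funext => h /=; rewrite scalerDl scaler1 addrCA.
Qed.

Lemma derive_line u x v t :
  'D_v u (x + t *: v) = 'D_1 (fun s : R => u (x + s *: v)) t.
Proof.
rewrite /derive; have -> : (fun h : R => h^-1 *: ((u \o shift (x + t *: v)) (h *: v) - u (x + t *: v)))
  = (fun h : R => h^-1 *: (((fun s : R => u (x + s *: v)) \o shift t) (h *: 1) - u (x + t *: v))) => //.
by apply/funext => h /=; rewrite scalerDl scaler1 addrCA.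
Qed.

Lemma is_derive_coord x v j : is_derive x v (fun y : 'rV[R]_m => y 0 j) (v 0 j).
Proof.
apply: DeriveDef; first exact/diff_derivable/differentiable_coord.
apply: (@lim_near_cst R^o) => //.
exists 1 => //= h _ h0; rewrite !mxE /= addrK /=.
by rewrite -[_ *: _]/(_ * _) mulKf.
Qed.

Lemma unitvE i j : (unitv R i) 0 j = (i == j)%:R :> R.
Proof. by rewrite mxE eqxx eq_sym. Qed.

Lemma pd_coord i j x : pd i (fun y : 'rV[R]_m => y 0 j) x = (i == j)%:R.
Proof. by rewrite /pd (derive_val (is_derive := is_derive_coord x _ j)) unitvE. Qed.

(** [phi'] vanishes at 0. If its derivative there were positive, [phi'] would be positive just to
    the right of 0, and the mean value theorem would give a value above [phi 0]. *)
Lemma second_derivative_max (phi : R -> R) (e : R) : 0 < e ->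
  (forall t : R, derivable phi t 1) ->
  derivable (fun t => 'D_1 phi t) 0 1 ->
  (forall t, `|t| < e -> phi t <= phi 0) ->
  'D_1 (fun t => 'D_1 phi t) (0 : R) <= 0.
Proof.
move=> e0 dphi ddphi max0.
have d0 : 'D_1 phi (0 : R) = 0.
  have : is_derive (0 : R) 1 phi 0.
    apply: (@derive1_at_max R phi (- e) e 0); first by rewrite ge0_cp// ltW.
    - by move=> t _; exact: dphi.
    - by rewrite in_itv /= oppr_lt0 e0.
    - by move=> t; rewrite in_itv /= -ltr_norml => /max0.
  by move=> D; rewrite derive_val.
rewrite leNgt; apply/negP => L0.
have := ddphi; move/cvgr_gt => /(_ _ L0) [d /= dpos Hd].
pose t := Num.min d e / 2.
have t0 : 0 < t by rewrite divr_gt0 // lt_min dpos.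
have [td te] : t < d /\ t < e.
  have : t < Num.min d e by rewrite /t ltr_pdivrMr // ltr_pMr ?lt_min ?dpos// ltr1n.
  by rewrite lt_min => /andP[].
have [||c] := @MVT R phi (fun s => 'D_1 phi s) 0 t t0.
- by move=> x _; exact: (derivableP (dphi x)).
- apply: derivable_within_continuous => x _; exact: dphi.
rewrite in_itv /= => /andP[c0 ct] Ec.
have := max0 t; rewrite gtr0_norm // => /(_ te).
rewrite -subr_le0 Ec subr0; apply/negP; rewrite -ltNge mulr_gt0 //.
have /= := Hd c; rewrite sub0r normrN gtr0_norm // => /(_ (lt_trans ct td)).
rewrite d0 subr0 addr0 scaler1 => /(_ (lt0r_neq0 c0)).
by rewrite -[_ *: _]/(_ * _) pmulr_rgt0 // invr_gt0.
Qed.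

(** Only pure second derivatives are required: the Laplacian and the test at a maximum use no
    others. Symmetry of mixed derivatives is proved separately for polynomials and for averages. *)
Definition twice u := [/\ continuous u,
  forall x i, derivable u x (unitv R i) &
  forall x i, derivable (pd i u) x (unitv R i)].

Definition lap u x := \sum_i pd i (pd i u) x.

Lemma twice_max u i x e : twice u -> 0 < e ->
  (forall t, `|t| < e -> u (x + t *: unitv R i) <= u x) ->
  pd i (pd i u) x <= 0.
Proof.
move=> [cu du ddu] e0 max0.
pose phi (t : R) := u (x + t *: unitv R i).
have E : (fun t => 'D_1 phi t) = (fun t : R => pd i u (x + t *: unitv R i)).
  by apply/funext => t; rewrite /pd derive_line.
have x0 : x = x + 0 *: unitv R i by rewrite scale0r addr0.
have -> : pd i (pd i u) x = 'D_1 (fun t => 'D_1 phi t) (0 : R).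
  by rewrite {1}x0 /pd derive_line E.
apply: (second_derivative_max e0).
- by move=> t; apply/derivable_line; exact: du.
- by rewrite E; apply/derivable_line; exact: ddu.
- by move=> t te; rewrite /phi scale0r addr0; apply: max0.
Qed.

Lemma twiceD u q : twice u -> twice q -> twice (fun x => u x + q x).
Proof.
move=> [cu du ddu] [cq dq ddq]; split.
- move=> x. exact: (cvgD (cu x) (cq x)).
- by move=> x i; exact: (derivableD (du x i) (dq x i)).
- move=> x i; have -> : pd i (fun x => u x + q x) = pd i u + pd i q.
    by apply/funext => y; exact: (deriveD (du y i) (dq y i)).
  exact: (derivableD (ddu x i) (ddq x i)).
Qed.

Lemma lapD u q x : twice u -> twice q ->
  lap (fun x => u x + q x) x = lap u x + lap q x.
Proof.
move=> [cu du ddu] [cq dq ddq]; rewrite /lap -big_split; apply: eq_bigr => i _.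
have -> : pd i (fun x => u x + q x) = pd i u + pd i q.
  by apply/funext => y; exact: (deriveD (du y i) (dq y i)).
exact: (deriveD (ddu x i) (ddq x i)).
Qed.

Lemma twiceZ (c : R) u : twice u -> twice (fun x => c * u x).
Proof.
move=> [cu du ddu]; split.
- move=> x; exact: (cvgM (cvg_cst c) (cu x)).
- by move=> x i; exact: (derivableZ (du x i)).
- move=> x i; have -> : pd i (fun x => c * u x) = c \*: pd i u.
    by apply/funext => y; exact: (deriveZ c (du y i)).
  exact: (derivableZ (ddu x i)).
Qed.

Lemma lapZ (c : R) u x : twice u -> lap (fun x => c * u x) x = c * lap u x.
Proof.
move=> [cu du ddu]; rewrite /lap mulr_sumr; apply: eq_bigr => i _.
have -> : pd i (fun x => c * u x) = c \*: pd i u.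
  by apply/funext => y; exact: (deriveZ c (du y i)).
exact: (deriveZ c (ddu x i)).
Qed.

Lemma continuous_coord j : continuous (fun x : 'rV[R]_m => x 0 j).
Proof. by move=> x; exact/differentiable_continuous/differentiable_coord. Qed.

Lemma pd_sqcoord i j x : pd i (fun y : 'rV[R]_m => y 0 j ^+ 2) x = 2 * (i == j)%:R * x 0 j.
Proof.
have D := is_derive_coord x (unitv R i) j.
have := @is_deriveX _ _ _ 2 x (unitv R i) _ D => D2; rewrite /pd (derive_val (is_derive := D2)).
by rewrite unitvE /= -[_ *: _]/(_ * _) /=; ring.
Qed.

Lemma twice_sqcoord j : twice (fun y : 'rV[R]_m => y 0 j ^+ 2).
Proof.
split.
- by move=> x; exact: (cvgM (@continuous_coord j x) (@continuous_coord j x)).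
- move=> x i; exact: (ex_derive (is_derive := @is_deriveX _ _ _ 2 x (unitv R i) _ (is_derive_coord x (unitv R i) j))).
- move=> x i; have -> : pd i (fun y : 'rV[R]_m => y 0 j ^+ 2) = (2 * (i == j)%:R) \*: (fun y : 'rV[R]_m => y 0 j).
    by apply/funext => y; rewrite pd_sqcoord.
  by apply/derivableZ/ex_derive/is_derive_coord.
Qed.

Lemma lap_sqcoord j x : lap (fun y : 'rV[R]_m => y 0 j ^+ 2) x = 2.
Proof.
rewrite /lap (bigD1 j) //= big1 => [|i ij].
- have -> : pd j (fun y : 'rV[R]_m => y 0 j ^+ 2) = 2 \*: (fun y : 'rV[R]_m => y 0 j).
    by apply/funext => y; rewrite pd_sqcoord eqxx mulr1.
  rewrite /pd deriveZ; last exact/ex_derive/is_derive_coord.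
  by rewrite -/(pd _ _ _) pd_coord eqxx addr0 -[_ *: _]/(_ * _) mulr1.
have -> : pd i (fun y : 'rV[R]_m => y 0 j ^+ 2) = cst 0.
  by apply/funext => y; rewrite pd_sqcoord (negbTE ij) mulr0 mul0r.
by rewrite /pd derive_cst.
Qed.

Lemma lap_coord j x : lap (fun y : 'rV[R]_m => y 0 j) x = 0.
Proof.
rewrite /lap big1 // => i _.
have -> : pd i (fun y : 'rV[R]_m => y 0 j) = cst (i == j)%:R.
  by apply/funext => y; rewrite pd_coord.
by rewrite /pd derive_cst.
Qed.

Lemma twice_sum (I : finType) (P : pred I) (F : I -> 'rV[R]_m -> R) :
  (forall k, twice (F k)) ->
  twice (fun x => \sum_(k | P k) F k x) /\
  forall x, lap (fun x => \sum_(k | P k) F k x) x = \sum_(k | P k) lap (F k) x.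
Proof.
move=> tF; rewrite /index_enum; elim: (Finite.enum I) => [|k s [IH1 IH2]].
  have Z : pd^~ (fun=> 0) = (fun=> cst 0).
    by apply/funext => i; apply/funext => y; rewrite /pd derive_cst.
  have -> : (fun x => \sum_(k <- [::] | P k) F k x) = cst 0.
    by apply/funext => x; rewrite big_nil.
  split; first by split=> [||x i]; [exact: cst_continuous|move=> x i; exact: derivable_cst|
    rewrite (congr1 (@^~ i) Z); exact: derivable_cst].
  move=> x; rewrite big_nil /lap big1 // => i _.
  by rewrite (congr1 (@^~ i) Z) /pd derive_cst.
have -> : (fun x => \sum_(k <- k :: s | P k) F k x) =
  (fun x => (P k)%:R * F k x + \sum_(k <- s | P k) F k x).
  by apply/funext => x; rewrite big_cons; case: (P k); rewrite ?mul1r// mul0r add0r.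
split; first exact: (twiceD (twiceZ _ (tF k)) IH1).
move=> x; rewrite (lapD x (twiceZ _ (tF k)) IH1).
rewrite (lapZ _ x (tF k)) IH2 big_cons.
by case: (P k); rewrite ?mul1r// mul0r add0r.
Qed.

(* Adding [eps * |x|^2] makes the Laplacian strictly positive. *)
Lemma max_principle u (K S : set 'rV[R]_m) (M : R) : (0 < m)%N -> twice u -> compact K ->
  (forall x, K x -> ~ S x -> forall i, exists2 e : R, 0 < e &
      forall t, `|t| < e -> K (x + t *: unitv R i)) ->
  (forall x, K x -> ~ S x -> 0 <= lap u x) ->
  (forall x, K x -> S x -> u x <= M) ->
  forall x, K x -> u x <= M.
Proof.
move=> m0 tu cK inn lapu bd x Kx.
pose q (x : 'rV[R]_m) := \sum_j x 0 j ^+ 2.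
have [tq lq] := @twice_sum _ predT (fun j y => y 0 j ^+ 2) twice_sqcoord.
have K0 : K !=set0 by exists x.
have [b _ qb] : exists2 c, c \in K & forall t, t \in K -> q t <= q c.
  apply: EVT_max_rV => //; apply: continuous_subspaceT; by case: tq.
have q0 y : 0 <= q y by apply: sumr_ge0 => j _; exact: sqr_ge0.
suff H eps : 0 < eps -> u x <= M + eps * q b.
  apply/ler_addgt0Pr => eps e0.
  apply: (le_trans (H (eps / (q b + 1)) _)).
    by rewrite divr_gt0// ltr_wpDl.
  rewrite lerD2l mulrAC -mulrA ler_piMr//; first exact: ltW.
  by rewrite ler_pdivrMr ?mul1r ?lerDl// ltr_wpDl.
move=> e0; have teq := twiceZ eps tq; have tw := twiceD tu teq.
have [c /set_mem Kc cmax] : exists2 c, c \in K &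
   forall t, t \in K -> u t + eps * q t <= u c + eps * q c.
  by apply: EVT_max_rV => //; apply: continuous_subspaceT; case: tw.
have [Sc|Sc] := pselect (S c).
  apply: (le_trans _ (lerD (bd c Kc Sc) (ler_wpM2l (ltW e0) (qb c (mem_set Kc))))).
  by apply: le_trans (cmax x (mem_set Kx)); rewrite lerDl mulr_ge0// ltW.
exfalso.
have : lap (fun x => u x + eps * q x) c <= 0.
  apply: sumr_le0 => i _.
  have [e ep He] := inn c Kc Sc i.
  by apply: (twice_max tw ep) => t te; apply: cmax; rewrite inE; exact: He.
rewrite (lapD c tu teq) (lapZ eps c tq) lq; apply/negP; rewrite -ltNge ltr_wpDl ?lapu//.
rewrite mulr_gt0//; under eq_bigr do rewrite lap_sqcoord.
by rewrite sumr_const card_ord pmulrn_lgt0.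
Qed.

End Calculus.

(** * Homogeneous polynomials, Euler's identity and affine substitutions *)

Section Polynomials.
Variables (R : realType) (m : nat).
Implicit Types (u p q : 'rV[R]_m -> R) (x v w : 'rV[R]_m) (i j : 'I_m) (k l : nat).

Definition dff u := forall x, differentiable u x.

Lemma dff_derivable u x v : dff u -> derivable u x v.
Proof. by move=> du; exact/diff_derivable/du. Qed.

Lemma dff_continuous u : dff u -> continuous u.
Proof. by move=> du x; exact/differentiable_continuous/du. Qed.

Lemma dff_cst (c : R) : dff (fun=> c).
Proof. by move=> x; exact: differentiable_cst. Qed.

Lemma dff_coord j : dff (fun x => x 0 j).
Proof. by move=> x; exact: differentiable_coord. Qed.

Lemma dffD u q : dff u -> dff q -> dff (fun x => u x + q x).
Proof. by move=> du dq x; exact: (differentiableD (du x) (dq x)). Qed.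

Lemma dffM u q : dff u -> dff q -> dff (fun x => u x * q x).
Proof. by move=> du dq x; exact: (differentiableM (du x) (dq x)). Qed.

Lemma dff_sum (I : Type) (r : seq I) (P : pred I) (F : I -> 'rV[R]_m -> R) :
  (forall a, dff (F a)) -> dff (fun x => \sum_(a <- r | P a) F a x).
Proof.
move=> dF; elim: r => [|a r IH].
  rewrite (_ : (fun _ => _) = fun=> 0); first exact: dff_cst.
  by apply/funext => x; rewrite big_nil.
rewrite (_ : (fun _ => _) = (fun x => (P a)%:R * F a x + \sum_(a <- r | P a) F a x)).
  exact: (dffD (dffM (dff_cst _) (dF a)) IH).
by apply/funext => x; rewrite big_cons; case: (P a); rewrite ?mul1r// mul0r add0r.
Qed.

Lemma DvC (c : R) v x : 'D_v (fun=> c) x = 0.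
Proof. exact: derive_cst. Qed.

Lemma Dv_coord v j x : 'D_v (fun y : 'rV[R]_m => y 0 j) x = v 0 j.
Proof. exact: (derive_val (is_derive := is_derive_coord x v j)). Qed.

Lemma DvD v u q x : dff u -> dff q ->
  'D_v (fun y => u y + q y) x = 'D_v u x + 'D_v q x.
Proof. by move=> du dq; exact: (deriveD (dff_derivable du) (dff_derivable dq)). Qed.

Lemma DvM v u q x : dff u -> dff q ->
  'D_v (fun y => u y * q y) x = u x * 'D_v q x + q x * 'D_v u x.
Proof. by move=> du dq; exact: (deriveM (dff_derivable du) (dff_derivable dq)). Qed.

Lemma DvZ (c : R) v u x : dff u -> 'D_v (fun y => c * u y) x = c * 'D_v u x.
Proof. by move=> du; rewrite (DvM v x (dff_cst c) du) DvC mulr0 addr0. Qed.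

Lemma Dv_sum (I : Type) (r : seq I) (P : pred I) (F : I -> 'rV[R]_m -> R) v x :
  (forall a, dff (F a)) ->
  'D_v (fun y => \sum_(a <- r | P a) F a y) x = \sum_(a <- r | P a) 'D_v (F a) x.
Proof.
move=> dF; elim: r => [|a r IH].
  rewrite (_ : (fun _ => _) = fun=> 0) ?DvC ?big_nil//.
  by apply/funext => y; rewrite big_nil.
rewrite (_ : (fun _ => _) = (fun x => (P a)%:R * F a x + \sum_(a <- r | P a) F a x)).
  rewrite (DvD v x (dffM (dff_cst _) (dF a)) (dff_sum r P dF)) (DvZ _ v x (dF a)) IH big_cons.
  by case: (P a); rewrite ?mul1r// mul0r add0r.
by apply/funext => y; rewrite big_cons; case: (P a); rewrite ?mul1r// mul0r add0r.
Qed.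

Lemma rV_unitv v : v = \sum_i v 0 i *: unitv R i.
Proof. exact: row_sum_delta. Qed.

Lemma Dv_pd u v x : dff u -> 'D_v u x = \sum_i v 0 i * pd i u x.
Proof.
move=> du; rewrite (deriveE _ (du x)) {1}(rV_unitv v) linear_sum.
by apply: eq_bigr => i _; rewrite linearZ /= /pd (deriveE _ (du x)).
Qed.

(* Recursive form of a homogeneous polynomial function: degree k+1 means
   [\sum_i x_i * q_i] with every [q_i] of degree k. *)
Fixpoint hpoly k p : Prop :=
  if k is k'.+1 then
    exists2 q : 'I_m -> 'rV[R]_m -> R, forall i, hpoly k' (q i) &
      p = (fun x => \sum_i x 0 i * q i x)
  else exists c, p = fun=> c.

Lemma hpoly0 k : hpoly k (fun=> 0).
Proof.
elim: k => [|k IH] /=; first by exists 0.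
exists (fun _ _ => 0) => //.
by apply/funext => x; rewrite big1 // => i _; rewrite mulr0.
Qed.

Lemma hpolyD k p q : hpoly k p -> hpoly k q -> hpoly k (fun x => p x + q x).
Proof.
elim: k p q => [p q [c ->] [d ->]|k IH p q [p' hp ->] [q' hq ->]] /=; first by exists (c + d).
exists (fun i x => p' i x + q' i x) => [i|]; first exact: IH (hp i) (hq i).
by apply/funext => x; rewrite -big_split; apply: eq_bigr => i _; rewrite mulrDr.
Qed.

Lemma hpolyZ k (c : R) p : hpoly k p -> hpoly k (fun x => c * p x).
Proof.
elim: k p => [p [d ->]|k IH p [p' hp ->]] /=; first by exists (c * d).
exists (fun i x => c * p' i x) => [i|]; first exact: IH (hp i).
by apply/funext => x; rewrite mulr_sumr; apply: eq_bigr => i _; rewrite mulrCA.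
Qed.

Lemma hpoly_sum k (I : Type) (r : seq I) (P : pred I) (F : I -> 'rV[R]_m -> R) :
  (forall a, P a -> hpoly k (F a)) -> hpoly k (fun x => \sum_(a <- r | P a) F a x).
Proof.
move=> hF; elim: r => [|a r IH].
  rewrite (_ : (fun _ => _) = fun=> 0); first exact: hpoly0.
  by apply/funext => x; rewrite big_nil.
rewrite (_ : (fun _ => _) = (fun x => (if P a then F a x else 0) + \sum_(a <- r | P a) F a x)).
  apply: hpolyD IH; case E: (P a); [exact: hF|exact: hpoly0].
by apply/funext => x; rewrite big_cons; case: (P a) => //; rewrite add0r.
Qed.

Lemma hpolyX k i p : hpoly k p -> hpoly k.+1 (fun x => x 0 i * p x).
Proof.
move=> hp; exists (fun j x => (i == j)%:R * p x) => [j|]; first exact: hpolyZ.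
apply/funext => x; rewrite (bigD1 i)//= eqxx mul1r big1 ?addr0// => j ij.
by rewrite eq_sym (negbTE ij) mul0r mulr0.
Qed.

Lemma hpoly_coord i : hpoly 1 (fun x => x 0 i).
Proof.
have := @hpolyX 0 i (fun=> 1) (ex_intro _ 1 erefl).
by under eq_fun do rewrite mulr1.
Qed.

Lemma hpolyM k l p q : hpoly k p -> hpoly l q -> hpoly (k + l) (fun x => p x * q x).
Proof.
move=> + hq; elim: k p => [p [c ->]|k IH p [p' hp ->]]; first exact: hpolyZ.
exists (fun i x => p' i x * q x) => [i|]; first exact: IH (hp i).
by apply/funext => x; rewrite mulr_suml; apply: eq_bigr => i _; rewrite mulrA.
Qed.

Lemma hpolyXn i k : hpoly k (fun x => x 0 i ^+ k).
Proof.
elim: k => [|k IH]; first by exists 1; apply/funext => x; rewrite expr0.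
by under eq_fun do rewrite exprS; exact: hpolyX.
Qed.

Lemma hpoly_hom k p x (t : R) : hpoly k p -> p (t *: x) = t ^+ k * p x.
Proof.
elim: k p => [p [c ->]|k IH p [q hq ->]]; first by rewrite expr0 mul1r.
rewrite mulr_sumr; apply: eq_bigr => i _.
by rewrite (IH _ (hq i)) mxE exprS; ring.
Qed.

Lemma hpoly_at0 k p : hpoly k.+1 p -> p 0 = 0.
Proof. by move=> hp; rewrite -(scale0r 0) (hpoly_hom _ _ hp) exprS !mul0r. Qed.

Lemma hpoly_dff k p : hpoly k p -> dff p.
Proof.
elim: k p => [p [c ->]|k IH p [q hq ->]]; first exact: dff_cst.
apply: dff_sum => i; exact: (dffM (dff_coord i) (IH _ (hq i))).
Qed.

Lemma hpoly_DvS k (q : 'I_m -> 'rV[R]_m -> R) v x : (forall i, hpoly k (q i)) ->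
  'D_v (fun x => \sum_i x 0 i * q i x) x = \sum_i (x 0 i * 'D_v (q i) x + v 0 i * q i x).
Proof.
move=> hq; have dq i := hpoly_dff (hq i).
rewrite (Dv_sum _ _ v x (fun i => dffM (dff_coord i) (dq i))).
apply: eq_bigr => i _; rewrite (DvM v x (dff_coord i) (dq i)) Dv_coord; ring.
Qed.

Lemma hpoly_Dv k p v : hpoly k p -> hpoly k.-1 (fun x => 'D_v p x).
Proof.
elim: k p => [p [c ->]|k IH p [q hq ->]].
  by exists 0; apply/funext => x; rewrite DvC.
have -> : (fun x => 'D_v (fun x0 => \sum_i x0 0 i * q i x0) x) =
  (fun x => \sum_i (x 0 i * 'D_v (q i) x + v 0 i * q i x)).
  by apply/funext => x; exact: hpoly_DvS hq.
apply: hpoly_sum => i _; apply: hpolyD; last exact: hpolyZ (hq i).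
(* For [k = 0] the product rule seems to leave a term of degree 1, but the derivative of the
   constant [q i] is 0, which is homogeneous of every degree. *)
case: k IH hq => [_ hq|k IH hq]; last by apply: hpolyX; exact: IH.
have [c ->] := hq i; exists 0; apply/funext => x.
by rewrite DvC mulr0.
Qed.

Lemma hpoly_pd k p i : hpoly k p -> hpoly k.-1 (pd i p).
Proof. exact: hpoly_Dv. Qed.

Lemma hpoly0_Dv p v x : hpoly 0 p -> 'D_v p x = 0.
Proof. by case=> c ->; rewrite DvC. Qed.

Lemma hpoly_euler k p x : hpoly k p -> 'D_x p x = k%:R * p x.
Proof.
elim: k p => [p hp|k IH p [q hq ->]]; first by rewrite hpoly0_Dv// mul0r.
rewrite (hpoly_DvS x x hq) mulr_sumr; apply: eq_bigr => i _.
by rewrite (IH _ (hq i)) -(addn1 k) natrD; ring.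
Qed.

Lemma hpoly_DvC k p v w x : hpoly k p ->
  'D_v (fun y => 'D_w p y) x = 'D_w (fun y => 'D_v p y) x.
Proof.
elim: k p x => [p x [c ->]|k IH p x [q hq ->]].
  have Z v' : (fun y : 'rV[R]_m => 'D_v' (fun=> c) y) = fun=> 0.
    by apply/funext=> y; rewrite DvC.
  by rewrite !Z !DvC.
have E v' : (fun y => 'D_v' (fun x0 : 'rV[R]_m => \sum_i x0 0 i * q i x0) y) =
    fun y => \sum_i (y 0 i * 'D_v' (q i) y + v' 0 i * q i y).
  by apply/funext => y; rewrite (hpoly_DvS v' y hq).
have dq i := hpoly_dff (hq i).
have dDq v' i := hpoly_dff (hpoly_Dv v' (hq i)).
have dt v' i := dffD (dffM (dff_coord i) (dDq v' i)) (dffM (dff_cst (v' 0 i)) (dq i)).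
rewrite !E (Dv_sum _ _ v x (dt w)) (Dv_sum _ _ w x (dt v)); apply: eq_bigr => i _.
rewrite (DvD v x (dffM (dff_coord i) (dDq w i)) (dffM (dff_cst (w 0 i)) (dq i))).
rewrite (DvD w x (dffM (dff_coord i) (dDq v i)) (dffM (dff_cst (v 0 i)) (dq i))).
rewrite (DvM v x (dff_coord i) (dDq w i)) (DvM w x (dff_coord i) (dDq v i)).
by rewrite (DvZ _ v x (dq i)) (DvZ _ w x (dq i)) !Dv_coord (IH _ x (hq i)); ring.
Qed.

(** The parts are indexed by their degree, so two polynomials can be compared part by part. *)
Definition pol p := exists d (q : nat -> 'rV[R]_m -> R),
  (forall k, hpoly k (q k)) /\ p = fun x => \sum_(k < d) q k x.

Lemma pol_hpoly k p : hpoly k p -> pol p.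
Proof.
move=> hp; exists k.+1, (fun l x => if l == k then p x else 0); split.
  by move=> l; case: eqP => [->//|_]; exact: hpoly0.
apply/funext => x; rewrite big_ord_recr /= eqxx big1 ?add0r// => i _.
by rewrite ltn_eqF.
Qed.

Lemma polD p q : pol p -> pol q -> pol (fun x => p x + q x).
Proof.
move=> [d [p' [hp ->]]] [e [q' [hq ->]]].
exists (maxn d e), (fun k x => (k < d)%N%:R * p' k x + (k < e)%N%:R * q' k x); split.
  by move=> k; apply: hpolyD; exact: hpolyZ.
apply/funext => x; rewrite big_split /=; congr (_ + _).
- rewrite -[RHS](big_mkord predT (fun k => (k < d)%N%:R * p' k x)) (big_cat_nat _ (leq_maxl d e))//=.
  rewrite [X in _ + X]big1_seq ?addr0 => [|i /andP[_]]; last first.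
    by rewrite mem_index_iota => /andP[di _]; rewrite ltnNge di mul0r.
  by rewrite big_mkord; apply: eq_bigr => i _; rewrite ltn_ord mul1r.
- rewrite -[RHS](big_mkord predT (fun k => (k < e)%N%:R * q' k x)) (big_cat_nat _ (leq_maxr d e))//=.
  rewrite [X in _ + X]big1_seq ?addr0 => [|i /andP[_]]; last first.
    by rewrite mem_index_iota => /andP[di _]; rewrite ltnNge di mul0r.
  by rewrite big_mkord; apply: eq_bigr => i _; rewrite ltn_ord mul1r.
Qed.

Lemma pol_cst (c : R) : pol (fun=> c).
Proof. by apply: (@pol_hpoly 0); exists c. Qed.

Lemma pol_coord i : pol (fun x => x 0 i).
Proof. exact: pol_hpoly (hpoly_coord i). Qed.

Lemma pol_sum (I : Type) (r : seq I) (P : pred I) (F : I -> 'rV[R]_m -> R) :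
  (forall a, P a -> pol (F a)) -> pol (fun x => \sum_(a <- r | P a) F a x).
Proof.
move=> hF; elim: r => [|a r IH].
  rewrite (_ : (fun _ => _) = fun=> 0); first exact: pol_cst.
  by apply/funext => x; rewrite big_nil.
rewrite (_ : (fun _ => _) = (fun x => (if P a then F a x else 0) + \sum_(a <- r | P a) F a x)).
  apply: polD IH; case E: (P a); [exact: hF|exact: pol_cst].
by apply/funext => x; rewrite big_cons; case: (P a) => //; rewrite add0r.
Qed.

Lemma polM p q : pol p -> pol q -> pol (fun x => p x * q x).
Proof.
move=> [d [p' [hp ->]]] [e [q' [hq ->]]].
under eq_fun do rewrite mulr_suml; apply: pol_sum => k _.
under eq_fun do rewrite mulr_sumr; apply: pol_sum => l _.
exact: pol_hpoly (hpolyM (hp k) (hq l)).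
Qed.

Lemma polZ (c : R) p : pol p -> pol (fun x => c * p x).
Proof. by move=> pp; exact: (polM (pol_cst c) pp). Qed.

Lemma polX p k : pol p -> pol (fun x => p x ^+ k).
Proof.
move=> pp; elim: k => [|k IH].
  by under eq_fun do rewrite expr0; exact: pol_cst.
by under eq_fun do rewrite exprS; exact: polM.
Qed.

Lemma pol_dff p : pol p -> dff p.
Proof. by move=> [d [q [hq ->]]]; apply: dff_sum => i; exact: hpoly_dff (hq i). Qed.

Lemma pol_Dv p v : pol p -> pol (fun x => 'D_v p x).
Proof.
move=> [d [q [hq ->]]].
rewrite (_ : (fun x => _) = fun x => \sum_(k < d) 'D_v (q k) x).
  by apply: pol_sum => k _; exact: pol_hpoly (hpoly_Dv v (hq k)).
by apply/funext => x; rewrite (Dv_sum _ _ v x (fun k : 'I_d => hpoly_dff (hq k))).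
Qed.

Lemma pol_pd p i : pol p -> pol (pd i p). Proof. exact: pol_Dv. Qed.

Lemma pol_DvC p v w x : pol p ->
  'D_v (fun y => 'D_w p y) x = 'D_w (fun y => 'D_v p y) x.
Proof.
move=> [d [q [hq ->]]].
have dq (k : 'I_d) := hpoly_dff (hq k).
have dDq v' (k : 'I_d) := hpoly_dff (hpoly_Dv v' (hq k)).
have E v' : (fun y => 'D_v' (fun x => \sum_(k < d) q k x) y) = fun y => \sum_(k < d) 'D_v' (q k) y.
  by apply/funext => y; rewrite (Dv_sum _ _ v' y dq).
rewrite !E (Dv_sum _ _ v x (dDq w)) (Dv_sum _ _ w x (dDq v)).
by apply: eq_bigr => k _; rewrite (hpoly_DvC v w x (hq k)).
Qed.

Lemma pol_twice p : pol p -> twice p.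
Proof.
move=> pp; split.
- exact/dff_continuous/pol_dff.
- by move=> x i; exact/dff_derivable/pol_dff.
- by move=> x i; exact/dff_derivable/pol_dff/pol_pd.
Qed.

Lemma pol_continuous p : pol p -> continuous p.
Proof. by move=> pp; exact/dff_continuous/pol_dff. Qed.

Lemma hpoly_lap k p : hpoly k p -> hpoly k.-2 (lap p).
Proof. by move=> hp; apply: hpoly_sum => i _; exact/hpoly_pd/hpoly_pd. Qed.

Lemma pol_lap_Dv p v x : pol p -> lap (fun y => 'D_v p y) x = 'D_v (lap p) x.
Proof.
move=> pp; have E := Dv_sum (index_enum 'I_m) xpredT v x (fun i => pol_dff (pol_pd i (pol_pd i pp))).
apply: etrans (esym E).
apply: eq_bigr => i _.
have -> : pd i (fun y => 'D_v p y) = (fun y => 'D_v (pd i p) y).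
  by apply/funext => y; exact: (pol_DvC (unitv R i) v y pp).
exact: (pol_DvC (unitv R i) v x (pol_pd i pp)).
Qed.

Definition affine (a c : 'I_m -> R) x : 'rV[R]_m := \row_i (a i + c i * x 0 i).

Lemma pol_affine p a c : pol p -> pol (fun x => p (affine a c x)).
Proof.
move=> [d [q [hq ->]]]; apply: pol_sum => k _.
have := hq k; elim: (k : nat) (q k) => [p' [b ->]|k' IH p' [q' hq' ->]]; first exact: pol_cst.
apply: pol_sum => i _; apply: polM; last exact: IH (hq' i).
rewrite (_ : (fun x => _) = fun x => a i + c i * x 0 i); last by apply/funext => x; rewrite mxE.
by apply: polD; [exact: pol_cst|apply: polZ; exact: pol_coord].
Qed.

Lemma affine_line a c x i (t : R) :
  affine a c (x + t *: unitv R i) = affine a c x + t *: (c i *: unitv R i).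
Proof.
apply/rowP => j; rewrite !mxE eqxx /= eq_sym.
by case: eqP => [->|_]; rewrite ?mulr1n ?mulr0n; ring.
Qed.

Lemma pd_affine u a c i x : dff u ->
  pd i (fun y => u (affine a c y)) x = c i * pd i u (affine a c x).
Proof.
move=> du; have x0 w : w = w + (0 : R) *: unitv R i by rewrite scale0r addr0.
have -> : pd i (fun y => u (affine a c y)) x = 'D_(c i *: unitv R i) u (affine a c x).
  rewrite {1}(x0 x) /pd derive_line.
  have -> : (fun s : R => u (affine a c (x + s *: unitv R i)))
    = (fun s : R => u (affine a c x + s *: (c i *: unitv R i))).
    by apply/funext => s; rewrite affine_line.
  by rewrite -derive_line scale0r addr0.
rewrite (deriveE _ (du _)) linearZ /= /pd (deriveE _ (du _)); done.
Qed.

(** Prescribing only the squares of the factors covers dilations and reflections of single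
    coordinates alike. *)
Lemma lap_affine p a c (r : R) x : pol p -> (forall i, c i ^+ 2 = r) ->
  lap (fun y => p (affine a c y)) x = r * lap p (affine a c x).
Proof.
move=> pp cr; rewrite /lap mulr_sumr; apply: eq_bigr => i _.
have -> : pd i (fun y => p (affine a c y)) = fun y => c i * pd i p (affine a c y).
  by apply/funext => y; rewrite pd_affine//; exact: pol_dff.
rewrite /pd (DvZ _ _ _ (pol_dff (pol_affine a c (pol_pd i pp)))).
rewrite -[X in c i * X]/(pd i (fun y => pd i p (affine a c y)) x).
rewrite pd_affine; last exact/pol_dff/pol_pd.
by rewrite mulrA -expr2 cr.
Qed.

End Polynomials.

(** * Gradient estimate for harmonic polynomials *)

Section GradientEstimate.
Variables (R : realType) (m : nat).
Hypothesis m0 : (0 < m)%N.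
Implicit Types (u p q : 'rV[R]_m -> R) (x y v w : 'rV[R]_m) (i j : 'I_m) (k l : nat).

Definition harmfun p := forall x, lap p x = 0.

Definition cube y (r : R) : set 'rV[R]_m := [set x | forall i, `|x 0 i - y 0 i| <= r].

Lemma le0_right_derive (phi : R -> R) : derivable phi 0 1 -> phi 0 = 0 ->
  (forall t : R, 0 <= t <= 1 -> phi t <= 0) -> 'D_1 phi (0 : R) <= 0.
Proof.
move=> dphi phi0 H; rewrite leNgt; apply/negP => L0.
have := dphi; move/cvgr_gt => /(_ _ L0) [d /= dpos Hd].
pose t := Num.min d 1 / 2.
have t0 : 0 < t by rewrite divr_gt0 // lt_min dpos ltr01.
have [td te] : t < d /\ t < 1.
  have : t < Num.min d 1 by rewrite /t ltr_pdivrMr // ltr_pMr ?ltr1n// lt_min dpos ltr01.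
  by rewrite lt_min => /andP[].
have /= := Hd t; rewrite sub0r normrN gtr0_norm // => /(_ td) /(_ (lt0r_neq0 t0)).
rewrite phi0 subr0 addr0 scaler1 -[_ *: _]/(_ * _) pmulr_rgt0 ?invr_gt0//.
by apply/negP; rewrite -leNgt H// !ltW.
Qed.

Lemma box_interior (lo hi : 'I_m -> R) x i :
  (forall i, lo i <= x 0 i <= hi i) -> lo i < x 0 i -> x 0 i < hi i ->
  exists2 e : R, 0 < e & forall t : R, `|t| < e ->
    forall l : 'I_m, lo l <= (x + t *: unitv R i) 0 l <= hi l.
Proof.
move=> bx lx xh; exists (Num.min (x 0 i - lo i) (hi i - x 0 i)).
  by rewrite lt_min !subr_gt0 lx xh.
move=> t; rewrite lt_min => /andP[t1 t2] l; rewrite !mxE eqxx /=.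
have /andP[b1 b2] := bx l.
case: eqP => [->|_]; last by rewrite mulr0 addr0 b1 b2.
rewrite mulr1; move: t1 t2; rewrite !ltr_norml => /andP[t1 t1'] /andP[t2 t2'].
by apply/andP; split; lra.
Qed.

(* Barrier argument on the half cube [x_j >= 0]: the odd part of [p] in [x_j]
   vanishes on [x_j = 0], where the harmonic function
   [\sum_i kap_i x_i^2 + m x_j] is nonnegative; on the other faces the latter is
   at least 1. *)
Lemma grad_unit p j M : pol p -> harmfun p ->
  (forall x, cube 0 1 x -> `|p x| <= M) -> pd j p 0 <= m%:R * M.
Proof.
move=> pp hp bp.
have M0 : 0 <= M by apply: le_trans (bp 0 _) => // i; rewrite subrr normr0.
pose c i : R := if i == j then -1 else 1.
pose sg := affine (fun=> 0) c.
(* The weights add up to 0, which makes the quadratic form harmonic. *)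
pose kap i : R := if i == j then - (m.-1)%:R else 1.
pose u x := (1/2 * p x + (- (1/2)) * p (sg x)) + (- M) * (\sum_i kap i * x 0 i ^+ 2 + m%:R * x 0 j).
have ps : pol (fun x => p (sg x)) by exact: pol_affine.
have pq : pol (fun x : 'rV[R]_m => \sum_i kap i * x 0 i ^+ 2).
  by apply: pol_sum => i _; apply: polZ; apply: polX; exact: pol_coord.
have pj := polZ m%:R (@pol_coord R m j).
have pb := polD pq pj.
have pw := polD (polZ (1/2) pp) (polZ (-(1/2)) ps).
have pu : pol u := polD pw (polZ (- M) pb).
have hs x : lap (fun x => p (sg x)) x = 0.
  rewrite (@lap_affine _ _ p _ _ 1) ?hp ?mulr0// => i.
  by rewrite /c; case: ifP; rewrite ?sqrrN expr1n.
have hu x : lap u x = 0.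
  rewrite /u (lapD x (pol_twice pw) (pol_twice (polZ (- M) pb))).
  rewrite (lapD x (pol_twice (polZ (1/2) pp)) (pol_twice (polZ (-(1/2)) ps))).
  rewrite (lapZ _ x (pol_twice pp)) (lapZ _ x (pol_twice ps)) hp hs !mulr0 !add0r.
  rewrite (lapZ _ x (pol_twice pb)) (lapD x (pol_twice pq) (pol_twice pj)).
  rewrite (lapZ _ x (pol_twice (@pol_coord R m j))) lap_coord mulr0 addr0.
  have tw i : twice (fun x : 'rV[R]_m => kap i * x 0 i ^+ 2) := twiceZ (kap i) (@twice_sqcoord R m i).
  have [_ ->] := twice_sum predT tw.
  under eq_bigr => i _ do rewrite (lapZ _ x (@twice_sqcoord R m i)) lap_sqcoord.
  rewrite (bigD1 j)//= /kap eqxx (eq_bigr (fun=> 2)) => [|i /negbTE ->]; last by rewrite mul1r.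
  rewrite sumr_const -[#|_|]/(#|[pred i | i != j]|) cardC1 card_ord -[in X in _ + X]mulr_natl.
  ring.
pose lo i : R := if i == j then 0 else -1.
pose K : set 'rV[R]_m := [set x | forall i, (`[lo i, 1]%classic : set R) (x ord0 i)].
pose S : set 'rV[R]_m := [set x | exists i, x 0 i = lo i \/ x 0 i = 1].
have cK : compact K.
  apply: (@rV_compact R m (fun i => `[lo i, 1]%classic)) => i; exact: segment_compact.
have KE x : K x <-> forall i, lo i <= x 0 i <= 1.
  by split => H i; have := H i; rewrite /= in_itv.
have lo1 i : lo i < 1 by rewrite /lo; case: ifP => _; lra.
have abs1 x i : K x -> `|x 0 i| <= 1.
  move=> /KE /(_ i) /andP[]; rewrite ler_norml /lo; case: ifP => _ h1 h2; apply/andP; split; lra.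
have ule x : K x -> u x <= 0.
  apply: (@max_principle R m u K S 0 m0 (pol_twice pu) cK).
  - move=> y /KE Ky Sy i.
    have /andP[h1 h2] := Ky i.
    have lt1 : lo i < y 0 i.
      by rewrite lt_neqAle h1 andbT; apply/eqP => e; apply: Sy; exists i; left.
    have lt2 : y 0 i < 1.
      by rewrite lt_neqAle h2 andbT; apply/eqP => e; apply: Sy; exists i; right.
    have [e e0 He] := @box_interior lo (fun=> 1) y i Ky lt1 lt2.
    by exists e => // t te; apply/KE; exact: He.
  - by move=> y _ _; rewrite hu.
  move=> y Ky [i Si].
  have [yj0|yj0] := eqVneq (y 0 j) 0.
    have -> : u y = - M * \sum_i kap i * y 0 i ^+ 2.
      rewrite /u; have -> : sg y = y.
        apply/rowP => l; rewrite mxE /c; case: eqP => [->|_]; last by rewrite mul1r add0r.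
        by rewrite yj0 mulr0 addr0.
      by rewrite yj0; ring.
    rewrite mulNr oppr_le0 mulr_ge0// sumr_ge0// => l _; rewrite /kap.
    by case: eqP => [->|_]; rewrite ?yj0 ?expr0n ?mulr0 // mul1r sqr_ge0.
  have yj1 : 0 <= y 0 j <= 1 by have /KE/(_ j) := Ky; rewrite /lo eqxx.
  (* On a face where [x_i] is 1 or -1, i other than j, the square of [x_i] contributes 1, and
     [m t - (m-1) t^2] is nonnegative for t in [0, 1]. On the face [x_j = 1] the latter expression
     itself equals 1. *)
  have key : 1 <= \sum_i kap i * y 0 i ^+ 2 + m%:R * y 0 j.
    rewrite (bigD1 j)//= {1}/kap eqxx.
    have -> : m%:R = m.-1%:R + 1 :> R by rewrite -[in LHS](prednK m0) -natr1.
    have nn : 0 <= (m.-1)%:R :> R by exact: ler0n.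
    have nn2 : 0 <= (m.-1)%:R * (y 0 j * (1 - y 0 j)).
      by case/andP: yj1 => *; rewrite !mulr_ge0// subr_ge0.
    have [ij|ij] := eqVneq i j.
      have y1 : y 0 j = 1.
        by case: Si => [|]; rewrite /lo ij ?eqxx// => e; rewrite e eqxx in yj0.
      have : 0 <= \sum_(i0 < m | i0 != j) kap i0 * y 0 i0 ^+ 2.
        by apply: sumr_ge0 => l /negbTE lj; rewrite /kap lj mul1r sqr_ge0.
      rewrite y1; set s := \sum_(_ < _ | _) _; nra.
    have yi : y 0 i ^+ 2 = 1.
      by case: Si => ->; rewrite ?expr1n// /lo (negbTE ij) sqrrN expr1n.
    have : 1 <= \sum_(i0 < m | i0 != j) kap i0 * y 0 i0 ^+ 2.
      rewrite (bigD1 i)//= /kap (negbTE ij) yi mulr1 lerDl.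
      by apply: sumr_ge0 => l /andP[/negbTE lj _]; rewrite lj mul1r sqr_ge0.
    case/andP: yj1 => y0 y1'; set s := \sum_(_ < _ | _) _ => s1; nra.
  have b1 : `|p y| <= M by apply: bp => l; rewrite mxE subr0 abs1.
  have b2 : `|p (sg y)| <= M.
    apply: bp => l; rewrite !mxE subr0 add0r normrM /c.
    by case: ifP => _; rewrite ?normrN normr1 mul1r abs1.
  move: b1 b2 key; rewrite /u; set s := \sum_i _ + _; rewrite !ler_norml.
  by move=> /andP[? ?] /andP[? ?] s1; nra.
(* [phi] is [u] on the x_j-axis without the quadratic term, which has derivative 0 at the origin.
   Since [phi] is 0 at 0 and nonpositive to the right, its derivative [pd j p 0 - m M] is
   nonpositive. *)
pose phi (t : R) := 1/2 * p (t *: unitv R j) + (- (1/2)) * p (t *: (- unitv R j)) + (- M * m%:R) * t.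
have eNt (t : R) : t *: (- unitv R j) = - (t *: unitv R j) by rewrite scalerN.
have dline v : is_derive (0 : R) 1 (fun t => p (t *: v)) ('D_v p 0).
  have E : (fun t => p (t *: v)) = (fun t => p (0 + t *: v)) by apply/funext => t; rewrite add0r.
  rewrite E -[X in 'D_v p X](addr0 0) -(scale0r v).
  apply: DeriveDef; last by rewrite -derive_line.
  by apply/derivable_line; rewrite scale0r addr0; exact/dff_derivable/pol_dff.
have D2 : is_derive (0 : R) 1 phi (1/2 * 'D_(unitv R j) p 0 + (-(1/2)) * 'D_(- unitv R j) p 0 + (- M * m%:R) * 1).
  apply: is_deriveD.
have DN : 'D_(- unitv R j) p 0 = - pd j p 0.
  have dp := pol_dff pp; by rewrite (deriveE _ (dp _)) linearN /= /pd (deriveE _ (dp _)).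
have : 'D_1 phi (0 : R) <= 0.
  apply: le0_right_derive.
  - exact: (ex_derive (is_derive := D2)).
  - by rewrite /phi !scale0r; ring.
  move=> t /andP[t0 t1].
  have := ule (t *: unitv R j).
  have -> : u (t *: unitv R j) = phi t + M * (m.-1%:R) * t ^+ 2.
    rewrite /u /phi (bigD1 j)//= big1 => [|l lj]; last by rewrite !mxE (negbTE lj) andbF mulr0 expr0n mulr0.
    rewrite /kap eqxx !mxE !eqxx mulr1.
    have -> : sg (t *: unitv R j) = t *: (- unitv R j).
      apply/rowP => l; rewrite !mxE /= /c; case: eqP => [_|_]; rewrite ?mulr1n ?mulr0n ?andbF; ring.
    ring.
  have nn : 0 <= M * (m.-1%:R) * t ^+ 2 by rewrite !mulr_ge0.
  move=> H; have : phi t + M * m.-1%:R * t ^+ 2 <= 0.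
    apply: H; apply/KE => l; rewrite !mxE eqxx /lo /=; case: eqP => _.
      by rewrite mulr1 t0 t1.
    by rewrite mulr0; apply/andP; split; lra.
  by move: nn; set A := M * _ * _; lra.
rewrite (derive_val (is_derive := D2)) DN -/(pd j p 0); lra.
Qed.

Lemma pd_bound p j y (r M : R) : 0 < r -> pol p -> harmfun p ->
  (forall x, cube y r x -> `|p x| <= M) -> `|pd j p y| <= m%:R * M / r.
Proof.
move=> r0 pp hp bp.
have H (s : R) : s ^+ 2 = 1 -> s * pd j p y <= m%:R * M / r.
  move=> s2; pose q x := s * p (affine (fun i => y 0 i) (fun=> r) x).
  have pa := pol_affine (fun i => y 0 i) (fun=> r) pp.
  have pq : pol q := polZ s pa.
  have ay : affine (fun i => y 0 i) (fun=> r) 0 = y :> 'rV[R]_m.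
    by apply/rowP => i; rewrite !mxE mulr0 addr0.
  have E : pd j q 0 = s * (r * pd j p y).
    rewrite /pd (DvZ _ _ _ (pol_dff pa)).
    by rewrite -[X in s * X]/(pd j (fun x => p (affine (fun i => y 0 i) (fun=> r) x)) 0)
      (pd_affine _ _ _ _ (pol_dff pp)) ay.
  have : pd j q 0 <= m%:R * M.
    apply: (@grad_unit q j M pq).
      move=> x; rewrite (lapZ _ x (pol_twice pa)) (@lap_affine _ _ p _ _ (r ^+ 2))//.
      by rewrite hp !mulr0.
    move=> x cx; rewrite normrM; have -> : `|s| = 1.
      by apply/eqP; rewrite -(@eqrXn2 _ 2)// -normrX s2 normr1 expr1n.
    rewrite mul1r; apply: bp => i; rewrite !mxE addrAC subrr add0r normrM (gtr0_norm r0).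
    by have := cx i; rewrite mxE subr0 => ?; rewrite -[leRHS]mulr1 ler_pM2l.
  by rewrite E ler_pdivlMr// mulrCA mulrC.
rewrite ler_norml; apply/andP; split; last by have := H 1; rewrite mul1r expr1n; apply.
by have := H (-1); rewrite sqrrN expr1n mulN1r lerNl; apply.
Qed.

Lemma Dv_bound p v y (r M : R) : 0 < r -> pol p -> harmfun p ->
  (forall i, `|v 0 i| <= 1) ->
  (forall x, cube y r x -> `|p x| <= M) -> `|'D_v p y| <= m%:R ^+ 2 / r * M.
Proof.
move=> r0 pp hp v1 bp; rewrite (Dv_pd v y (pol_dff pp)).
apply: (le_trans (ler_norm_sum _ _ _)).
apply: (le_trans (y := \sum_(i < m) m%:R * M / r)).
  apply: ler_sum => i _; rewrite normrM -[leRHS]mul1r ler_pM//.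
  exact: pd_bound bp.
rewrite sumr_const card_ord -mulr_natl le_eqVlt; apply/orP; left; apply/eqP; ring.
Qed.

Definition Dn k v p := iter k (fun u x => 'D_v u x) p.

Lemma pol_Dn k v p : pol p -> pol (Dn k v p).
Proof. by move=> pp; elim: k => [//|k IH]; exact: (pol_Dv v IH). Qed.

Lemma harmonic_Dv v p : pol p -> harmfun p -> harmfun (fun x => 'D_v p x).
Proof.
move=> pp hp x; rewrite (pol_lap_Dv v x pp).
by rewrite (_ : lap p = fun=> 0) ?DvC//; apply/funext => y; exact: hp.
Qed.

(** Each differentiation uses up a layer of width [d], hence the cube of half-side [k d] for [k] of
    them. *)
Lemma Dn_bound k p v y (d M : R) : 0 < d -> pol p -> harmfun p ->
  (forall i, `|v 0 i| <= 1) ->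
  (forall x, cube y (k%:R * d) x -> `|p x| <= M) ->
  `|Dn k v p y| <= (m%:R ^+ 2 / d) ^+ k * M.
Proof.
move=> d0 pp hp v1; elim: k p M pp hp => [|k IH] p M pp hp bp.
  by rewrite expr0 mul1r; apply: bp => i; rewrite subrr normr0 mul0r.
rewrite /Dn iterSr exprSr -mulrA; apply: (IH (fun x => 'D_v p x)).
- exact: pol_Dv.
- exact: harmonic_Dv.
move=> x cx; apply: Dv_bound => // z cz; apply: bp => i.
rewrite -(subrKA (x 0 i)) (le_trans (ler_normD _ _))// -natr1 mulrDl mul1r addrC.
by rewrite lerD// ?cx// cz.
Qed.

Lemma hpoly_Dn k l v p : hpoly k p -> hpoly (k - l) (Dn l v p).
Proof.
move=> hp; elim: l => [|l IH]; first by rewrite subn0.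
by rewrite subnS; exact: hpoly_Dv IH.
Qed.

(** The k-th derivative of a form of degree k is constant, so the point [x] is irrelevant. The
    innermost derivative [D_v p] is evaluated at [v], where Euler's identity gives [k p(v)]. *)
Lemma Dn_hpoly_diag k v p x : hpoly k p -> Dn k v p x = k`!%:R * p v.
Proof.
elim: k p => [|k IH] p hp; first by case: hp => c ->; rewrite fact0 mul1r.
rewrite /Dn iterSr -/(Dn k v _) (IH _ (hpoly_Dv v hp)) (hpoly_euler v hp).
by rewrite factS natrM mulrA [k`!%:R * _]mulrC.
Qed.

Lemma Dn_hpoly_0 k l v p : hpoly l p -> l != k -> Dn k v p 0 = 0.
Proof.
move=> hp; rewrite neq_ltn => /orP[lk|kl]; last first.
  have := hpoly_Dn k v hp; rewrite -(ltn_predK kl) subSn; last by rewrite -ltnS (ltn_predK kl).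
  exact: hpoly_at0.
have : hpoly 0 (Dn l v p) by rewrite -(subnn l); exact: hpoly_Dn.
rewrite -(subnK lk) /Dn iterD /= => h0.
have -> : (fun x => 'D_v (iter l (fun u x => 'D_v u x) p) x) = fun=> 0.
  by apply/funext => x; exact: hpoly0_Dv h0.
elim: (k - l.+1)%N => // s /= IH; rewrite (_ : iter s _ _ = fun=> 0) ?DvC//.
elim: s {IH} => // s /= ->; apply/funext => x; exact: DvC.
Qed.

Lemma Dv_sumn (d : nat) (q : nat -> 'rV[R]_m -> R) v x : (forall k, dff (q k)) ->
  'D_v (fun x => \sum_(l < d) q l x) x = \sum_(l < d) 'D_v (q l) x.
Proof. by move=> dq; rewrite (Dv_sum _ _ v x (fun l : 'I_d => dq l)). Qed.

Lemma Dn_sum k d (q : nat -> 'rV[R]_m -> R) v : (forall l, pol (q l)) ->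
  Dn k v (fun x => \sum_(l < d) q l x) = (fun x => \sum_(l < d) Dn k v (q l) x).
Proof.
move=> pq; elim: k => [//|k IH]; rewrite /Dn /= -/(Dn k v _) IH.
apply/funext => x; apply: (Dv_sumn d (q := fun l => Dn k v (q l)) v x) => l.
exact/pol_dff/pol_Dn.
Qed.

(** One term of the exponential series. It is used to trade a power like [k^k] for [k!] times a
    geometric factor. *)
Lemma expX_fact (x : R) k : 0 <= x -> x ^+ k <= k`!%:R * expR x.
Proof.
case: k => [|k] x0; first by rewrite expr0 fact0 mul1r -expR0 ler_expR.
rewrite mulrC -ler_pdivrMr ?ltr0n ?fact_gt0//.
by apply: le_trans (expR_ge1Dxn k x0); rewrite lerDr.
Qed.

(* For a harmonic sum the degree-k part is controlled independently of the top
   degree: [k! q_k(v) = D_v^k p(0)], and each of the k derivatives costs one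
   gradient estimate at scale [r / k]. *)
Lemma hpart_bound d (q : nat -> 'rV[R]_m -> R) k v (r M : R) : 0 < r ->
  (forall l, hpoly l (q l)) -> harmfun (fun x => \sum_(l < d) q l x) -> (k < d)%N ->
  (forall i, `|v 0 i| <= 1) ->
  (forall x, cube 0 r x -> `|\sum_(l < d) q l x| <= M) ->
  `|q k v| <= (m%:R ^+ 2 * expR 1 / r) ^+ k * M.
Proof.
move=> r0 hq hp kd v1 bp.
have pq l := pol_hpoly (hq l).
have pp : pol (fun x => \sum_(l < d) q l x) by apply: pol_sum => l _; exact: pq.
have E : Dn k v (fun x => \sum_(l < d) q l x) 0 = k`!%:R * q k v.
  rewrite Dn_sum// (bigD1 (Ordinal kd))//= (Dn_hpoly_diag v 0 (hq k)) big1 ?addr0// => l lk.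
  exact: Dn_hpoly_0 (hq l) lk.
case: k kd E => [|k] kd E.
  rewrite expr0 mul1r; move: E; rewrite /Dn /= fact0 mul1r => <-.
  by apply: bp => i; rewrite subrr normr0 ltW.
have kp : 0 < (k.+1)%:R :> R by rewrite ltr0n.
have M0 : 0 <= M by apply: le_trans (bp 0 _) => // i; rewrite subrr normr0 ltW.
have := @Dn_bound k.+1 _ v 0 (r / k.+1%:R) M (divr_gt0 r0 kp) pp hp v1.
rewrite mulrCA divff ?mulr1 ?lt0r_neq0// => /(_ bp); rewrite E normrM normr_nat.
have fp : 0 < (k.+1)`!%:R :> R by rewrite ltr0n fact_gt0.
rewrite -ler_pdivlMl// => H; apply: (le_trans H).
have -> : m%:R ^+ 2 / (r / k.+1%:R) = m%:R ^+ 2 / r * k.+1%:R :> R.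
  by rewrite invf_div mulrA mulrAC.
have -> : m%:R ^+ 2 * expR 1 / r = m%:R ^+ 2 / r * expR 1 by rewrite mulrAC.
have a0 : 0 <= m%:R ^+ 2 / r by rewrite divr_ge0// ?exprn_ge0// ltW.
move: (m%:R ^+ 2 / r) a0 => a a0.
rewrite !exprMn mulrA ler_wpM2r// mulrCA; apply: ler_wpM2l; first exact: exprn_ge0.
rewrite ler_pdivrMl// -expRM_natl mulr1; exact: expX_fact (ltW kp).
Qed.

End GradientEstimate.

(** * Regularization by Steklov averages *)

Section CubeTopology.
Variables (R : realType) (m : nat).
Implicit Types (u p q : 'rV[R]_m -> R) (x y v w : 'rV[R]_m) (i j : 'I_m) (k l : nat).

Lemma cube_nbhs x (r : R) : 0 < r -> nbhs x (cube x r).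
Proof.
move=> r0; apply/nbhs_ballP; exists r => //= y xy i.
by case: xy => _ /(_ ord0 i); rewrite /ball /= distrC => /ltW.
Qed.

Lemma nbhs_cube x (A : set 'rV[R]_m) : nbhs x A -> exists2 r : R, 0 < r & cube x r `<=` A.
Proof.
move=> /nbhs_ballP[r /= r0 H]; exists (r / 2); first by rewrite divr_gt0.
move=> y xy; apply: H; split => // a j; rewrite (ord1 a) /ball /= distrC.
by apply: (le_lt_trans (xy j)); rewrite ltr_pdivrMr// ltr_pMr// ltr1n.
Qed.

Lemma cont_cube u x (e : R) : {for x, continuous u} -> 0 < e ->
  exists2 d : R, 0 < d & forall y, cube x d y -> `|u y - u x| <= e.
Proof.
move=> cu e0; move/cvgrPdist_le : cu => /(_ e e0) /nbhs_cube[r r0 H].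
by exists r => // y /H /=; rewrite distrC.
Qed.

Lemma cube_cont u x : (forall e : R, 0 < e ->
  exists2 d : R, 0 < d & forall y, cube x d y -> `|u y - u x| <= e) -> {for x, continuous u}.
Proof.
move=> H; suff: u y @[y --> x] --> u x by [].
have FF : Filter (nbhs x) := nbhs_filter x.
apply/cvgrPdist_le => e e0; have [d d0 Hd] := H e e0.
apply: filterS (cube_nbhs x d0) => y cy /=; rewrite distrC; exact: Hd.
Qed.

Lemma cube_compact x (r : R) : compact (cube x r).
Proof.
have -> : cube x r = [set y | forall i, (`[x 0 i - r, x 0 i + r]%classic : set R) (y ord0 i)].
  apply/seteqP; split => y H i; have := H i; rewrite /= in_itv /= ler_norml.
    by move=> /andP[? ?]; apply/andP; split; lra.
  by move=> /andP[? ?]; apply/andP; split; lra.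
apply: (@rV_compact R m (fun i => `[x 0 i - r, x 0 i + r]%classic)) => i; exact: segment_compact.
Qed.

Lemma cubeS x (r s : R) : r <= s -> cube x r `<=` cube x s.
Proof. by move=> rs y H i; apply: le_trans (H i) rs. Qed.

Lemma cube_trans x y z (r s : R) : cube x r y -> cube y s z -> cube x (r + s) z.
Proof.
move=> xy yz i; have -> : z 0 i - x 0 i = (y 0 i - x 0 i) + (z 0 i - y 0 i) by ring.
apply: le_trans (ler_normD _ _) _; apply: lerD; [exact: xy|exact: yz].
Qed.

Lemma cube_line x i (t r : R) : `|t| <= r -> cube x r (x + t *: unitv R i).
Proof.
move=> tr j; rewrite !mxE addrAC subrr add0r eqxx /=.
case: eqP => _; first by rewrite mulr1.
by rewrite mulr0 normr0 (le_trans _ tr).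
Qed.

(** Stronger than uniform continuity on [K]: only the first point lies in [K], because the shifts
    made by averages and difference quotients leave it. *)
Lemma unif_cont u (K : set 'rV[R]_m) (e : R) : continuous u -> compact K -> 0 < e ->
  exists2 d : R, 0 < d & forall x y, K x -> cube x d y -> `|u y - u x| <= e.
Proof.
move=> cu cK e0.
have e20 : 0 < e / 2 by rewrite divr_gt0.
have /compact_near_coveringP : compact K by [].
move=> /(_ R (0 : R)^'+ (fun d x => forall y, cube x d y -> `|u y - u x| <= e) _) H.
have : \forall d \near (0:R)^'+, K `<=` (fun x => forall y, cube x d y -> `|u y - u x| <= e).
  apply: H => x Kx; have [d d0 Hd] := cont_cube (cu x) e20.
  have d2 : 0 < d / 2 by rewrite divr_gt0.
  exists (cube x (d / 2), [set t | t <= d / 2]).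
    by split => /=; [exact: cube_nbhs|exact: nbhs_right_le].
  move=> [x' t] /= [cx td] y cy; rewrite -(subrKA (u x)) (splitr e).
  apply: le_trans (ler_normD _ _) _; apply: lerD.
    apply: Hd; rewrite (splitr d); exact: cube_trans cx (cubeS td cy).
  rewrite distrC; apply: Hd; apply: cubeS cx; rewrite ler_pdivrMr// ler_pMr// ler1n//.
move=> H2; have [d [d0 Hd]] : exists d : R, 0 < d /\ (K `<=` (fun x => forall y, cube x d y -> `|u y - u x| <= e)).
  near (0:R)^'+ => d; exists d; split => //; near: d; exact: H2.
by exists d => // x y Kx; exact: Hd.
Unshelve. all: by end_near. Qed.

Lemma cont_bounded u x (r : R) : 0 <= r -> continuous u -> exists2 M : R, 0 <= M & forall y, cube x r y -> `|u y| <= M.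
Proof.
move=> r0 cu; have [c _ H] : exists2 c, c \in cube x r & forall t, t \in cube x r -> `|u t| <= `|u c|.
  apply: (@EVT_max_rV R m (fun y => `|u y|)).
  - by exists x => i; rewrite subrr normr0.
  - exact: cube_compact.
  - apply: continuous_subspaceT => y; exact: (cvg_norm (cu y)).
by exists `|u c| => // y cy; apply: H; rewrite inE.
Qed.

Lemma mvt_line u v x (t : R) : (forall s : R, derivable u (x + s *: v) v) ->
  exists2 c : R, `|c| <= `|t| & u (x + t *: v) - u x = t * 'D_v u (x + c *: v).
Proof.
move=> du.
have D (s : R) : is_derive s 1 (fun s : R => u (x + s *: v)) ('D_v u (x + s *: v)).
  by apply: DeriveDef; [apply/derivable_line; exact: du|rewrite derive_line].
have cw (a b : R) : {within `[a, b], continuous (fun s : R => u (x + s *: v))}.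
  by apply: derivable_within_continuous => s _; apply/derivable_line; exact: du.
have x0 : u x = u (x + 0 *: v) by rewrite scale0r addr0.
have [t0|t0] := leP 0 t.
  have [c /[!in_itv]/= /andP[c0 ct] E] := @MVT_segment R _ _ 0 t t0 (fun s _ => D s) (cw _ _).
  by exists c; rewrite ?ger0_norm// x0 E subr0 mulrC.
have [c /[!in_itv]/= /andP[c0 ct] E] := @MVT_segment R _ _ t 0 (ltW t0) (fun s _ => D s) (cw _ _).
exists c; first by rewrite (ltr0_norm t0) (ler0_norm ct) lerN2.
by rewrite x0 -opprB E sub0r mulrN opprK mulrC.
Qed.

Definition cont1 u := (forall x i, derivable u x (unitv R i)) /\
  (forall i, continuous (pd i u)).

Lemma cont1_continuous u : cont1 u -> continuous u.
Proof.
move=> [du cdu] x; apply: cube_cont => e e0.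
have [M M0 HM] : exists2 M : R, 0 <= M & forall i y, cube x 1 y -> `|pd i u y| <= M.
  have /choice[M HM] i : exists M : R, 0 <= M /\ forall y, cube x 1 y -> `|pd i u y| <= M.
    by have [M ? ?] := @cont_bounded _ x 1 ler01 (cdu i); exists M.
  exists (\sum_i M i) => [|i y cy]; first by apply: sumr_ge0 => i _; case: (HM i).
  apply: (le_trans ((HM i).2 y cy)); rewrite (bigD1 i)//= lerDl.
  by apply: sumr_ge0 => j _; case: (HM j).
pose d := Num.min 1 (e / (m%:R * M + 1)).
have mM : 0 < m%:R * M + 1 by rewrite ltr_wpDl// mulr_ge0.
have d0 : 0 < d by rewrite lt_min ltr01 divr_gt0.
exists d => // y cy.
(* [z k] has the first [k] coordinates of [y] and the others of [x]; passing to [z k.+1] moves along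
   one axis and costs at most [M d]. *)
pose z k : 'rV[R]_m := \row_i (if (i < k)%N then y 0 i else x 0 i).
have step k : (k <= m)%N -> `|u (z k) - u x| <= k%:R * (M * d).
  elim: k => [_|k IH km].
    have -> : z 0 = x by apply/rowP => i; rewrite mxE.
    by rewrite subrr normr0 mul0r.
  have kE : z k.+1 = z k + (y 0 (Ordinal km) - x 0 (Ordinal km)) *: unitv R (Ordinal km).
    apply/rowP => i; rewrite !mxE eqxx /= ltnS leq_eqVlt.
    have [->|ik] := eqVneq i (Ordinal km); first by rewrite /= eqxx ltnn /= mulr1 addrC subrK.
    have -> : (nat_of_ord i == k) = false by apply/negP => /eqP ik'; case/eqP: ik; exact: val_inj.
    by rewrite mulr0 addr0.
  have -> : u (z k.+1) - u x = (u (z k.+1) - u (z k)) + (u (z k) - u x) by ring.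
  rewrite -natr1 mulrDl mul1r [leRHS]addrC.
  apply: le_trans (ler_normD _ _) _; apply: lerD; last exact: IH (ltnW km).
  rewrite kE; have [c cle ->] := @mvt_line u (unitv R (Ordinal km)) (z k)
     (y 0 (Ordinal km) - x 0 (Ordinal km)) (fun s => du _ _).
  rewrite normrM mulrC; have t1 := cy (Ordinal km); apply: ler_pM => //.
  apply: HM => i; rewrite !mxE eqxx /=.
  have d1 : d <= 1 by rewrite ge_min lexx.
  have [->|ik] := eqVneq i (Ordinal km).
    by rewrite ltnn mulr1 addrAC subrr add0r (le_trans cle)// (le_trans (cy _)).
  rewrite mulr0 addr0; case: ifP => _; last by rewrite subrr normr0.
  exact: le_trans (cy i) d1.
have := step m (leqnn m); have -> : z m = y by apply/rowP => i; rewrite mxE ltn_ord.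
move=> H; apply: (le_trans H); rewrite mulrA.
apply: (le_trans (y := (m%:R * M + 1) * d)); first by rewrite ler_wpM2r ?ltW// ltrDl.
rewrite mulrC -ler_pdivlMr//; by rewrite ge_min lexx orbT.
Qed.
End CubeTopology.

(** * Integrals of continuous functions over the unit interval *)

Section UnitIntegral.
Variable R : realType.
Implicit Types f g : R -> R.

Definition int01 f : R := \int[@lebesgue_measure R]_(t in `[0, 1]) f t.

Lemma measurable_unit_itv : measurable (`[0, 1]%classic : set (measurableTypeR R)).
Proof. exact: measurable_itv. Qed.

Lemma int01_integrable f : continuous f ->
  (@lebesgue_measure R).-integrable `[0, 1]%classic (EFin \o f).
Proof.
move=> cf; apply: continuous_compact_integrable; first exact: segment_compact.
exact: continuous_subspaceT.
Qed.

Lemma int01_cst (c : R) : int01 (fun=> c) = c.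
Proof.
rewrite /int01 Rintegral_cst; last exact: measurable_itv.
rewrite -[X in fine X]/(@lebesgue_measure R [set` `[0, 1]%R]) lebesgue_measure_itv /=.
by rewrite lte_fin ltr01 oppr0 adde0 mulr1.
Qed.

Lemma int01D f g : continuous f -> continuous g ->
  int01 (fun t => f t + g t) = int01 f + int01 g.
Proof.
move=> cf cg; exact: (RintegralD measurable_unit_itv (int01_integrable cf) (int01_integrable cg)).
Qed.

Lemma int01Z (c : R) f : continuous f -> int01 (fun t => c * f t) = c * int01 f.
Proof.
move=> cf; exact: (RintegralZl c measurable_unit_itv (int01_integrable cf)).
Qed.

Lemma int01B f g : continuous f -> continuous g ->
  int01 (fun t => f t - g t) = int01 f - int01 g.
Proof.
move=> cf cg; exact: (RintegralB measurable_unit_itv (int01_integrable cf) (int01_integrable cg)).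
Qed.

Lemma int01_bound f (M : R) : continuous f -> (forall t, 0 <= t <= 1 -> `|f t| <= M) ->
  `|int01 f| <= M.
Proof.
move=> cf bf; have mI := measurable_unit_itv.
apply: le_trans (le_normr_Rintegral mI (int01_integrable cf)) _.
rewrite -[leRHS](int01_cst M); apply: le_Rintegral => //.
- apply: int01_integrable => t; exact: (cvg_norm (cf t)).
- apply: int01_integrable; exact: cst_continuous.
Qed.

Lemma int01_FTC (F f : R -> R) : continuous f -> (forall t : R, is_derive t 1 F (f t)) ->
  int01 f = F 1 - F 0.
Proof.
move=> cf dF; rewrite /int01 /Rintegral.
have cF : continuous F by move=> t; apply/differentiable_continuous/derivable1_diffP.
rewrite (@continuous_FTC2 R f F 0 1)//.
- exact: continuous_subspaceT.
- split.
  + by move=> t _; exact: ex_derive.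
  + exact/cvg_at_right_filter/cF.
  + exact/cvg_at_left_filter/cF.
- by move=> t _; rewrite derive1E derive_val.
Qed.
End UnitIntegral.

(** * Steklov averages and their derivatives *)

Section Steklov.
Variables (R : realType) (m : nat) (h : R).
Hypothesis h0 : 0 < h.
Implicit Types (u p q : 'rV[R]_m -> R) (x y v w : 'rV[R]_m) (i j : 'I_m) (k l : nat).

(** The average over the segment from [x] to [x + h e_i]. Its parameter is scaled to [0, 1], so that
    constants are their own averages and [h] occurs only in the integrand. *)
Definition stek i u x : R := int01 (fun t => u (x + (h * t) *: unitv R i)).
Definition fdiff i u x : R := (u (x + h *: unitv R i) - u x) / h.

Lemma line_continuous u x v (c : R) : continuous u -> continuous (fun t : R => u (x + (c * t) *: v)).
Proof.
move=> cu t; apply: (@continuous_comp _ _ _ (fun t : R => x + (c * t) *: v) u); last exact: cu.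
apply: cvgD; first exact: cvg_cst.
apply: cvgZr_tmp; apply: cvgM; [exact: cvg_cst|exact: cvg_id].
Qed.

Lemma shift_cube i x y (r t : R) : cube x r y ->
  cube (x + t *: unitv R i) r (y + t *: unitv R i).
Proof. by move=> H j; rewrite !mxE opprD addrACA subrr addr0; exact: H. Qed.

Lemma seg_cube i x (t : R) : 0 <= t <= 1 -> cube x h (x + (h * t) *: unitv R i).
Proof.
by move=> /andP[t0 t1]; apply: cube_line; rewrite normrM (gtr0_norm h0) (ger0_norm t0) ler_piMr// ltW.
Qed.

Lemma stek_continuous i u : continuous u -> continuous (stek i u).
Proof.
move=> cu x; apply: cube_cont => e e0.
have [d d0 Hd] := unif_cont cu (@cube_compact R m x h) e0.
exists d => // y cy; rewrite /stek -int01B; try exact: line_continuous.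
apply: int01_bound.
  move=> t; exact: (cvgB (@line_continuous u y _ h cu t) (@line_continuous u x _ h cu t)).
move=> t t01; apply: Hd; first exact: seg_cube.
exact: shift_cube.
Qed.

(** Differentiation under the integral sign. The mean value theorem turns the difference quotient of
    the integrand into a value of [pd j u] at distance at most |s|, and uniform continuity makes
    this close to [pd j u] along the whole segment. *)
Lemma is_derive_stek i j u x : cont1 u -> is_derive x (unitv R j) (stek i u) (stek i (pd j u) x).
Proof.
move=> c1; have cu := cont1_continuous c1; have [du cdu] := c1.
suff H : (fun s : R => s^-1 *: ((stek i u \o shift x) (s *: unitv R j) - stek i u x)) @ 0^' --> stek i (pd j u) x.
  by apply: DeriveDef; [apply/cvg_ex; exists (stek i (pd j u) x)|exact: cvg_lim H].
apply/cvgrPdist_le => e e0.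
have [d d0 Hd] := unif_cont (cdu j) (@cube_compact R m x h) e0.
exists d => // s /=; rewrite sub0r normrN => sd s0.
have E : s^-1 *: (stek i u (s *: unitv R j + x) - stek i u x) =
   int01 (fun t => s^-1 * (u (x + s *: unitv R j + (h * t) *: unitv R i) - u (x + (h * t) *: unitv R i))).
  rewrite int01Z.
    by rewrite int01B; [rewrite [s *: _ + x]addrC|exact: line_continuous|exact: line_continuous].
  move=> t; exact: (cvgB (@line_continuous u _ _ h cu t) (@line_continuous u x _ h cu t)).
have ct : continuous (fun t : R => s^-1 * (u (x + s *: unitv R j + (h * t) *: unitv R i) - u (x + (h * t) *: unitv R i))).
  move=> t; apply: (cvgM (cvg_cst _)).
  exact: (cvgB (@line_continuous u _ _ h cu t) (@line_continuous u x _ h cu t)).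
rewrite E /stek -int01B; [|exact: line_continuous|exact: ct].
apply: int01_bound.
  move=> t; exact: (cvgB (@line_continuous (pd j u) _ _ h (cdu j) t) (ct t)).
move=> t t01; rewrite addrAC.
have [c cs ->] := @mvt_line R m u (unitv R j) (x + (h * t) *: unitv R i) s (fun s => du _ _).
rewrite mulKf// distrC; apply: Hd; first exact: seg_cube.
by apply: cube_line; apply: (le_trans cs); exact: ltW.
Qed.

Lemma pd_stek i j u : cont1 u -> pd j (stek i u) = stek i (pd j u).
Proof. by move=> c1; apply/funext => x; exact: (derive_val (is_derive := is_derive_stek i j x c1)). Qed.

Lemma cont1_stek i u : cont1 u -> cont1 (stek i u).
Proof.
move=> c1; split=> [x j|j]; first exact: (ex_derive (is_derive := is_derive_stek i j x c1)).
by rewrite pd_stek//; apply: stek_continuous; case: c1.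
Qed.

Lemma pd_stek_diag i u : cont1 u -> pd i (stek i u) = fdiff i u.
Proof.
move=> c1; rewrite pd_stek//; apply/funext => x; have [du cdu] := c1.
have cF : continuous (fun t : R => pd i u (x + (h * t) *: unitv R i)).
  by apply: line_continuous; exact: cdu.
have D (t : R) : is_derive t 1 (fun t : R => h^-1 * u (x + (h * t) *: unitv R i)) (pd i u (x + (h * t) *: unitv R i)).
  have D : is_derive (h * t) 1 (fun s : R => u (x + s *: unitv R i)) (pd i u (x + (h * t) *: unitv R i)).
    by apply: DeriveDef; [apply/derivable_line; exact: du|rewrite -derive_line].
  have Dm : is_derive t 1 (fun t : R => h * t) h.
    by apply: is_derive_eq; rewrite -[_ *: _]/(_ * _) mulr1.
  have Dc := @is_derive1_comp R _ _ t _ _ D Dm.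
  have DZ := is_deriveZ h^-1 Dc; apply: (is_derive_eq DZ).
  by rewrite -[_ *: _]/(_ * _) mulrC mulfK// gt_eqF.
rewrite /stek /fdiff (int01_FTC cF D).
by rewrite mulr1 mulr0 scale0r addr0 mulrBl mulrC [_ * u x]mulrC.
Qed.

Lemma shift_derivable i u x v : derivable u (x + h *: unitv R i) v ->
  derivable (fun y => u (y + h *: unitv R i)) x v /\
  'D_v (fun y => u (y + h *: unitv R i)) x = 'D_v u (x + h *: unitv R i).
Proof.
rewrite /derivable /derive.
have -> : (fun s : R => s^-1 *: ((u \o shift (x + h *: unitv R i)) (s *: v) - u (x + h *: unitv R i)))
  = (fun s : R => s^-1 *: (((fun y => u (y + h *: unitv R i)) \o shift x) (s *: v) - u (x + h *: unitv R i))) => //.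
by apply/funext => s /=; rewrite addrA.
Qed.

Lemma is_derive_fdiff i j u x : cont1 u -> is_derive x (unitv R j) (fdiff i u) (fdiff i (pd j u) x).
Proof.
move=> [du cdu].
have [d1 e1] := shift_derivable (du (x + h *: unitv R i) j).
have D1 := derivableP d1; have D2 := derivableP (du x j).
have := is_deriveZ h^-1 (is_deriveB D1 D2); rewrite e1.
have -> : h^-1 \*: ((fun y => u (y + h *: unitv R i)) - u) = fdiff i u.
  by apply/funext => y; rewrite /fdiff mulrC.
by move=> D; apply: (is_derive_eq D); rewrite /fdiff -[LHS]/(h^-1 * _) mulrC.
Qed.

Lemma pd_fdiff i j u : cont1 u -> pd j (fdiff i u) = fdiff i (pd j u).
Proof. by move=> c1; apply/funext => x; exact: (derive_val (is_derive := is_derive_fdiff i j x c1)). Qed.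

Lemma fdiff_continuous i u : continuous u -> continuous (fdiff i u).
Proof.
move=> cu x; have c2 : {for x, continuous (fun y => u (y + h *: unitv R i))}; last first.
  exact: (cvgM (cvgB c2 (cu x)) (cvg_cst _)).
apply: (@continuous_comp _ _ _ (fun y => y + h *: unitv R i) u); last exact: cu.
exact: (cvgD cvg_id (cvg_cst _)).
Qed.

Lemma cont1_fdiff i u : cont1 u -> cont1 (fdiff i u).
Proof.
move=> c1; split=> [x j|j]; first exact: (ex_derive (is_derive := is_derive_fdiff i j x c1)).
by rewrite pd_fdiff//; apply: fdiff_continuous; case: c1.
Qed.

(* A Steklov average becomes a difference quotient when differentiated in its
   own direction; [c] records the directions where this has happened. *)
Definition stk (b : bool) i u := if b then fdiff i u else stek i u.
Definition stks (c : 'I_m -> bool) (s : seq 'I_m) u := foldr (fun i => stk (c i) i) u s.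

Lemma cont1_stks c s u : cont1 u -> cont1 (stks c s u).
Proof.
move=> c1; elim: s => //= i s IH; rewrite /stk; case: (c i).
  exact: cont1_fdiff.
exact: cont1_stek.
Qed.

Lemma pd_stk b i j u : cont1 u -> pd j (stk b i u) = stk b i (pd j u).
Proof. by case: b => c1; [exact: pd_fdiff|exact: pd_stek]. Qed.

Lemma pd_stks c s j u : cont1 u -> pd j (stks c s u) = stks c s (pd j u).
Proof.
move=> c1; elim: s => //= i s IH; rewrite -IH -pd_stk//; exact: cont1_stks.
Qed.

Definition upd (c : 'I_m -> bool) j i := (i == j) || c i.

Lemma stks_upd_notin c s j u : j \notin s -> stks (upd c j) s u = stks c s u.
Proof.
elim: s => //= i s IH; rewrite inE negb_or => /andP[ij js].
by rewrite IH// /upd eq_sym (negbTE ij).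
Qed.

Lemma pd_stks_upd c s j u : cont1 u -> uniq s -> j \in s -> c j = false ->
  pd j (stks c s u) = stks (upd c j) s u.
Proof.
move=> c1; elim: s => //= i s IH /andP[is_ us]; rewrite inE => /orP[/eqP ji|js] cj.
  rewrite -ji cj /upd eqxx /= pd_stek_diag ?stks_upd_notin ?ji//.
  exact: cont1_stks.
have ij : (i == j) = false by apply/negP => /eqP e; rewrite e js in is_.
rewrite pd_stk; last exact: cont1_stks.
by rewrite IH// /upd ij.
Qed.

(** Averaging once in every direction. A first derivative consumes the average in its own direction,
    and the remaining function is still [cont1], so a second derivative exists. *)
Definition smooth u := stks (fun=> false) (enum 'I_m) u.

(** For distinct directions both sides are the same composite, with difference quotients in the
    directions i and j and averages in all others. *)
Lemma smooth_pdpd u i j : cont1 u -> pd i (pd j (smooth u)) = pd j (pd i (smooth u)).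
Proof.
move=> c1; have [->//|ij] := eqVneq i j.
have us := enum_uniq 'I_m; have me (k : 'I_m) : k \in enum 'I_m by rewrite mem_enum.
rewrite /smooth !(pd_stks_upd c1 us (me _))// /upd ?(negbTE ij) 1?eq_sym ?(negbTE ij)//.
by congr (stks _ _ u); apply/funext => k; rewrite !orbF orbC.
Qed.

Lemma smooth_twice u : cont1 u -> twice (smooth u).
Proof.
move=> c1; have cs := cont1_stks (fun=> false) (enum 'I_m) c1; split.
- exact: cont1_continuous cs.
- by case: cs.
- move=> x i; rewrite (pd_stks_upd c1 (enum_uniq _) (mem_enum _ _))//.
  by have [] := cont1_stks (upd (fun=> false) i) (enum 'I_m) c1.
Qed.

Lemma pd_smooth u j : cont1 u -> pd j (smooth u) = smooth (pd j u).
Proof. exact: pd_stks. Qed.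

Lemma stek_lin i (a : R) u q : continuous u -> continuous q ->
  stek i (fun x => u x + a * q x) = fun x => stek i u x + a * stek i q x.
Proof.
move=> cu cq; apply/funext => x; rewrite /stek int01D ?int01Z//; try exact: line_continuous.
by move=> t; apply: (cvgM (cvg_cst _)); exact: (@line_continuous q).
Qed.

Lemma smooth_lin (a : R) u q : continuous u -> continuous q ->
  smooth (fun x => u x + a * q x) = fun x => smooth u x + a * smooth q x.
Proof.
move=> cu cq; rewrite /smooth; elim: (enum _) => //= i s ->.
have cs (w : 'rV[R]_m -> R) : continuous w -> continuous (stks (fun=> false) s w).
  by move=> cw; elim: s => //= k s' IH; exact: stek_continuous.
by rewrite stek_lin//; exact: cs.
Qed.

Lemma smooth0 : smooth (fun=> 0) = fun=> 0.
Proof.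
rewrite /smooth; elim: (enum _) => //= i s ->; apply/funext => x.
by rewrite /stek int01_cst.
Qed.

Lemma smooth_close u x (a e : R) : continuous u ->
  (forall y, cube x (m%:R * h) y -> `|u y - a| <= e) -> `|smooth u x - a| <= e.
Proof.
move=> cu; suff G s x' : (forall y, cube x' ((size s)%:R * h) y -> `|u y - a| <= e) ->
    `|stks (fun=> false) s u x' - a| <= e.
  by move=> H; apply: G; rewrite size_enum_ord.
elim: s x' => [|i s IH] x' /= H.
  by apply: H => i; rewrite subrr normr0 mul0r.
have cs : continuous (stks (fun=> false) s u).
  by elim: (s) => //= k s' IH'; exact: stek_continuous.
have cl := @line_continuous _ x' (unitv R i) h cs.
rewrite /stek -(int01_cst a) -int01B//; last exact: cst_continuous.
apply: int01_bound.
  by move=> t; exact: (cvgB (cl t) (cvg_cst a)).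
move=> t t01; apply: IH => y cy; apply: H; rewrite -natr1 mulrDl mul1r addrC.
exact: cube_trans (seg_cube i x' t01) cy.
Qed.
End Steklov.

(** * Polynomial approximation and the Dirichlet problem on spheres *)

Section Bernstein.
Variable R : realType.

(* [bern N t g] is the expectation of [g] under the binomial law (N, t), so
   [t |-> bern N t (fun k => f (k / N))] is the Bernstein polynomial of [f]. *)
Fixpoint bern (N : nat) (t : R) (g : nat -> R) : R :=
  if N is N'.+1 then (1 - t) * bern N' t g + t * bern N' t (fun k => g k.+1) else g 0.

Lemma bernD N t g1 g2 : bern N t (fun k => g1 k + g2 k) = bern N t g1 + bern N t g2.
Proof. by elim: N g1 g2 => [//|N IH] g1 g2 /=; rewrite !IH; ring. Qed.

Lemma bernZ N t c g : bern N t (fun k => c * g k) = c * bern N t g.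
Proof. by elim: N g => [//|N IH] g /=; rewrite !IH; ring. Qed.

Lemma bern_cst N t c : bern N t (fun=> c) = c.
Proof. by elim: N => [//|N IH] /=; rewrite !IH; ring. Qed.

(** The centre [a] is arbitrary because the recursion moves it to [a - 1]; at [a = N t] this is the
    variance of the binomial law. *)
Lemma bern_var N t a : bern N t (fun k => (k%:R - a) ^+ 2) = N%:R * t * (1 - t) + (N%:R * t - a) ^+ 2.
Proof.
elim: N a => [|N IH] a /=; first by rewrite mulr0n; ring.
have -> : (fun k : nat => ((k.+1)%:R - a) ^+ 2) = (fun k : nat => (k%:R - (a - 1)) ^+ 2).
  by apply/funext => k; rewrite -natr1; congr (_ ^+ 2); ring.
by rewrite !IH -natr1; ring.
Qed.

Lemma bern_norm N t g G : 0 <= t <= 1 -> (forall k, (k <= N)%N -> `|g k| <= G k) ->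
  `|bern N t g| <= bern N t G.
Proof.
move=> /andP[t0 t1]; elim: N g G => [|N IH] g G H /=; first exact: H.
have t1' : 0 <= 1 - t by rewrite subr_ge0.
apply: le_trans (ler_normD _ _) _; rewrite !normrM (ger0_norm t0) (ger0_norm t1').
apply: lerD; apply: ler_wpM2l => //; apply: IH => k kN; apply: H => //.
exact: leqW.
Qed.

(** Chebyshev's argument: where [k / N] is farther than [d] from [t], the difference 2M is at most
    [2M (k/N - t)^2 / d^2], and the binomial variance bounds the mean of this majorant. *)
Lemma bern_approx N (phi : R -> R) (t e d M : R) : (0 < N)%N -> 0 <= t <= 1 -> 0 < d ->
  0 <= M -> 0 <= e ->
  (forall s, 0 <= s <= 1 -> `|phi s| <= M) ->
  (forall s, 0 <= s <= 1 -> `|s - t| <= d -> `|phi s - phi t| <= e) ->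
  `|bern N t (fun k => phi (k%:R / N%:R)) - phi t| <= e + 2 * M / d ^+ 2 / N%:R.
Proof.
move=> N0 t01 d0 M0 e0 bM mod.
have NR : 0 < N%:R :> R by rewrite ltr0n.
have -> : bern N t (fun k => phi (k%:R / N%:R)) - phi t =
   bern N t (fun k => phi (k%:R / N%:R) + - phi t) by rewrite bernD bern_cst.
pose c := 2 * M / d ^+ 2 / N%:R ^+ 2.
have c0 : 0 <= c by rewrite /c !(mulr_ge0, invr_ge0, exprn_ge0)// ltW.
apply: (le_trans (@bern_norm N t _ (fun k => e + c * (k%:R - N%:R * t) ^+ 2) t01 _)).
  move=> k kN; have s01 : 0 <= (k%:R / N%:R : R) <= 1.
    by apply/andP; split; [exact: divr_ge0|rewrite ler_pdivrMr// mul1r ler_nat].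
  have [sd|sd] := leP `|k%:R / N%:R - t| d.
    by apply: ler_wpDr; [rewrite mulr_ge0// sqr_ge0|exact: mod].
  apply: (le_trans (y := 2 * M)).
    by apply: le_trans (ler_normB _ _) _; have := bM _ s01; have := bM _ t01; lra.
  apply: ler_wpDl => //; have -> : c * (k%:R - N%:R * t) ^+ 2 = 2 * M * ((k%:R / N%:R - t) ^+ 2 / d ^+ 2).
    rewrite /c; field; rewrite !gt_eqF//.
  rewrite ler_peMr// ?mulr_ge0// ler_pdivlMr ?exprn_gt0// mul1r -[leRHS](real_normK (num_real _)).
  by rewrite ler_pXn2r// ?nnegrE ?ltW.
rewrite bernD bern_cst bernZ bern_var subrr expr0n addr0 lerD2l.
have -> : c * (N%:R * t * (1 - t)) = 2 * M / d ^+ 2 / N%:R * (t * (1 - t)).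
  by rewrite /c; field; rewrite !gt_eqF.
rewrite ler_piMr ?divr_ge0// ?mulr_ge0// ?exprn_ge0 ?ltW//.
by case/andP: t01 => *; nra.
Qed.

Variable m : nat.
Implicit Types (u p q : 'rV[R]_m -> R) (x y v w : 'rV[R]_m) (i j : 'I_m) (k l : nat).

Definition setc i (c : R) x : 'rV[R]_m := \row_j (if j == i then c else x 0 j).

Fixpoint mbern N (s : seq 'I_m) u : 'rV[R]_m -> R :=
  if s is i :: s' then fun x => bern N (x 0 i) (fun k => mbern N s' (u \o setc i (k%:R / N%:R)) x)
  else u.

Lemma pol_bern N i (g : nat -> 'rV[R]_m -> R) : (forall k, pol (g k)) ->
  pol (fun x => bern N (x 0 i) (fun k => g k x)).
Proof.
elim: N g => [|N IH] g hg /=; first exact: hg.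
apply: polD; apply: polM; try exact: IH; last exact: pol_coord.
apply: polD; first exact: pol_cst.
have -> : (fun x : 'rV[R]_m => - x 0 i) = (fun x => (-1) * x 0 i) by apply/funext => x; rewrite mulN1r.
apply: polZ; exact: pol_coord.
Qed.

(** That [u] depends only on the coordinates in [s] is the invariant of the induction: freezing
    [x_i] at a grid point removes [i] from the list, and a function of no coordinates is
    constant. *)
Lemma pol_mbern N s u : (forall x y, (forall i, i \in s -> x 0 i = y 0 i) -> u x = u y) ->
  pol (mbern N s u).
Proof.
elim: s u => [|i s IH] u dep /=.
  rewrite (_ : u = fun=> u 0); first exact: pol_cst.
  by apply/funext => x; apply: dep.
apply: pol_bern => k; apply: IH => x y xy; apply: dep => j.
rewrite inE !mxE; case: eqP => //= _; exact: xy.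
Qed.

Definition unitc x := forall i, 0 <= x 0 i <= 1.

Lemma mbern_approx N s u (e d M : R) x : (0 < N)%N -> 0 < d -> 0 <= M -> 0 <= e -> unitc x ->
  (forall x, unitc x -> `|u x| <= M) ->
  (forall x y, unitc x -> unitc y -> (forall i, `|x 0 i - y 0 i| <= d) -> `|u x - u y| <= e) ->
  `|mbern N s u x - u x| <= (size s)%:R * (e + 2 * M / d ^+ 2 / N%:R).
Proof.
move=> N0 d0 M0 e0 ux; elim: s u => [|i s IH] u bM mod /=; first by rewrite subrr normr0 mul0r.
have uset (c : R) z : 0 <= c <= 1 -> unitc z -> unitc (setc i c z).
  by move=> c01 uz j; rewrite mxE; case: ifP.
have N01 k : (k <= N)%N -> 0 <= (k%:R / N%:R : R) <= 1.
  by move=> kN; apply/andP; split; [exact: divr_ge0|rewrite ler_pdivrMr ?ltr0n// mul1r ler_nat].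
set A := bern _ _ _; set B := bern N (x 0 i) (fun k => u (setc i (k%:R / N%:R) x)).
have -> : A - u x = (A - B) + (B - u x) by ring.
rewrite -natr1 mulrDl mul1r; apply: le_trans (ler_normD _ _) _; apply: lerD.
  have -> : A - B = bern N (x 0 i) (fun k => mbern N s (u \o setc i (k%:R / N%:R)) x +
       (-1) * u (setc i (k%:R / N%:R) x)) by rewrite bernD bernZ mulN1r.
  set E := (size s)%:R * _; rewrite -[leRHS](bern_cst N (x 0 i)).
  apply: bern_norm => [|k kN]; first exact: ux.
  rewrite mulN1r; apply: IH.
    by move=> z uz; apply: bM; apply: uset => //; exact: N01.
  move=> y z uy uz yz; apply: mod; try by apply: uset => //; exact: N01.
  by move=> j; rewrite !mxE; case: ifP => // _; rewrite subrr normr0 ltW.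
have xE : x = setc i (x 0 i) x by apply/rowP => j; rewrite mxE; case: eqP => [->|].
have -> : u x = u (setc i (x 0 i) x) by rewrite -xE.
apply: (@bern_approx N (fun t => u (setc i t x))) => //.
  by move=> c c01; apply: bM; exact: uset.
move=> c c01 cd; apply: mod; try exact: uset.
by move=> j; rewrite !mxE; case: ifP => // _; rewrite subrr normr0 ltW.
Qed.

Lemma weierstrass u (r e : R) : continuous u -> 0 < r -> 0 < e ->
  exists2 q, pol q & forall x, cube 0 r x -> `|u x - q x| <= e.
Proof.
move=> cu r0 e0.
have r20 : 0 < 2 * r by rewrite mulr_gt0.
pose A := @affine R m (fun=> - r) (fun=> 2 * r).
pose w := u \o A.
have HA x : unitc x -> cube 0 r (A x).
  move=> ux i; rewrite !mxE subr0 ler_norml; have /andP[x0 x1] := ux i.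
  by apply/andP; split; nra.
have mp : 0 < m%:R + 1 :> R by rewrite ltr_wpDl.
(* One half is for the modulus of continuity and one for the variance term, in each of [m]
   coordinates; [m + 1] keeps the quotient meaningful in dimension 0. *)
have e1 : 0 < e / (m%:R + 1) / 2 by rewrite !divr_gt0.
have [d d0 Hd] := unif_cont cu (@cube_compact R m 0 r) e1.
have [M M0 HM] := @cont_bounded R m u 0 r (ltW r0) cu.
pose d' := d / (2 * r).
have d'0 : 0 < d' by rewrite divr_gt0.
have [N N0 NB] : exists2 N, (0 < N)%N & 2 * M / d' ^+ 2 / N%:R <= e / (m%:R + 1) / 2.
  pose c := 2 * M / d' ^+ 2 / (e / (m%:R + 1) / 2).
  have ge1 := ltW d'0; have ge2 := ltW e0; have ge3 := ltW mp; have ge4 := ltW d0; have ge5 := ltW r0.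
  have c0 : 0 <= c by rewrite /c !(mulr_ge0, invr_ge0, exprn_ge0)//.
  exists (Num.bound c).
    by rewrite -(ltr0n R); apply: le_lt_trans c0 (archi_boundP c0).
  have bp : 0 < (Num.bound c)%:R :> R by apply: le_lt_trans c0 (archi_boundP c0).
  rewrite ler_pdivrMr// -ler_pdivrMl// [leLHS]mulrC; exact: ltW (archi_boundP c0).
pose q := mbern N (enum 'I_m) w.
have pq : pol q.
  apply: pol_mbern => x y xy; congr (w _); apply/rowP => i; apply: xy; exact: mem_enum.
exists (fun x => q (affine (fun=> 1/2) (fun=> (2 * r)^-1) x)); first exact: pol_affine.
move=> x cx; pose z := affine (fun=> 1/2) (fun=> (2 * r)^-1) x.
have uz : unitc z.
  move=> i; rewrite mxE mulrC; have := cx i; rewrite mxE subr0 ler_norml => /andP[x0 x1].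
  have : `|x 0 i / (2 * r)| <= 1/2.
    rewrite normrM normfV (gtr0_norm r20) ler_pdivrMr// ler_norml; apply/andP; split; lra.
  by rewrite ler_norml => /andP[? ?]; apply/andP; split; lra.
have -> : u x = w z.
  by congr (u _); apply/rowP => i; rewrite !mxE; field; rewrite gt_eqF.
rewrite distrC.
have := @mbern_approx N (enum 'I_m) w _ d' M z N0 d'0 M0 (ltW e1) uz _ _.
move=> H; apply: le_trans (H _ _) _ => [y uy|y y' uy uy' yy'|].
- by apply: HM; exact: HA.
- apply: Hd; first exact: HA.
  move=> i; rewrite !mxE; have -> : - r + 2 * r * y 0 i - (- r + 2 * r * y' 0 i) = 2 * r * (y 0 i - y' 0 i) by ring.
  by rewrite normrM (gtr0_norm r20) mulrC -ler_pdivlMr.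
rewrite size_enum_ord; apply: (le_trans (y := m%:R * (e / (m%:R + 1)))).
  by rewrite ler_wpM2l//; move: NB; set a := e / _; lra.
by rewrite mulrA ler_pdivrMr// mulrC ler_wpM2l ?ltW//; lra.
Qed.
End Bernstein.

(** * Harmonic polynomials with given values on a sphere *)

Section Dirichlet.
Variables (R : realType) (m : nat).
Hypothesis m0 : (0 < m)%N.
Implicit Types (u p q g : 'rV[R]_m -> R) (x y v w : 'rV[R]_m) (i j : 'I_m) (k l s : nat).

Definition r2 x : R := \sum_i x 0 i ^+ 2.

Lemma hpoly_r2 : hpoly 2 r2.
Proof. by apply: hpoly_sum => i _; exact: hpolyXn. Qed.

Lemma hpoly_r2X s : hpoly (2 * s) (fun x => r2 x ^+ s).
Proof.
elim: s => [|s IH]; first by exists 1; apply/funext => x; rewrite expr0.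
by rewrite mulnS; under eq_fun do rewrite exprS; exact: hpolyM hpoly_r2 IH.
Qed.

Lemma pd_r2 i x : pd i r2 x = 2 * x 0 i.
Proof.
have dX (j : 'I_m) : dff (fun y : 'rV[R]_m => y 0 j ^+ 2) := hpoly_dff (@hpolyXn R m j 2).
rewrite /pd (Dv_sum _ _ _ x dX) (bigD1 i)//= -[X in X + _]/(pd i (fun y : 'rV[R]_m => y 0 i ^+ 2) x).
rewrite pd_sqcoord eqxx mulr1 big1 ?addr0// => j ij.
rewrite -[LHS]/(pd i (fun y : 'rV[R]_m => y 0 j ^+ 2) x) pd_sqcoord.
by rewrite eq_sym (negbTE ij) mulr0 mul0r.
Qed.

Lemma lap_r2M k g x : hpoly k g ->
  lap (fun y => r2 y * g y) x = (2 * m%:R + 4 * k%:R) * g x + r2 x * lap g x.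
Proof.
move=> hg; have dg := hpoly_dff hg; have dr := hpoly_dff hpoly_r2.
have dpg i : dff (pd i g) := hpoly_dff (hpoly_pd i hg).
have E i : pd i (fun y => r2 y * g y) = fun y => r2 y * pd i g y + g y * (2 * y 0 i).
  by apply/funext => y; rewrite -pd_r2; exact: (DvM _ y dr dg).
have E2 i : pd i (pd i (fun y => r2 y * g y)) x = 2 * g x + 4 * (x 0 i * pd i g x) + r2 x * pd i (pd i g) x.
  have dx2 := dffM (@dff_cst R m 2) (@dff_coord R m i).
  rewrite E /pd (DvD _ x (dffM dr (dpg i)) (dffM dg dx2)) (DvM _ x dr (dpg i)) (DvM _ x dg dx2).
  rewrite (DvZ 2 _ x (@dff_coord R m i)) Dv_coord unitvE eqxx.
  have pdE u : 'D_(unitv R i) u x = pd i u x by [].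
  rewrite !pdE pd_r2 mulr1n; ring.
rewrite [LHS](eq_bigr _ (fun i _ => E2 i)).
rewrite !big_split /= -mulr_sumr -!mulr_sumr sumr_const card_ord.
by rewrite -(Dv_pd x x dg) (hpoly_euler x hg) -mulr_natl -[\sum_i pd i (pd i g) x]/(lap g x); ring.
Qed.

Lemma lap_r2XM k g s x : hpoly k g ->
  lap (fun y => r2 y ^+ s * g y) x =
  2 * s%:R * (m%:R + 2 * k%:R + 2 * s%:R - 2) * (r2 x ^+ s.-1 * g x) + r2 x ^+ s * lap g x.
Proof.
move=> hg; elim: s => [|s IH].
  rewrite mulr0 mul0r mul0r add0r expr0 mul1r.
  by congr (lap _ x); apply/funext => y; rewrite expr0 mul1r.
have -> : (fun y => r2 y ^+ s.+1 * g y) = (fun y => r2 y * (r2 y ^+ s * g y)).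
  by apply/funext => y; rewrite exprS mulrA.
rewrite (lap_r2M x (hpolyM (hpoly_r2X s) hg)) IH /= -natr1 natrD natrM.
by case: s {IH} => [|s] /=; rewrite ?exprS ?expr0 -?natr1; ring.
Qed.

Definition lapn s g := iter s (@lap R m) g.

Lemma hpoly_lapn k s g : hpoly k g -> hpoly (k - 2 * s) (lapn s g).
Proof.
move=> hg; elim: s => [|s IH]; first by rewrite muln0 subn0.
by rewrite mulnS addnC addn2 !subnS; exact: hpoly_lap IH.
Qed.

(* Makes consecutive terms cancel in the Laplacian of the sum in [harmonic_proj]. *)
Fixpoint dcoef k s : R :=
  if s is s'.+1 then - dcoef k s' / (2 * s%:R * (m%:R + 2 * k%:R - 2 * s%:R - 2)) else 1.

Lemma lap_sum (N : nat) (F : nat -> 'rV[R]_m -> R) x : (forall s, pol (F s)) ->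
  lap (fun y => \sum_(s < N) F s y) x = \sum_(s < N) lap (F s) x.
Proof. by move=> pF; have [_ ->] := twice_sum predT (fun s : 'I_N => pol_twice (pF s)). Qed.

Lemma harmonic_proj k q : hpoly k q ->
  harmfun (fun x => \sum_(s < (k./2).+1) dcoef k s * (r2 x ^+ s * lapn s q x)).
Proof.
move=> hq x.
have ph s : pol (fun x => r2 x ^+ s * lapn s q x) := pol_hpoly (hpolyM (hpoly_r2X s) (hpoly_lapn s hq)).
rewrite (@lap_sum _ (fun s x => dcoef k s * (r2 x ^+ s * lapn s q x))); last by move=> s; exact: polZ.
have E s : (s <= k./2)%N -> lap (fun x => dcoef k s * (r2 x ^+ s * lapn s q x)) x =
   (if s is s'.+1 then - (dcoef k s' * (r2 x ^+ s' * lapn s'.+1 q x)) else 0) +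
   dcoef k s * (r2 x ^+ s * lapn s.+1 q x).
  move=> sk; rewrite (lapZ _ x (pol_twice (ph s))) (lap_r2XM s x (hpoly_lapn s hq)).
  rewrite mulrDr; congr (_ + _); case: s sk => [|s] sk; first by rewrite mulr0 !mul0r mulr0.
  have s2k : (2 * s.+1 <= k)%N by rewrite mul2n -geq_half_double.
  rewrite natrB// natrM [dcoef k s.+1]/=.
  have nz : m%:R + 2 * k%:R - 2 * (s.+1)%:R - 2 != 0 :> R.
    have : 2 * (s.+1)%:R <= k%:R :> R by rewrite -natrM ler_nat.
    have : 1 <= m%:R :> R by rewrite ler1n.
    have : 1 <= (s.+1)%:R :> R by rewrite ler1n.
    by move=> *; rewrite gt_eqF//; lra.
  have nz2 : (s.+1)%:R != 0 :> R by rewrite pnatr_eq0.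
  rewrite [lapn s.+1 q]lock /=; move: (s.+1%:R) nz nz2 (locked _) => S nz nz2 L; field.
  by rewrite nz2 nz.
have tele N : (N <= k./2)%N -> \sum_(s < N.+1) lap (fun x => dcoef k s * (r2 x ^+ s * lapn s q x)) x =
   dcoef k N * (r2 x ^+ N * lapn N.+1 q x).
  elim: N => [|N IH] Nk; first by rewrite big_ord_recr big_ord0 /= add0r (E 0%N)// add0r.
  by rewrite big_ord_recr /= IH ?(ltnW Nk)// (E N.+1)// addrA subrr add0r.
rewrite tele//.
(* What survives the cancellation is one more Laplacian of a polynomial of degree at most 1. *)
have -> : lapn (k./2).+1 q x = 0; last by rewrite !mulr0.
have h := hpoly_lapn k./2 hq.
have : (k - 2 * k./2 <= 1)%N by rewrite mul2n -{1}(odd_double_half k) addnK; case: odd.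
rewrite /lapn /= -/(lapn _ q); case: (k - 2 * k./2)%N h => [|[|//]] h _.
  by rewrite /lap big1// => i _; exact: hpoly0_Dv (hpoly_pd i h).
rewrite /lap big1// => i _; exact: hpoly0_Dv (hpoly_pd i h).
Qed.

(** The first coefficient of the harmonic projection [h] is 1, so [q = h - r2 g] with [g] of degree
    [k - 2]. On the sphere [r2] is the constant [c], and the induction hypothesis replaces [g] by a
    harmonic polynomial. *)
Lemma hpoly_sphere (c : R) k q : hpoly k q ->
  exists p, [/\ pol p, harmfun p & forall x, r2 x = c -> q x = p x].
Proof.
elim/ltn_ind: k q => k IH q hq.
pose h x := \sum_(s < (k./2).+1) dcoef k s * (r2 x ^+ s * lapn s q x).
have ph s : pol (fun x => r2 x ^+ s * lapn s q x) := pol_hpoly (hpolyM (hpoly_r2X s) (hpoly_lapn s hq)).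
have pp : pol h by apply: pol_sum => s _; exact: polZ.
pose g x := \sum_(s < k./2) dcoef k s.+1 * (r2 x ^+ s * lapn s.+1 q x).
have hE x : h x = q x + r2 x * g x.
  rewrite /h big_ord_recl /= expr0 !mul1r; congr (_ + _).
  rewrite mulr_sumr; apply: eq_bigr => s _; rewrite /bump /= add1n exprS; ring.
have [k2|k2] := ltnP k 2.
  exists h; split => //; first exact: harmonic_proj.
  move=> x _; rewrite hE /g; have -> : k./2 = 0%N by case: (k) k2 => [|[|]].
  by rewrite big_ord0 mulr0 addr0.
have hg : hpoly (k - 2) g.
  apply: hpoly_sum => s _; apply: hpolyZ.
  have -> : (k - 2 = 2 * s + (k - 2 * s.+1))%N.
    have : (2 * s.+1 <= k)%N by rewrite mul2n -geq_half_double.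
    by move=> H; rewrite mulnS addnC subnDA addnC subnKC// leq_subRL ?(leq_trans _ H)// ?mulnS ?leq_addr.
  exact: hpolyM (hpoly_r2X s) (hpoly_lapn s.+1 hq).
have [|p' [pp' hp' E]] := IH (k - 2)%N _ g hg; first by rewrite ltn_subrL (leq_trans _ k2).
exists (fun x => h x + (- c) * p' x); split.
- exact: polD pp (polZ _ pp').
- move=> x; rewrite (lapD x (pol_twice pp) (pol_twice (polZ (- c) pp'))).
  rewrite (lapZ _ x (pol_twice pp')) hp' mulr0 addr0; exact: harmonic_proj.
- by move=> x xc; rewrite hE -(E _ xc) xc; ring.
Qed.

Lemma pol_sphere (c : R) q : pol q ->
  exists p, [/\ pol p, harmfun p & forall x, r2 x = c -> q x = p x].
Proof.
move=> [d [q' [hq ->]]].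
have /choice[p Hp] k : exists p, [/\ pol p, harmfun p & forall x, r2 x = c -> q' k x = p x].
  exact: hpoly_sphere (hq k).
exists (fun x => \sum_(k < d) p k x); split.
- by apply: pol_sum => k _; case: (Hp k).
- move=> x; rewrite (@lap_sum d p x); last by move=> k; case: (Hp k).
  by rewrite big1// => k _; case: (Hp k).
- by move=> x xc; apply: eq_bigr => k _; case: (Hp k) => _ _; apply.
Qed.
End Dirichlet.

(** * Expansion of entire harmonic functions *)

Section LocallyUniformLimits.
Variables (R : realType) (m : nat).
Hypothesis m0 : (0 < m)%N.
Implicit Types (u p q g f : 'rV[R]_m -> R) (x y v w : 'rV[R]_m) (i j : 'I_m) (k l s N : nat).

Lemma cauchy_limit (a : nat -> R) :
  (forall e : R, 0 < e -> exists N, forall n k, (N <= n)%N -> (N <= k)%N -> `|a n - a k| <= e) ->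
  exists l : R, forall e : R, 0 < e -> exists N, forall n, (N <= n)%N -> `|a n - l| <= e.
Proof.
move=> H; have ca : cvg (a @ \oo).
  apply/cauchy_cvgP; apply: cauchy_exP => e e0; have e20 : 0 < e / 2 by rewrite divr_gt0.
  have [N HN] := H _ e20; exists (a N); exists N => // k kN.
  apply: le_lt_trans (HN N k (leqnn N) kN) _.
  by rewrite ltr_pdivrMr// ltr_pMr// ltr1n.
exists (lim (a @ \oo)) => e e0.
have /cvgrPdist_le/(_ e e0)[N _ HN] := ca.
by exists N => n nN; rewrite distrC; exact: HN.
Qed.

(* luc: locally uniform convergence. *)
Definition luc_lim (p : nat -> 'rV[R]_m -> R) f := forall (r e : R), 0 < r -> 0 < e ->
  exists N, forall n, (N <= n)%N -> forall x, cube 0 r x -> `|p n x - f x| <= e.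

Lemma cube_exists x : exists2 r : R, 0 < r & cube 0 r x.
Proof.
exists (1 + \sum_i `|x 0 i|); first by rewrite ltr_wpDr// sumr_ge0.
move=> i; rewrite mxE subr0 (bigD1 i)//= addrCA lerDl addr_ge0// sumr_ge0 //.
Qed.

Lemma luc_lim_continuous (p : nat -> 'rV[R]_m -> R) f :
  (forall N, continuous (p N)) -> luc_lim p f -> continuous f.
Proof.
move=> cp lf x; apply: cube_cont => e e0.
have e3 : 0 < e / 3 by rewrite divr_gt0.
have [r r0 cx] := cube_exists x.
have [N HN] := lf (r + 1) (e / 3) (addr_gt0 r0 ltr01) e3.
have [d d0 Hd] := cont_cube (cp N x) e3.
exists (Num.min d 1); first by rewrite lt_min d0 ltr01.
move=> y cy.
have c1 : cube 0 (r + 1) y by apply: cube_trans cx (cubeS _ cy); rewrite ge_min lexx orbT.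
have c2 : cube 0 (r + 1) x by apply: cubeS cx; rewrite lerDl.
have c3 : cube x d y by apply: cubeS cy; rewrite ge_min lexx.
have := HN N (leqnn N) y c1; have := HN N (leqnn N) x c2; have := Hd y c3.
rewrite !ler_norml => /andP[? ?] /andP[? ?] /andP[? ?]; apply/andP; split; lra.
Qed.

Lemma luc_limD (p q : nat -> 'rV[R]_m -> R) f g : luc_lim p f -> luc_lim q g ->
  luc_lim (fun N x => p N x + q N x) (fun x => f x + g x).
Proof.
move=> lf lg r e r0 e0; have e2 : 0 < e / 2 by rewrite divr_gt0.
have [N1 H1] := lf r _ r0 e2; have [N2 H2] := lg r _ r0 e2.
exists (maxn N1 N2) => n; rewrite geq_max => /andP[n1 n2] x cx.
have := H1 n n1 x cx; have := H2 n n2 x cx.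
by rewrite !ler_norml => /andP[? ?] /andP[? ?]; apply/andP; split; lra.
Qed.

Lemma luc_limZ (c : R) (p : nat -> 'rV[R]_m -> R) f : luc_lim p f -> luc_lim (fun N x => c * p N x) (fun x => c * f x).
Proof.
move=> lf r e r0 e0; have c1 : 0 < `|c| + 1 by rewrite ltr_wpDl.
have [N H] := lf r _ r0 (divr_gt0 e0 c1).
exists N => n nN x cx; rewrite -mulrBr normrM.
apply: le_trans (ler_wpM2l (normr_ge0 c) (H n nN x cx)) _.
rewrite mulrCA; apply: ler_piMr; [exact: ltW|by rewrite ler_pdivrMr// mul1r lerDl].
Qed.

Lemma luc_lim_cst f : luc_lim (fun=> f) f.
Proof. by move=> r e r0 e0; exists 0%N => n _ x _; rewrite subrr normr0 ltW. Qed.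

Lemma luc_lim_sum (I : Type) (s : seq I) (P : pred I) (p : I -> nat -> 'rV[R]_m -> R) (f : I -> 'rV[R]_m -> R) :
  (forall a, luc_lim (p a) (f a)) ->
  luc_lim (fun N x => \sum_(a <- s | P a) p a N x) (fun x => \sum_(a <- s | P a) f a x).
Proof.
move=> H; elim: s => [|a s IH].
  have -> : (fun x => \sum_(a <- [::] | P a) f a x) = fun=> 0 by apply/funext => x; rewrite big_nil.
  have -> : (fun N x => \sum_(a <- [::] | P a) p a N x) = fun=> fun=> 0.
    by apply/funext => N; apply/funext => x; rewrite big_nil.
  exact: luc_lim_cst.
have -> : (fun x => \sum_(b <- a :: s | P b) f b x) =
    fun x => (P a)%:R * f a x + \sum_(b <- s | P b) f b x.
  by apply/funext => x; rewrite big_cons; case: (P a); rewrite ?mul1r// mul0r add0r.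
have -> : (fun N x => \sum_(b <- a :: s | P b) p b N x) =
    fun N x => (P a)%:R * p a N x + \sum_(b <- s | P b) p b N x.
  by apply/funext => N; apply/funext => x; rewrite big_cons; case: (P a); rewrite ?mul1r// mul0r add0r.
exact: luc_limD (luc_limZ _ (H a)) IH.
Qed.

Lemma luc_lim_unique (p : nat -> 'rV[R]_m -> R) f g x : luc_lim p f -> luc_lim p g -> f x = g x.
Proof.
move=> lf lg; apply/eqP; rewrite -subr_eq0 -normr_le0; apply/ler_addgt0Pr => e e0.
have e2 : 0 < e / 2 by rewrite divr_gt0.
have [r r0 cx] := cube_exists x.
have [N1 H1] := lf r _ r0 e2; have [N2 H2] := lg r _ r0 e2.
have := H1 _ (leq_maxl N1 N2) x cx; have := H2 _ (leq_maxr N1 N2) x cx.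
rewrite add0r !ler_norml => /andP[? ?] /andP[? ?]; apply/andP; split; lra.
Qed.

Lemma luc_lim_eq (p q : nat -> 'rV[R]_m -> R) f : (forall N x, p N x = q N x) -> luc_lim p f -> luc_lim q f.
Proof. by move=> pq H r e r0 e0; have [N HN] := H r e r0 e0; exists N => n nN x; rewrite -pq; exact: HN. Qed.

Lemma harmfunB p q : pol p -> pol q -> harmfun p -> harmfun q -> harmfun (fun x => p x + -1 * q x).
Proof.
move=> pp pq hp hq x; rewrite (lapD x (pol_twice pp) (pol_twice (polZ (-1) pq))).
by rewrite (lapZ _ x (pol_twice pq)) hp hq mulr0 addr0.
Qed.

(* The gradient estimate applied to [p_n - p_k]. *)
Lemma luc_lim_pd (p : nat -> 'rV[R]_m -> R) f i :
  (forall N, pol (p N)) -> (forall N, harmfun (p N)) -> luc_lim p f ->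
  (forall x, derivable f x (unitv R i)) /\ luc_lim (fun N => pd i (p N)) (pd i f).
Proof.
move=> pp hp lf.
have mR : 0 < m%:R :> R by rewrite ltr0n.
have unif (r e : R) : 0 < r -> 0 < e -> exists N, forall n k, (N <= n)%N -> (N <= k)%N ->
    forall x, cube 0 r x -> `|pd i (p n) x - pd i (p k) x| <= e.
  move=> r0 e0; have e1 : 0 < e / m%:R / 2 by rewrite !divr_gt0.
  have [N HN] := lf (r + 1) _ (addr_gt0 r0 ltr01) e1.
  exists N => n k nN kN x cx.
  have pd_p := polD (pp n) (polZ (-1) (pp k)).
  have := @pd_bound R m m0 _ i x 1 (e / m%:R) ltr01 pd_p (harmfunB (pp n) (pp k) (hp n) (hp k)).
  have -> : pd i (fun y => p n y + -1 * p k y) x = pd i (p n) x - pd i (p k) x.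
    by rewrite /pd (DvD _ x (pol_dff (pp n)) (pol_dff (polZ _ (pp k)))) (DvZ _ _ x (pol_dff (pp k))) mulN1r.
  rewrite divr1 mulrCA divff ?mulr1 ?gt_eqF//; apply => y cy.
  have c1 : cube 0 (r + 1) y := cube_trans cx cy.
  have := HN n nN y c1; have := HN k kN y c1.
  by rewrite !ler_norml => /andP[? ?] /andP[? ?]; apply/andP; split; lra.
have /choice[G HG] x : exists l : R, forall e : R, 0 < e -> exists N, forall n, (N <= n)%N -> `|pd i (p n) x - l| <= e.
  apply: cauchy_limit => e e0; have [r r0 cx] := cube_exists x.
  by have [N HN] := unif r e r0 e0; exists N => n k nN kN; exact: HN.
have lG : luc_lim (fun N => pd i (p N)) G.
  move=> r e r0 e0; have e2 : 0 < e / 2 by rewrite divr_gt0.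
  have [N HN] := unif r _ r0 e2; exists N => n nN x cx.
  have [N' HN'] := HG x _ e2.
  have := HN n (maxn N N') nN (leq_maxl _ _) x cx; have := HN' _ (leq_maxr N N').
  by rewrite !ler_norml => /andP[? ?] /andP[? ?]; apply/andP; split; lra.
have cG : continuous G.
  by apply: luc_lim_continuous lG => N; exact/pol_continuous/pol_pd.
have D x : is_derive x (unitv R i) f (G x).
  suff H : (fun s : R => s^-1 *: ((f \o shift x) (s *: unitv R i) - f x)) @ 0^' --> G x.
    by apply: DeriveDef; [apply/cvg_ex; exists (G x)|exact: cvg_lim H].
  apply/cvgrPdist_le => e e0; have e2 : 0 < e / 2 by rewrite divr_gt0.
  have [r r0 cx] := cube_exists x.
  have [d d0 Hd] := cont_cube (cG x) e2.
  exists (Num.min d 1) => /=; first by rewrite lt_min d0 ltr01.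
  move=> s /=; rewrite sub0r normrN lt_min => /andP[sd s1] s0.
  have ns0 : 0 < `|s| by rewrite normr_gt0.
  (* The index [n] must depend on the increment [s], since the error of [p n] is divided by |s|. The
     bound is therefore proved up to an arbitrary [a]. *)
  apply/ler_addgt0Pr => a a0.
  have a1 : 0 < `|s| * a / 4 by rewrite !(mulr_gt0, divr_gt0).
  have a2 : 0 < Num.min (a / 2) (e / 2) by rewrite lt_min !divr_gt0.
  have [N1 HN1] := lf (r + 1) _ (addr_gt0 r0 ltr01) a1.
  have [N2 HN2] := lG (r + 1) _ (addr_gt0 r0 ltr01) e2.
  pose n := maxn N1 N2.
  have cxs : cube 0 (r + 1) (x + s *: unitv R i).
    by apply: cube_trans cx _; apply: cube_line; exact: ltW.
  have cx1 : cube 0 (r + 1) x by apply: cubeS cx; rewrite lerDl.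
  have [c cs E] := @mvt_line R m (p n) (unitv R i) x s (fun=> dff_derivable (pol_dff (pp n))).
  have E2 : s^-1 * (p n (x + s *: unitv R i) - p n x) = pd i (p n) (x + c *: unitv R i).
    by rewrite E mulKf.
  have cxc : cube 0 (r + 1) (x + c *: unitv R i).
    by apply: cube_trans cx _; apply: cube_line; exact: le_trans cs (ltW s1).
  have B1 := HN1 n (leq_maxl _ _) _ cxs; have B2 := HN1 n (leq_maxl _ _) _ cx1.
  have B3 := HN2 n (leq_maxr _ _) _ cxc.
  have B4 : `|G (x + c *: unitv R i) - G x| <= e / 2.
    by apply: Hd; apply: cube_line; exact: le_trans cs (ltW sd).
  have B5 : `|s^-1 * (f (x + s *: unitv R i) - f x) - s^-1 * (p n (x + s *: unitv R i) - p n x)| <= a.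
    rewrite -mulrBr normrM normfV ler_pdivrMl//.
    move: B1 B2; rewrite !ler_norml => /andP[? ?] /andP[? ?].
    have : 0 < `|s| * a by rewrite mulr_gt0.
    by move=> ?; apply/andP; split; lra.
  rewrite [s *: _ + x]addrC -[_ *: _]/(_ * _).
  move: B3 B4 B5; rewrite -E2 !ler_norml => /andP[? ?] /andP[? ?] /andP[? ?].
  by apply/andP; split; lra.
split; first by move=> x; exact: (ex_derive (is_derive := D x)).
rewrite (_ : pd i f = G)//; apply/funext => x; exact: (derive_val (is_derive := D x)).
Qed.

Lemma harmfun_pd p i : pol p -> harmfun p -> harmfun (pd i p).
Proof. exact: harmonic_Dv. Qed.

Lemma luc_lim_harm (p : nat -> 'rV[R]_m -> R) f :
  (forall N, pol (p N)) -> (forall N, harmfun (p N)) -> luc_lim p f -> harmfun f.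
Proof.
move=> pp hp lf x.
have H i : luc_lim (fun N => pd i (pd i (p N))) (pd i (pd i f)).
  have [_ l1] := luc_lim_pd i pp hp lf.
  by have [] := luc_lim_pd i (fun N => pol_pd i (pp N)) (fun N => harmfun_pd i (pp N) (hp N)) l1.
have := luc_lim_sum (index_enum 'I_m) xpredT H.
have : luc_lim (fun N x => \sum_i pd i (pd i (p N)) x) (fun=> 0).
  apply: luc_lim_eq (luc_lim_cst _) => N y; by rewrite -[RHS]/(lap (p N) y) hp.
move=> l0 l1; exact: (luc_lim_unique x l1 l0).
Qed.

(** Partial derivatives converge too, and by induction their limits are forms of degree one less.
    Euler's identity, passed to the limit, rebuilds [f] from them. *)
Lemma luc_lim_hpoly k (p : nat -> 'rV[R]_m -> R) f :
  (forall N, hpoly k (p N)) -> (forall N, harmfun (p N)) -> luc_lim p f -> hpoly k f.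
Proof.
elim: k p f => [|k IH] p f hp hh lf.
  exists (f 0); apply/funext => x.
  apply/eqP; rewrite -subr_eq0 -normr_le0; apply/ler_addgt0Pr => e e0.
  have e2 : 0 < e / 2 by rewrite divr_gt0.
  have [r r0 cx] := cube_exists x.
  have [N HN] := lf r _ r0 e2.
  have c0 : cube 0 r (0 : 'rV[R]_m) by move=> i; rewrite mxE subr0 normr0 ltW.
  have := HN N (leqnn N) x cx; have := HN N (leqnn N) 0 c0.
  have [c ->] := hp N.
  by rewrite add0r !ler_norml => /andP[? ?] /andP[? ?]; apply/andP; split; lra.
have pp N := pol_hpoly (hp N).
have Hi i : hpoly k (pd i f).
  have [_ l1] := luc_lim_pd i pp hh lf.
  exact: (IH _ _ (fun N => hpoly_pd i (hp N)) (fun N => harmfun_pd i (pp N) (hh N)) l1).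
exists (fun i x => (k.+1)%:R^-1 * pd i f x); first by move=> i; exact: hpolyZ (Hi i).
apply/funext => x.
have nz : (k.+1)%:R != 0 :> R by rewrite pnatr_eq0.
have E N : p N x = \sum_i x 0 i * (k.+1%:R^-1 * pd i (p N) x).
  have := hpoly_euler x (hp N); rewrite (Dv_pd x x (hpoly_dff (hp N))) => E.
  apply: (mulfI nz); rewrite -E mulr_sumr; apply: eq_bigr => i _.
  by rewrite mulrCA [k.+1%:R * _]mulrA divff// mul1r.
have l2 i : luc_lim (fun N (_ : 'rV[R]_m) => x 0 i * (k.+1%:R^-1 * pd i (p N) x)) (fun=> x 0 i * (k.+1%:R^-1 * pd i f x)).
  apply: luc_limZ; apply: luc_limZ => r e r0 e0; have [s s0 cx] := cube_exists x.
  have [_ l1] := luc_lim_pd i pp hh lf.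
  by have [N HN] := l1 s e s0 e0; exists N => n nN _ _; exact: HN.
have l3 := luc_lim_sum (index_enum 'I_m) xpredT l2.
have l4 : luc_lim (fun N (_ : 'rV[R]_m) => p N x) (fun=> f x).
  move=> r e r0 e0; have [s s0 cx] := cube_exists x.
  by have [N HN] := lf s e s0 e0; exists N => n nN _ _; exact: HN.
have l5 := luc_lim_eq (fun N _ => E N) l4.
exact: (luc_lim_unique x l5 l3).
Qed.
End LocallyUniformLimits.

(** * Geometric tails and uniqueness of power series *)

Section PowerSeries.
Variable R : realType.
Implicit Types (a b : nat -> R) (t e : R) (k l n N : nat).

Lemma geo_le2 t n : 0 <= t <= 2^-1 -> \sum_(i < n) t ^+ i <= 2.
Proof.
move=> /andP[t0 t1]; elim: n => [|n IH]; first by rewrite big_ord0.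
rewrite big_ord_recl expr0; under eq_bigr do rewrite lift0 exprS.
rewrite -mulr_sumr; have : 0 <= \sum_(i < n) t ^+ i by apply: sumr_ge0 => i _; exact: exprn_ge0.
by set S := \sum_(_ < _) _ in IH * => S0; nra.
Qed.

Lemma geo_tail_le t n K : 0 <= t <= 2^-1 -> \sum_(K <= i < n) t ^+ i <= 2 * t ^+ K.
Proof.
move=> t01; have [nK|Kn] := leqP n K.
  by rewrite big_geq// mulr_ge0// exprn_ge0//; case/andP: t01.
rewrite -{1}(add0n K) big_addn big_mkord.
under eq_bigr do rewrite exprD.
rewrite -mulr_suml ler_wpM2r ?geo_le2// exprn_ge0//; by case/andP: t01.
Qed.

Lemma half_pow_small (c e : R) : 0 <= c -> 0 < e -> exists K, forall k, (K <= k)%N -> c * 2^-1 ^+ k <= e.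
Proof.
move=> c0 e0; have ce : 0 <= c / e by rewrite divr_ge0// ltW.
exists (Num.bound (c / e)) => k Kk.
have kk : k%:R <= 2 ^+ k :> R by rewrite -natrX ler_nat ltnW// ltn_expl.
have : c / e <= 2 ^+ k.
  by apply: le_trans kk; apply: le_trans (ltW (archi_boundP ce)) _; rewrite ler_nat.
by rewrite ler_pdivrMr// exprVn => H; rewrite ler_pdivrMr ?exprn_gt0// mulrC.
Qed.

Lemma lim_bound a (l B : R) N : (forall e : R, 0 < e -> exists N, forall n, (N <= n)%N -> `|a n - l| <= e) ->
  (forall n, (N <= n)%N -> `|a n| <= B) -> `|l| <= B.
Proof.
move=> H bd; apply/ler_addgt0Pr => e e0; have [N' HN] := H e e0.
have := HN _ (leq_maxr N N'); have := bd _ (leq_maxl N N').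
by rewrite !ler_norml => /andP[? ?] /andP[? ?]; apply/andP; split; lra.
Qed.

(** Convergence at [t = 1] bounds all coefficients by some [B]. If the coefficients before [k]
    vanish, the tail after [b k t^k] is at most [2 B t^(k+1)], which is negligible against [t^k] for
    small [t]. *)
Lemma series_unique b :
  (forall t e : R, `|t| <= 1 -> 0 < e -> exists N, forall n, (N <= n)%N -> `|\sum_(k < n) b k * t ^+ k| <= e) ->
  forall k, b k = 0.
Proof.
move=> H.
have [N0 HN0] := H 1 1 ltac:(by rewrite normr1) ltr01.
pose B := 2 + \sum_(k < N0) `|b k|.
have B0 : 0 < B by rewrite ltr_wpDr// sumr_ge0.
have bB k : `|b k| <= B.
  have [kN|Nk] := ltnP k N0.
    by rewrite /B (bigD1 (Ordinal kN))//= addrCA lerDl addr_ge0// sumr_ge0.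
  have := HN0 k Nk; have := HN0 k.+1 (leqW Nk); rewrite big_ord_recr /= expr1n mulr1.
  set S := \sum_(_ < k) _; have : 0 <= \sum_(k < N0) `|b k| by rewrite sumr_ge0.
  rewrite /B; set T := \sum_(_ < N0) _; rewrite !ler_norml => ? /andP[? ?] /andP[? ?].
  by apply/andP; split; lra.
elim/ltn_ind => k IH.
apply/eqP; rewrite -normr_le0; apply/ler_addgt0Pr => e e0; rewrite add0r.
(* Then [2 B t <= e / 2], so that the tail takes half of [e] and the partial sum the other half. *)
pose t := Num.min 2^-1 (e / (4 * B)).
have t0 : 0 < t by rewrite lt_min invr_gt0 ltr0n /= divr_gt0// mulr_gt0.
have t01 : 0 <= t <= 2^-1 by rewrite (ltW t0) ge_min lexx.
have t1 : `|t| <= 1 by rewrite gtr0_norm//; case/andP: t01 => *; lra.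
have tk : 0 < t ^+ k by exact: exprn_gt0.
have [N HN] := H t (t ^+ k * (e / 2)) t1 (mulr_gt0 tk (divr_gt0 e0 (ltr0Sn R 1))).
have := HN (maxn N k.+1) (leq_maxl _ _).
have kn := leq_maxr N k.+1; move: (maxn N k.+1) kn => n kn.
rewrite -(big_mkord predT (fun k => b k * t ^+ k)) (big_cat_nat (n := k.+1))//= big_mkord big_ord_recr /=.
rewrite big1 => [|i _]; last by rewrite IH// mul0r.
rewrite add0r => H1.
have H2 : `|\sum_(k.+1 <= i < n) b i * t ^+ i| <= t ^+ k * (e / 2).
  apply: le_trans (ler_norm_sum _ _ _) _.
  apply: (le_trans (y := \sum_(k.+1 <= i < n) B * t ^+ i)).
    apply: ler_sum => i _; rewrite normrM (ger0_norm (exprn_ge0 i (ltW t0))).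
    by rewrite ler_wpM2r// exprn_ge0// ltW.
  rewrite -mulr_sumr; apply: le_trans (ler_wpM2l (ltW B0) (geo_tail_le n k.+1 t01)) _.
  rewrite exprSr; have : t * (4 * B) <= e by rewrite -ler_pdivlMr ?mulr_gt0// ge_min lexx orbT.
  move=> tB; have -> : B * (2 * (t ^+ k * t)) = t ^+ k * (t * (4 * B) / 2) by field.
  by rewrite ler_wpM2l ?(ltW tk)// ler_pM2r// invr_gt0.
have H3 : `|b k * t ^+ k| <= t ^+ k * e.
  move: H1 H2; set X := b k * _; set Y := \sum_(_ <= _ < _) _.
  have -> : t ^+ k * e = t ^+ k * (e / 2) + t ^+ k * (e / 2) by field.
  rewrite !ler_norml => /andP[? ?] /andP[? ?]; by apply/andP; split; lra.
by move: H3; rewrite normrM (gtr0_norm tk) mulrC ler_pM2l.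
Qed.
End PowerSeries.

(** * Homogeneous expansion of approximately harmonic functions *)

Section EntireExpansion.
Variables (R : realType) (m : nat).
Hypothesis m0 : (0 < m)%N.
Implicit Types (u p g : 'rV[R]_m -> R) (x y v w : 'rV[R]_m) (i j : 'I_m) (k l s N : nat).

Lemma hpoly_sum0 d (q : nat -> 'rV[R]_m -> R) :
  (forall k, hpoly k (q k)) -> (forall x, \sum_(k < d) q k x = 0) ->
  forall k x, (k < d)%N -> q k x = 0.
Proof.
move=> hq q0 k x kd.
pose b l := if (l < d)%N then q l x else 0.
have -> : q k x = b k by rewrite /b kd.
apply: series_unique => t e _ e0; exists d => n dn.
rewrite (_ : \sum_(_ < n) _ = 0) ?normr0 ?ltW// -(big_mkord predT (fun k => b k * t ^+ k)).
rewrite (big_cat_nat (n := d))//= [X in _ + X]big_nat_cond [X in _ + X]big1 => [|l]; last first.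
  by rewrite andbT => /andP[dl _]; rewrite /b ltnNge dl mul0r.
rewrite addr0 big_mkord -[RHS](q0 (t *: x)); apply: eq_bigr => l _.
by rewrite (hpoly_hom x t (hq l)) /b ltn_ord mulrC.
Qed.

(** The Laplacians of the parts of degree at least 2 are homogeneous of distinct degrees, so their
    sum vanishes only if each does. *)
Lemma harmfun_part d (q : nat -> 'rV[R]_m -> R) k :
  (forall k, hpoly k (q k)) -> harmfun (fun x => \sum_(k < d) q k x) -> (k < d)%N -> harmfun (q k).
Proof.
move=> hq hh kd x.
have pq l := pol_hpoly (hq l).
case: k kd => [|[|k]] kd.
- by rewrite /lap big1// => i _; have h := hpoly_pd i (hq 0); exact: hpoly0_Dv h.
- by rewrite /lap big1// => i _; have h := hpoly_pd i (hq 1); exact: hpoly0_Dv h.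
case: d hh kd => [//|[//|d]] hh kd.
apply: (@hpoly_sum0 d (fun k => lap (q k.+2)) (fun k => hpoly_lap (hq k.+2))) => //.
move=> y; have := hh y; rewrite (lap_sum _ _ pq) !big_ord_recl /=.
have -> : lap (q 0) y = 0.
  by rewrite /lap big1// => i _; have h := hpoly_pd i (hq 0); exact: hpoly0_Dv h.
have -> : lap (q (bump 0 0)) y = 0.
  by rewrite /lap big1// => i _; have h := hpoly_pd i (hq 1); exact: hpoly0_Dv h.
rewrite !add0r => H; apply: etrans H; exact: eq_bigr.
Qed.

Lemma hpoly_cube_scale k p (s B : R) v : hpoly k p -> 0 < s ->
  (forall x, cube 0 1 x -> `|p x| <= B) -> cube 0 s v -> `|p v| <= s ^+ k * B.
Proof.
move=> hp s0 bp cv; have -> : v = s *: (s^-1 *: v) by rewrite scalerA divff ?scale1r// gt_eqF.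
rewrite (hpoly_hom _ _ hp) normrM ger0_norm ?exprn_ge0 ?(ltW s0)//.
rewrite ler_wpM2l ?exprn_ge0 ?(ltW s0)//; apply: bp => i.
by have := cv i; rewrite !mxE !subr0 normrM normfV (gtr0_norm s0) ler_pdivrMl// mulr1.
Qed.

(* A monogenic function is only assumed C^1, so its coordinates are first known
   to be harmonic in this sense, by Steklov averaging. *)
Definition approxharm u := forall (r e : R), 0 < r -> 0 < e ->
  exists g, [/\ twice g, harmfun g & forall x, cube 0 r x -> `|u x - g x| <= e].

Lemma twice_bound_sphere g (c M : R) : twice g -> harmfun g ->
  (forall x, r2 x = c -> g x <= M) -> forall x, r2 x <= c -> g x <= M.
Proof.
move=> tg hg bd.
have cr : continuous (@r2 R m) := pol_continuous (pol_hpoly (@hpoly_r2 R m)).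
apply: (@max_principle R m g [set x | r2 x <= c] [set x | r2 x = c] M m0 tg).
- apply: (subclosed_compact _ (@cube_compact R m 0 (c + 1))).
    apply: (@closed_comp _ _ (@r2 R m) [set t | t <= c]); last exact: closed_le.
    by move=> x _; exact: cr.
  move=> x /= xc i; rewrite mxE subr0.
  have H : `|x 0 i| ^+ 2 <= c.
    rewrite real_normK ?num_real//; apply: le_trans xc; rewrite /r2 (bigD1 i)//= lerDl.
    by apply: sumr_ge0 => j _; exact: sqr_ge0.
  by move: H (sqr_ge0 (`|x 0 i| - 1/2)); set a := `|_|; nra.
- move=> x /= xc nxc i; have ltc : r2 x < c by rewrite lt_neqAle xc andbT; apply/eqP.
  have e0 : 0 < c - r2 x by rewrite subr_gt0.
  have [d d0 Hd] := cont_cube (cr x) e0.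
  exists d => // t td; have := Hd _ (cube_line x i (ltW td)).
  by rewrite ler_norml => /andP[_ H] /=; lra.
- by move=> x _ _; rewrite hg.
- by move=> x _; exact: bd.
Qed.

(* Replace [u] by a nearby C^2 harmonic [g], approximate [g] by a polynomial on
   the sphere, solve the Dirichlet problem for that polynomial, and compare
   with [g] by the maximum principle. *)
Lemma harm_pol_approx u (s e : R) : approxharm u -> 0 < s -> 0 < e ->
  exists p, [/\ pol p, harmfun p & forall x, cube 0 s x -> `|u x - p x| <= e].
Proof.
move=> au s0 e0; have mR : 1 <= m%:R :> R by rewrite ler1n.
(* The ball of radius [m s] contains the cube of half-side [s]; the factor [m] instead of its root
   avoids square roots. *)
pose r := m%:R * s; have r0 : 0 < r by rewrite mulr_gt0// ltr0n.
have e2 : 0 < e / 2 by rewrite divr_gt0.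
have [g [tg hg ug]] := au r _ r0 e2.
have [q pq gq] := weierstrass (let: And3 c _ _ := tg in c) r0 e2.
have [p [pp hp qp]] := pol_sphere m0 (r ^+ 2) pq.
have sphere x : r2 x = r ^+ 2 -> cube 0 r x.
  move=> xr i; rewrite mxE subr0.
  have H : `|x 0 i| ^+ 2 <= r ^+ 2.
    rewrite real_normK ?num_real// -xr /r2 (bigD1 i)//= lerDl.
    by apply: sumr_ge0 => j _; exact: sqr_ge0.
  by rewrite -(ler_pXn2r (n := 2))// nnegrE ltW.
have cubes x : cube 0 s x -> r2 x <= r ^+ 2.
  move=> cx; apply: (le_trans (y := \sum_(i < m) s ^+ 2)).
    apply: ler_sum => i _; rewrite -(real_normK (num_real (x 0 i))).
    rewrite ler_pXn2r ?nnegrE ?(ltW s0)//; by have := cx i; rewrite mxE subr0.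
  rewrite sumr_const card_ord -mulr_natl /r exprMn ler_wpM2r ?sqr_ge0//.
  by rewrite expr2 ler_peMr.
exists p; split => // x cx.
have tp := pol_twice pp.
have H1 : g x + -1 * p x <= e / 2.
  apply: (@twice_bound_sphere (fun x => g x + -1 * p x) (r ^+ 2)) => [||y yr|]; last exact: cubes.
  - exact: twiceD tg (twiceZ _ tp).
  - by move=> y; rewrite (lapD y tg (twiceZ _ tp)) (lapZ _ y tp) hg hp mulr0 addr0.
  - rewrite mulN1r -(qp _ yr); have := gq y (sphere y yr); rewrite ler_norml => /andP[? ?]; lra.
have H2 : p x + -1 * g x <= e / 2.
  apply: (@twice_bound_sphere (fun x => p x + -1 * g x) (r ^+ 2)) => [||y yr|]; last exact: cubes.
  - exact: twiceD tp (twiceZ _ tg).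
  - by move=> y; rewrite (lapD y tp (twiceZ _ tg)) (lapZ _ y tg) hg hp mulr0 addr0.
  - rewrite mulN1r -(qp _ yr); have := gq y (sphere y yr); rewrite ler_norml => /andP[? ?]; lra.
have cr : cube 0 r x by apply: cubeS cx; rewrite /r ler_peMl// ltW.
have := ug x cr; rewrite !ler_norml => /andP[? ?]; apply/andP; split; lra.
Qed.

(** Padding the parts with zeros makes the sum independent of the truncation [D], so that
    polynomials of different degrees can be cut at a common one. *)
Lemma pol_parts p : pol p -> exists (q : nat -> 'rV[R]_m -> R) d,
  (forall k, hpoly k (q k)) /\ forall D x, (d <= D)%N -> p x = \sum_(k < D) q k x.
Proof.
move=> [d [q [hq ->]]]; exists (fun k x => if (k < d)%N then q k x else 0), d; split.
  by move=> k; case: ltnP => // _; exact: hpoly0.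
move=> D x dD; rewrite -[RHS](big_mkord predT (fun k => if (k < d)%N then q k x else 0)).
rewrite (big_cat_nat (n := d))//= [X in _ + X]big_nat_cond [X in _ + X]big1 => [|l]; last first.
  by rewrite andbT => /andP[dl _]; rewrite ltnNge dl.
by rewrite addr0 big_mkord; apply: eq_bigr => l _; rewrite ltn_ord.
Qed.

(** The approximants [p N] live on growing cubes. By [hpart_bound], applied to [p N] and to
    differences [p N - p N'], their parts of each fixed degree form Cauchy sequences, with bounds
    free of the degrees of the [p N]; the limits [f k] are the terms of the expansion. *)
Lemma entire_expansion u : continuous u -> approxharm u ->
  exists f : nat -> 'rV[R]_m -> R,
  [/\ forall k, hpoly k (f k), forall k, harmfun (f k),
   forall r : R, 0 < r -> exists2 M : R, 0 <= M &
     forall k v, cube 0 1 v -> `|f k v| <= M / r ^+ k &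
   luc_lim (fun N x => \sum_(k < N) f k x) u].
Proof.
move=> cu au.
have ip N : 0 < (N.+1)%:R :> R by rewrite ltr0n.
have /choice[p Hp] N : exists p, [/\ pol p, harmfun p &
    forall x, cube 0 (N.+1)%:R x -> `|u x - p x| <= (N.+1)%:R^-1].
  by apply: harm_pol_approx => //; rewrite invr_gt0.
have pp N : pol (p N) by case: (Hp N).
have hp N : harmfun (p N) by case: (Hp N).
have /choice[q Hq] N := pol_parts (pp N).
have /choice[d Hd] := Hq => {Hq}.
have hq N k : hpoly k (q N k) by case: (Hd N).
have qE N D x : (d N <= D)%N -> p N x = \sum_(k < D) q N k x by case: (Hd N) => _; apply.
pose C : R := m%:R ^+ 2 * expR 1.
have C0 : 0 < C by rewrite mulr_gt0 ?expR_gt0// exprn_gt0// ltr0n.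
have hh N k : harmfun (q N k).
  apply: (@harmfun_part (maxn (d N) k.+1) (q N) k (hq N)); last exact: leq_maxr.
  rewrite (_ : (fun x => _) = p N)//; apply/funext => x.
  by rewrite -qE// leq_maxl.
have part1 N k (r M : R) v : 0 < r -> (forall x, cube 0 r x -> `|p N x| <= M) ->
    cube 0 1 v -> `|q N k v| <= (C / r) ^+ k * M.
  move=> r0 bM cv; have E : (fun x => \sum_(l < maxn (d N) k.+1) q N l x) = p N.
    by apply/funext => x; rewrite -qE// leq_maxl.
  apply: (@hpart_bound R m m0 (maxn (d N) k.+1) (q N) k v r M r0 (hq N)).
  - by rewrite E.
  - exact: leq_maxr.
  - by move=> i; have := cv i; rewrite mxE subr0.
  - by move=> x; rewrite -qE ?leq_maxl//; exact: bM.
have diff N N' (r : R) x : r <= N.+1%:R -> r <= N'.+1%:R -> cube 0 r x ->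
    `|p N x - p N' x| <= N.+1%:R^-1 + N'.+1%:R^-1.
  move=> rN rN' cx.
  have [_ _ /(_ x (cubeS rN cx)) H1] := Hp N; have [_ _ /(_ x (cubeS rN' cx)) H2] := Hp N'.
  move: H1 H2; move: (N.+1%:R^-1) (N'.+1%:R^-1) => a b.
  by rewrite !ler_norml => /andP[? ?] /andP[? ?]; apply/andP; split; lra.
have part2 N N' k (r : R) v : 0 < r -> r <= N.+1%:R -> r <= N'.+1%:R -> cube 0 1 v ->
    `|q N k v - q N' k v| <= (C / r) ^+ k * (N.+1%:R^-1 + N'.+1%:R^-1).
  move=> r0 rN rN' cv; pose D := maxn (maxn (d N) (d N')) k.+1.
  have D1 : (d N <= D)%N by rewrite /D !leq_max leqnn.
  have D2 : (d N' <= D)%N by rewrite /D !leq_max leqnn orbT.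
  have E : (fun x => \sum_(l < D) (q N l x + -1 * q N' l x)) = (fun x => p N x + -1 * p N' x).
    by apply/funext => x; rewrite big_split /= -mulr_sumr -(qE N D x D1) -(qE N' D x D2).
  rewrite -[q N' k v]mul1r -mulNr.
  apply: (@hpart_bound R m m0 D (fun l x => q N l x + -1 * q N' l x) k v r _ r0).
  - by move=> l; apply: hpolyD (hq N l) (hpolyZ _ (hq N' l)).
  - by rewrite E; exact: harmfunB.
  - exact: leq_maxr.
  - by move=> i; have := cv i; rewrite mxE subr0.
  - by move=> x cx; have := congr1 (@^~ x) E => /= ->; rewrite mulN1r; exact: diff cx.
have big (r : R) : exists N0, forall N, (N0 <= N)%N -> r <= N.+1%:R.
  exists (Num.bound `|r|) => N N0N; apply: le_trans (ler_norm _) _.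
  apply: le_trans (ltW (archi_boundP (normr_ge0 r))) _; rewrite ler_nat.
  exact: leqW.
have small (e : R) : 0 < e -> exists N0, forall N, (N0 <= N)%N -> N.+1%:R^-1 <= e.
  move=> e0; have [N0 HN0] := big e^-1; exists N0 => N /HN0 H.
  by rewrite invf_ple// posrE.
have /choice[f Hf] k : exists fk : 'rV[R]_m -> R, forall x (e : R), 0 < e ->
    exists N, forall n, (N <= n)%N -> `|q n k x - fk x| <= e.
  suff /choice[fk Hfk] : forall x, exists l : R, forall e : R, 0 < e ->
      exists N, forall n, (N <= n)%N -> `|q n k x - l| <= e by exists fk.
  move=> x; apply: cauchy_limit => e e0.
  have [s s0 cx] := cube_exists x.
  have sC : 0 < s ^+ k * C ^+ k by rewrite mulr_gt0// exprn_gt0.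
  have [N0 HN0] := small (e / (s ^+ k * C ^+ k) / 2) ltac:(by rewrite !divr_gt0).
  exists N0 => n n' nN nN'; have h : hpoly k (fun x => q n k x + -1 * q n' k x).
    exact: hpolyD (hq n k) (hpolyZ _ (hq n' k)).
  rewrite -[q n' k x]mul1r -mulNr.
  apply: le_trans (hpoly_cube_scale (B := C ^+ k * (n.+1%:R^-1 + n'.+1%:R^-1)) h s0 _ cx) _.
    move=> v cv; rewrite mulN1r.
    by have := part2 n n' k 1 v ltr01; rewrite divr1 !ler1n => /(_ isT isT cv).
  rewrite mulrA -ler_pdivlMl// [leRHS]mulrC; move: (HN0 n nN) (HN0 n' nN').
  by move: (n.+1%:R^-1) (n'.+1%:R^-1) (e / _) => a b c; lra.
have part1f k (r M : R) N0 v : 0 < r -> (forall N x, (N0 <= N)%N -> cube 0 r x -> `|p N x| <= M) ->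
    cube 0 1 v -> `|f k v| <= (C / r) ^+ k * M.
  move=> r0 bM cv; apply: (lim_bound (a := fun N => q N k v) (N := N0)); first exact: Hf.
  by move=> N NN; apply: part1 => // x; exact: bM.
have part2f N k (r : R) v : 0 < r -> r <= N.+1%:R -> cube 0 1 v ->
    `|q N k v - f k v| <= (C / r) ^+ k * (2 * N.+1%:R^-1).
  move=> r0 rN cv.
  apply: (lim_bound (a := fun N' => q N k v - q N' k v) (N := N)) => [e e0|n Nn].
    have [N1 HN1] := Hf k v e e0; exists N1 => n /HN1; rewrite opprB addrA addrAC.
    by rewrite addrAC -addrA addrAC; rewrite distrC => H; rewrite (_ : _ + _ = f k v - q n k v)//; ring.
  have rn : r <= n.+1%:R by apply: le_trans rN _; rewrite ler_nat.
  apply: le_trans (part2 N n k r v r0 rN rn cv) _.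
  rewrite ler_wpM2l ?exprn_ge0 ?divr_ge0 ?(ltW C0) ?(ltW r0)//.
  have : n.+1%:R^-1 <= N.+1%:R^-1 :> R by rewrite lef_pV2 ?posrE// ler_nat.
  by move: (n.+1%:R^-1) (N.+1%:R^-1) => a b; lra.
have luf k : luc_lim (fun N => q N k) (f k).
  move=> s e s0 e0; have sC : 0 < s ^+ k * C ^+ k by rewrite mulr_gt0// exprn_gt0.
  have [N0 HN0] := small (e / (s ^+ k * C ^+ k) / 2) ltac:(by rewrite !divr_gt0).
  exists N0 => n nN x cx.
  (* [f k] is so far only a pointwise limit. Its homogeneity is inherited from that of the
     [q n' k]. *)
  have -> : q n k x - f k x = s ^+ k * (q n k (s^-1 *: x) - f k (s^-1 *: x)).
    have xE : x = s *: (s^-1 *: x) by rewrite scalerA divff ?scale1r// gt_eqF.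
    rewrite mulrBr -(hpoly_hom _ _ (hq n k)) -xE; congr (_ - _).
    apply/eqP; rewrite -subr_eq0 -normr_le0; apply/ler_addgt0Pr => a a0; rewrite add0r.
    have sk : 0 < s ^+ k by exact: exprn_gt0.
    have [N1 HN1] := Hf k x _ (divr_gt0 a0 (ltr0Sn R 1)).
    have [N2 HN2] := Hf k (s^-1 *: x) _ (divr_gt0 (divr_gt0 a0 (ltr0Sn R 1)) sk).
    have H1 := HN1 _ (leq_maxl N1 N2); have H2 := HN2 _ (leq_maxr N1 N2).
    move: (maxn N1 N2) H1 H2 => n' H1 H2.
    have H3 : `|s ^+ k * q n' k (s^-1 *: x) - s ^+ k * f k (s^-1 *: x)| <= a / 2.
      by rewrite -mulrBr normrM (gtr0_norm sk) mulrC -ler_pdivlMr.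
    rewrite -(hpoly_hom _ _ (hq n' k)) -xE in H3; move: H1 H3.
    by rewrite !ler_norml => /andP[? ?] /andP[? ?]; apply/andP; split; lra.
  rewrite normrM (gtr0_norm (exprn_gt0 _ s0)).
  have c1 : cube 0 1 (s^-1 *: x).
    by move=> i; have := cx i; rewrite !mxE !subr0 normrM normfV (gtr0_norm s0) ler_pdivrMl// mulr1.
  have := part2f n k 1 _ ltr01; rewrite divr1 ler1n => /(_ _ isT c1) H.
  apply: le_trans (ler_wpM2l (exprn_ge0 _ (ltW s0)) H) _.
  rewrite mulrA -ler_pdivlMl// [leRHS]mulrC; move: (HN0 n nN).
  by move: (n.+1%:R^-1) (e / _) => a b; lra.
have hf k : hpoly k (f k) := luc_lim_hpoly m0 (hq^~ k) (hh^~ k) (luf k).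
have hhf k : harmfun (f k).
  by apply: (luc_lim_harm m0 _ _ (luf k)) => N; [exact: pol_hpoly (hq N k)|exact: hh].
exists f; split; [exact: hf|exact: hhf| |].
(* Bounding [u] on the cube of half-side [C r] absorbs the constant [C] of the estimate and leaves
   the ratio 1/r. *)
- move=> r r0; have rC : 0 < C * r by rewrite mulr_gt0.
  have [M M0 HM] := @cont_bounded R m u 0 (C * r) (ltW rC) cu.
  exists (M + 1); first exact: addr_ge0.
  move=> k v cv; have [N0 HN0] := big (C * r).
  have -> : (M + 1) / r ^+ k = (C / (C * r)) ^+ k * (M + 1).
    by rewrite invfM mulrA divff ?gt_eqF// mul1r exprVn mulrC.
  apply: (@part1f k (C * r) (M + 1) N0 v rC _ cv) => N x /HN0 rN cx.
  have [_ _ /(_ x (cubeS rN cx))] := Hp N; have := HM x cx.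
  have : N.+1%:R^-1 <= 1 :> R by rewrite invf_le1// ler1n.
  by move: (N.+1%:R^-1) => b; rewrite !ler_norml => ? /andP[? ?] /andP[? ?]; apply/andP; split; lra.
move=> s e s0 e0.
(* With this radius the degree-k part on the cube of half-side [s] is at most [2^-k] times a
   constant. *)
pose r := 2 * C * s; have r0 : 0 < r by rewrite /r mulr_gt0// mulr_gt0//.
have Cr k : s ^+ k * (C / r) ^+ k = 2^-1 ^+ k.
  rewrite -exprMn; congr (_ ^+ k); rewrite /r; field; by rewrite !gt_eqF.
have [M M0 HM] := @cont_bounded R m u 0 r (ltW r0) cu.
have [N0 HN0] := big r.
have M2 : 0 <= 2 * (M + 1) by rewrite mulr_ge0// addr_ge0.
have [K HK] := half_pow_small M2 e0.
exists K => n Kn x cx; rewrite distrC.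
(* [K] does not depend on [a], but the approximant [p N] does: its tail beyond degree [n] costs [e],
   while the distance to [u] and the difference of the first [n] parts cost less than [a]
   together. *)
apply/ler_addgt0Pr => a a0.
have [N1 HN1] := small (a / 8) ltac:(by rewrite divr_gt0).
pose N := maxn (maxn N0 N1) (maxn (N0) (Num.bound s)).
have NN0 : (N0 <= N)%N by rewrite /N !leq_max leqnn.
have NN1 : (N1 <= N)%N by rewrite /N !leq_max leqnn orbT.
have rN := HN0 N NN0.
have sN : s <= N.+1%:R.
  apply: le_trans (ltW (archi_boundP (ltW s0))) _; rewrite ler_nat.
  by rewrite leqW// /N !leq_max leqnn !orbT.
have pM y : cube 0 r y -> `|p N y| <= M + 1.
  move=> cy; have [_ _ /(_ y (cubeS rN cy))] := Hp N; have := HM y cy.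
  have : N.+1%:R^-1 <= 1 :> R by rewrite invf_le1// ler1n.
  by move: (N.+1%:R^-1) => b; rewrite !ler_norml => ? /andP[? ?] /andP[? ?]; apply/andP; split; lra.
have q1 k : `|q N k x| <= 2^-1 ^+ k * (M + 1).
  by rewrite -Cr -mulrA; apply: (hpoly_cube_scale (hq N k) s0 _ cx) => v cv; exact: part1.
have q2 k : `|q N k x + -1 * f k x| <= 2^-1 ^+ k * (2 * N.+1%:R^-1).
  rewrite -Cr -mulrA.
  apply: (hpoly_cube_scale (hpolyD (hq N k) (hpolyZ (-1) (hf k))) s0 _ cx) => v cv.
  by rewrite mulN1r; exact: part2f.
have A1 : `|u x - p N x| <= a / 8.
  by have [_ _ /(_ x (cubeS sN cx)) H] := Hp N; apply: le_trans H _; exact: HN1.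
pose D := maxn (d N) n.
have half01 : 0 <= (2^-1 : R) <= 2^-1 by rewrite lexx invr_ge0 ler0n.
have A2 : `|p N x - \sum_(k < n) q N k x| <= e.
  rewrite (qE N D x (leq_maxl _ _)) -(big_mkord predT (fun k => q N k x)).
  rewrite (big_cat_nat (n := n)) ?leq_maxr//= big_mkord addrAC subrr add0r.
  apply: le_trans (ler_norm_sum _ _ _) _.
  apply: le_trans (ler_sum _ (fun k _ => q1 k)) _.
  rewrite -mulr_suml; apply: le_trans (HK n Kn); rewrite mulrAC.
  by rewrite ler_wpM2r ?geo_tail_le// addr_ge0.
have A3 : `|\sum_(k < n) q N k x - \sum_(k < n) f k x| <= a / 2.
  rewrite -sumrB; apply: le_trans (ler_norm_sum _ _ _) _.
  apply: (le_trans (y := \sum_(k < n) 2^-1 ^+ k * (2 * N.+1%:R^-1))).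
    by apply: ler_sum => k _; have := q2 k; rewrite mulN1r.
  rewrite -mulr_suml; have := HN1 N NN1; have := geo_le2 n half01.
  have : 0 <= N.+1%:R^-1 :> R by rewrite invr_ge0.
  move: (N.+1%:R^-1) (\sum_(_ < _) _) => b S b0 S2 ba.
  have : S * (2 * b) <= 2 * (2 * b) by rewrite ler_wpM2r// mulr_ge0.
  lra.
move: A1 A2 A3; set S1 := \sum_(_ < _) _; set S2 := \sum_(_ < _) _.
by rewrite !ler_norml => /andP[? ?] /andP[? ?] /andP[? ?]; apply/andP; split; lra.
Qed.
End EntireExpansion.

(** * Monogenic functions *)

Section CliffordSigns.
Variables (R : realType) (n : nat).
Implicit Types (i j : 'I_n) (A B C : {set 'I_n}) (a b : Cl R n).

(* [e_j e_(flip j C) = sg j C *: e_C], with [sg] as below. *)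
Definition flip j C := symdiff (finset.set1 j) C.

Lemma in_flip i j C : (i \in flip j C) = (i == j) (+) (i \in C).
Proof. by rewrite !inE; case: (i == j); case: (i \in C). Qed.

Lemma flipK j : involutive (flip j).
Proof. by move=> C; apply/setP => i; rewrite !in_flip addKb. Qed.

Lemma flipC i j C : flip i (flip j C) = flip j (flip i C).
Proof. by apply/setP => k; rewrite !in_flip addbCA. Qed.

Definition sg j C : R := blade_sign R (finset.set1 j) (flip j C).

Definition epsb C (b : 'I_n) : R := if b \in C then -1 else 1.

Lemma prod_epsb j C :
  \prod_(b < n | (b < j)%N) epsb C b =
  (-1) ^+ #|finset.finset (fun b : 'I_n => (b \in C) && (b < j)%N)|.
Proof.
rewrite -prodr_const big_mkcond [RHS]big_mkcond; apply: eq_bigr => b _.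
by rewrite inE /epsb; case: (b < j)%N; case: (b \in C).
Qed.

(** The product counts the exchanges of [e_j] with generators of smaller index, and the last factor
    is [e_j^2 = -1], present when [j] lies in [flip j C]. In this form flipping another index
    changes at most one factor. *)
Lemma sgE j C : sg j C = (\prod_(b < n | (b < j)%N) epsb C b) * epsb (flip j C) j.
Proof.
have -> : \prod_(b < n | (b < j)%N) epsb C b = \prod_(b < n | (b < j)%N) epsb (flip j C) b.
  by apply: eq_bigr => b bj; rewrite /epsb in_flip -val_eqE ltn_eqF.
rewrite prod_epsb /sg /blade_sign exprD; move: (flip j C) => B; congr (_ * _).
  congr (_ ^+ _).
  have -> : finset.finset (fun p : 'I_n * 'I_n => (p.1 \in finset.set1 j) && (p.2 \in B) && (p.2 < p.1)%N) =
    finset.setX (finset.set1 j) (finset.finset (fun b : 'I_n => (b \in B) && (b < j)%N)).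
    by apply/setP => -[x y]; rewrite !inE /= -andbA; case: eqP => [->|].
  by rewrite cardsX cards1 mul1n.
rewrite /epsb; case: (boolP (j \in B)) => jB.
  have -> : finset.set1 j :&: B = finset.set1 j by apply/finset.setIidPl; rewrite finset.sub1set.
  by rewrite cards1 expr1.
have -> : finset.set1 j :&: B = finset.set0 by apply/setP => x; rewrite !inE; case: eqP => [->|//]; rewrite (negbTE jB).
by rewrite cards0 expr0.
Qed.

Lemma epsb_sq C (b : 'I_n) : epsb C b * epsb C b = 1.
Proof. by rewrite /epsb; case: ifP => _; ring. Qed.

Lemma prod_epsb_sq j C : (\prod_(b < n | (b < j)%N) epsb C b) * (\prod_(b < n | (b < j)%N) epsb C b) = 1.
Proof. by rewrite -big_split big1// => b _; exact: epsb_sq. Qed.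

Lemma sg_flip j C : sg j C * sg j (flip j C) = -1.
Proof.
rewrite !sgE flipK.
have -> : \prod_(b < n | (b < j)%N) epsb (flip j C) b = \prod_(b < n | (b < j)%N) epsb C b.
  by apply: eq_bigr => b bj; rewrite /epsb in_flip -val_eqE ltn_eqF.
rewrite mulrACA prod_epsb_sq mul1r /epsb in_flip eqxx; case: (j \in C) => /=; ring.
Qed.

Lemma sg_sq j C : sg j C * sg j C = 1.
Proof. by rewrite sgE mulrACA prod_epsb_sq epsb_sq mulr1. Qed.

Lemma sg_norm j C : `|sg j C| = 1.
Proof.
apply/eqP; rewrite -(@eqrXn2 _ 2)// ?normr_ge0// expr1n real_normK ?num_real//.
by rewrite expr2 sg_sq.
Qed.

Lemma sg_flip_neq i j C : i != j -> sg j (flip i C) = (if (i < j)%N then -1 else 1) * sg j C.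
Proof.
move=> ij; rewrite !sgE mulrA; congr (_ * _); last first.
  by rewrite /epsb !in_flip eqxx eq_sym (negbTE ij).
have E (b : 'I_n) : epsb (flip i C) b = (if b == i then -1 else 1) * epsb C b.
  by rewrite /epsb in_flip; case: (b == i); case: (b \in C) => /=; ring.
under eq_bigr do rewrite E.
rewrite big_split /=; congr (_ * _); case: ifP => ltij.
  by rewrite (bigD1 i)//= eqxx big1 ?mulr1// => b /andP[_ /negbTE ->].
by rewrite big1// => b bj; case: eqP => // bi; rewrite -bi bj in ltij.
Qed.

(** The rule [e_i e_j = - e_j e_i] in coordinates: exactly one of i < j and j < i holds, so exactly
    one of the two flips changes a sign. *)
Lemma sg_anti i j C : i != j -> sg i C * sg j (flip i C) = - (sg j C * sg i (flip j C)).
Proof.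
move=> ij; rewrite (sg_flip_neq _ ij) (sg_flip_neq _ (_ : j != i)) ?[j == i]eq_sym//.
have : (i < j)%N = ~~ (j < i)%N.
  by rewrite -leqNgt ltn_neqAle; have -> : (nat_of_ord i != j) by rewrite val_eqE.
by case: (j < i)%N => -> /=; ring.
Qed.

(** One identity with three uses. For [b] made of second derivatives, of products [x_j x_l], and of
    [x_l] times j-th derivatives, it yields the factorization of the Laplacian, the square of a
    vector, and the anticommutator of [xm] with the Dirac operator. *)
Lemma sg_anti_sum (b : 'I_n -> 'I_n -> {set 'I_n} -> R) C :
  \sum_j \sum_l sg j C * sg l (flip j C) * b j l (flip l (flip j C)) +
  \sum_j \sum_l sg j C * sg l (flip j C) * b l j (flip l (flip j C)) = - 2 * \sum_j b j j C.
Proof.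
rewrite [X in _ + X]exchange_big -big_split mulr_sumr; apply: eq_bigr => j _ /=.
rewrite -big_split (bigD1 j)//= big1 ?addr0 => [|l lj].
  by rewrite sg_flip flipK; ring.
by rewrite [flip j (flip l C)]flipC (sg_anti _ lj); ring.
Qed.

Lemma cl_mul_e j a C : cl_mul (cl_e R j) a C = sg j C * a (flip j C).
Proof.
rewrite ffunE (bigD1 (finset.set1 j))//= [X in _ + X]big1 => [|A /negbTE Aj]; last first.
  by rewrite big1// => B _; rewrite ffunE Aj mulr0 mul0r.
rewrite (bigD1 (flip j C))/=; last by rewrite -/(flip j _) flipK.
rewrite big1 => [|B /andP[/eqP BC BC']]; last first.
  by rewrite -BC -/(flip j B) flipK eqxx in BC'.
by rewrite ffunE eqxx mulr1 !addr0.
Qed.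

Lemma cl_mulDl a a' b : cl_mul (a + a') b = cl_mul a b + cl_mul a' b.
Proof.
apply/ffunP => C; rewrite !ffunE -big_split; apply: eq_bigr => A _; rewrite -big_split.
by apply: eq_bigr => B _ /=; rewrite ffunE; ring.
Qed.

Lemma cl_mulZl (c : R) a b : cl_mul (c *: a) b = c *: cl_mul a b.
Proof.
apply/ffunP => C; rewrite [LHS]ffunE [RHS]ffunE -[RHS]/(c * cl_mul a b C) [cl_mul a b C]ffunE mulr_sumr; apply: eq_bigr => A _; rewrite mulr_sumr.
by apply: eq_bigr => B _ /=; rewrite ffunE -[c *: a A]/(c * a A); ring.
Qed.

Lemma cl_mul0l b : cl_mul 0 b = 0.
Proof. by have := cl_mulZl 0 0 b; rewrite !scale0r. Qed.

Lemma cl_mul_suml (I : Type) (r : seq I) (P : pred I) (F : I -> Cl R n) b :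
  cl_mul (\sum_(i <- r | P i) F i) b = \sum_(i <- r | P i) cl_mul (F i) b.
Proof.
elim: r => [|i r IH]; first by rewrite !big_nil cl_mul0l.
by rewrite !big_cons; case: (P i); rewrite ?cl_mulDl IH.
Qed.

Lemma cl_mul1 b : cl_mul (cl_one R n) b = b.
Proof.
apply/ffunP => C; rewrite ffunE (bigD1 (finset.set0))//= [X in _ + X]big1 => [|A /negbTE A0]; last first.
  by rewrite big1// => B _; rewrite ffunE A0 mulr0 mul0r.
have s0 B : symdiff (finset.set0 : {set 'I_n}) B = B.
  by apply/setP => x; rewrite !inE /=; case: (x \in B).
rewrite (bigD1 C)/=; last by rewrite s0.
rewrite big1 => [|B /andP[/eqP BC BC']]; last by rewrite -BC s0 eqxx in BC'.
rewrite ffunE eqxx mulr1 !addr0 /blade_sign finset.set0I cards0 addn0.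
have -> : finset.finset (fun p : 'I_n * 'I_n => (p.1 \in (finset.set0 : {set 'I_n})) && (p.2 \in C) && (p.2 < p.1)%N) = finset.set0.
  by apply/setP => x; rewrite !inE.
by rewrite cards0 expr0 mul1r.
Qed.

End CliffordSigns.

(** * The Cauchy-Riemann system in coordinates and monogenic expansions *)

Section Monogenic.
Variables (R : realType) (n : nat).
Local Notation lft j := (lift ord0 j : 'I_n.+1).
Implicit Types (i j : 'I_n) (A B C : {set 'I_n}) (f g F : 'rV[R]_(n.+1) -> Cl R n).

Definition bcomp m (f : 'rV[R]_m -> Cl R n) A : 'rV[R]_m -> R := fun y => f y A.

(* The coordinate of index [C] of the generalized Cauchy-Riemann operator. *)
Definition CR f C (x : 'rV[R]_(n.+1)) : R :=
  pd ord0 (bcomp f C) x + \sum_(j < n) sg R j C * pd (lft j) (bcomp f (flip j C)) x.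

Lemma CRE f x C : (cl_partial f ord0 x
            + \sum_(j < n) cl_mul (cl_e R j) (cl_partial f (lft j) x)) C = CR f C x.
Proof.
rewrite ffunE sum_ffunE /CR /cl_partial ffunE; congr (_ + _).
by apply: eq_bigr => j _; rewrite cl_mul_e ffunE.
Qed.

Lemma monogenicE f : monogenic f <->
  (forall A, cont1 (bcomp f A)) /\ (forall x C, CR f C x = 0).
Proof.
split=> [[[d c] H]|[c1 H]].
  split=> [A|x C]; first by split=> [x i|i]; [exact: d|exact: c].
  by rewrite -CRE H ffunE.
split; first by split=> [A i x|A i]; have [d c] := c1 A; [exact: d|exact: c].
by move=> x; apply/ffunP => C; rewrite CRE H ffunE.
Qed.

Lemma derive_lincomb m k (c : 'I_k -> R) (u : 'I_k -> 'rV[R]_m -> R) (v x : 'rV[R]_m) :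
  (forall j : 'I_k, derivable (u j) x v) ->
  is_derive x v (fun y => \sum_j c j * u j y) (\sum_j c j * 'D_v (u j) x).
Proof.
move=> du; have D (j : 'I_k) : is_derive x v (c j \*: u j) (c j * 'D_v (u j) x).
  exact: (is_deriveZ (c j) (derivableP (du j))).
have := is_derive_sum D; congr (is_derive _ _ _ _).
by apply/funext => y; rewrite fct_sumE.
Qed.

(* The conjugate operator applied to the Cauchy-Riemann system gives the
   Laplacian: mixed terms cancel by [sg_anti]. *)
Lemma CR_harm g :
  (forall A (i j : 'I_n.+1) x, derivable (pd i (bcomp g A)) x (unitv R j)) ->
  (forall A (i j : 'I_n.+1) x, pd i (pd j (bcomp g A)) x = pd j (pd i (bcomp g A)) x) ->
  (forall x C, CR g C x = 0) -> forall C, harmfun (bcomp g C).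
Proof.
move=> dpd sw H C x.
have E D : pd ord0 (bcomp g D) = fun y => \sum_j - sg R j D * pd (lft j) (bcomp g (flip j D)) y.
  apply/funext => y; have /eqP := H y D; rewrite addr_eq0 => /eqP ->.
  by rewrite -sumrN; apply: eq_bigr => j _; rewrite mulNr.
have E2 D (l : 'I_n.+1) y : pd l (pd ord0 (bcomp g D)) y =
    \sum_j - sg R j D * pd l (pd (lft j) (bcomp g (flip j D))) y.
  by rewrite E; apply: derive_val; apply: derive_lincomb => j; exact: dpd.
have [b bE] : exists b : 'I_n -> 'I_n -> {set 'I_n} -> R,
    forall j l D, b j l D = pd (lft j) (pd (lft l) (bcomp g D)) x by eexists.
have bS j l D : b j l D = b l j D by rewrite !bE; exact: sw.
have E3 : pd ord0 (pd ord0 (bcomp g C)) x =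
    \sum_j \sum_l sg R j C * sg R l (flip j C) * b j l (flip l (flip j C)).
  rewrite E2; apply: eq_bigr => j _; rewrite sw E2 mulr_sumr; apply: eq_bigr => l _.
  by rewrite bE; ring.
have H2 := sg_anti_sum b C.
have E4 : \sum_j \sum_l sg R j C * sg R l (flip j C) * b l j (flip l (flip j C)) =
    \sum_j \sum_l sg R j C * sg R l (flip j C) * b j l (flip l (flip j C)).
  by apply: eq_bigr => j _; apply: eq_bigr => l _; rewrite bS.
rewrite /lap big_ord_recl E3.
have -> : \sum_(i < n) pd (lft i) (pd (lft i) (bcomp g C)) x = \sum_j b j j C.
  by apply: eq_bigr => j _; rewrite bE.
move: H2; rewrite E4; set p := \sum_j \sum_l _; set q := \sum_j _ => H2; lra.
Qed.

Lemma CR_harm_pol g : (forall A, pol (bcomp g A)) ->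
  (forall x C, CR g C x = 0) -> forall C, harmfun (bcomp g C).
Proof.
move=> pg; apply: CR_harm => A i j x.
  exact/dff_derivable/pol_dff/pol_pd.
exact: (pol_DvC _ _ x (pg A)).
Qed.

(** Averaging is linear and commutes with every partial derivative, hence with an operator of
    constant coefficients. *)
Lemma smooth_CR (h : R) f C : 0 < h -> (forall A, cont1 (bcomp f A)) ->
  CR (fun x => [ffun A => smooth h (bcomp f A) x]) C = smooth h (CR f C).
Proof.
move=> h0 c1.
have cE A : bcomp (fun x => [ffun A => smooth h (bcomp f A) x]) A = smooth h (bcomp f A).
  by apply/funext => x; rewrite /bcomp ffunE.
have cpd A (i : 'I_n.+1) : continuous (pd i (bcomp f A)) by have [_] := c1 A.
have S (s : seq 'I_n) : smooth h (fun x => pd ord0 (bcomp f C) x + \sum_(j <- s) sg R j C * pd (lft j) (bcomp f (flip j C)) x)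
   = fun x => smooth h (pd ord0 (bcomp f C)) x + \sum_(j <- s) sg R j C * smooth h (pd (lft j) (bcomp f (flip j C))) x.
  elim/last_ind: s => [|s j IH].
    have -> : (fun x => pd ord0 (bcomp f C) x + \sum_(j <- [::]) sg R j C * pd (lft j) (bcomp f (flip j C)) x) = pd ord0 (bcomp f C).
      by apply/funext => x; rewrite big_nil addr0.
    by apply/funext => x; rewrite big_nil addr0.
  have -> : (fun x => pd ord0 (bcomp f C) x + \sum_(j <- rcons s j) sg R j C * pd (lft j) (bcomp f (flip j C)) x) =
     (fun x => (pd ord0 (bcomp f C) x + \sum_(j <- s) sg R j C * pd (lft j) (bcomp f (flip j C)) x) +
        sg R j C * pd (lft j) (bcomp f (flip j C)) x).
    by apply/funext => x; rewrite -cats1 big_cat big_seq1 /= addrA.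
  rewrite (smooth_lin h0 _ _ (cpd _ _)).
    by rewrite IH; apply/funext => x; rewrite -cats1 big_cat big_seq1 /= addrA.
  elim: (s) => [|k t IHt].
    have -> : (fun x => pd ord0 (bcomp f C) x + \sum_(j <- [::]) sg R j C * pd (lft j) (bcomp f (flip j C)) x) = pd ord0 (bcomp f C).
      by apply/funext => x; rewrite big_nil addr0.
    exact: cpd.
  have -> : (fun x => pd ord0 (bcomp f C) x + \sum_(j <- k :: t) sg R j C * pd (lft j) (bcomp f (flip j C)) x) =
     (fun x => sg R k C * pd (lft k) (bcomp f (flip k C)) x + (pd ord0 (bcomp f C) x + \sum_(j <- t) sg R j C * pd (lft j) (bcomp f (flip j C)) x)).
    by apply/funext => x; rewrite big_cons addrCA.
  by move=> x; exact: (cvgD (cvgM (cvg_cst _) (cpd _ _ x)) (IHt x)).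
rewrite [RHS]S; apply/funext => x; rewrite /CR !cE (pd_smooth h0 _ (c1 C)).
by congr (_ + _); apply: eq_bigr => j _; rewrite cE (pd_smooth h0 _ (c1 _)).
Qed.

Lemma monogenic_approxharm f A : monogenic f -> approxharm (bcomp f A).
Proof.
move=> /monogenicE[c1 H] r e r0 e0.
have cf := cont1_continuous (c1 A).
have [d d0 Hd] := unif_cont cf (@cube_compact R n.+1 0 r) e0.
(* Each of the [n + 1] averages moves a point by at most [h], in total by at most [d]. *)
pose h := d / n.+1%:R; have h0 : 0 < h by rewrite divr_gt0.
exists (smooth h (bcomp f A)); split; first exact: smooth_twice.
  pose g x : Cl R n := [ffun A => smooth h (bcomp f A) x].
  have cE B : bcomp g B = smooth h (bcomp f B) by apply/funext => x; rewrite /bcomp ffunE.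
  rewrite -cE; apply: CR_harm => [B i j x|B i j x|x C].
  - rewrite cE (pd_stks_upd h0 (c1 B) (enum_uniq _) (mem_enum _ i))//.
    by have [] := cont1_stks h0 (upd (fun=> false) i) (enum 'I_n.+1) (c1 B).
  - by rewrite cE smooth_pdpd.
  - rewrite smooth_CR// (_ : CR f C = fun=> 0) ?smooth0//.
    by apply/funext => y; exact: H.
move=> x cx; rewrite distrC; apply: smooth_close => // y cy.
by apply: Hd => //; apply: cubeS cy; rewrite /h mulrC divfK// pnatr_eq0.
Qed.

Lemma luc_lim_CR (u : nat -> 'rV[R]_(n.+1) -> Cl R n) f C :
  (forall N A, pol (bcomp (u N) A)) -> (forall N A, harmfun (bcomp (u N) A)) ->
  (forall A, luc_lim (fun N => bcomp (u N) A) (bcomp f A)) ->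
  luc_lim (fun N => CR (u N) C) (CR f C).
Proof.
move=> pu hu lu.
have l (i : 'I_n.+1) A : luc_lim (fun N => pd i (bcomp (u N) A)) (pd i (bcomp f A)).
  by have [] := luc_lim_pd (ltn0Sn n) i (pu^~ A) (hu^~ A) (lu A).
apply: luc_limD; first exact: l.
by apply: luc_lim_sum => j; apply: luc_limZ; exact: l.
Qed.

Lemma luc_lim_monogenic (u : nat -> 'rV[R]_(n.+1) -> Cl R n) f :
  (forall N A, pol (bcomp (u N) A)) -> (forall N x C, CR (u N) C x = 0) ->
  (forall A, luc_lim (fun N => bcomp (u N) A) (bcomp f A)) -> monogenic f.
Proof.
move=> pu cu lu; have hu N := CR_harm_pol (pu N) (cu N).
apply/monogenicE; split=> [A|x C].
  split=> [x i|i].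
    by have [] := luc_lim_pd (ltn0Sn n) i (pu^~ A) (hu^~ A) (lu A).
  have [_ l] := luc_lim_pd (ltn0Sn n) i (pu^~ A) (hu^~ A) (lu A).
  by apply: luc_lim_continuous l => N; exact/pol_continuous/pol_pd.
have l1 := luc_lim_CR C pu hu lu.
have l0 : luc_lim (fun N => CR (u N) C) (fun=> 0).
  by apply: luc_lim_eq (luc_lim_cst _) => N y; rewrite cu.
exact: luc_lim_unique x l1 l0.
Qed.

Lemma hpoly_CR k F C : (forall A, hpoly k (bcomp F A)) -> hpoly k.-1 (CR F C).
Proof.
move=> hF; apply: hpolyD; first exact: hpoly_pd.
by apply: hpoly_sum => j _; apply: hpolyZ; exact: hpoly_pd.
Qed.

Lemma comp_sum m (I : Type) (r : seq I) (P : pred I) (F : I -> 'rV[R]_m -> Cl R n) A :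
  bcomp (fun x => \sum_(k <- r | P k) F k x) A = fun x => \sum_(k <- r | P k) bcomp (F k) A x.
Proof. by apply/funext => x; rewrite /bcomp sum_ffunE. Qed.

Lemma CR_sum (I : Type) (r : seq I) (P : pred I) (F : I -> 'rV[R]_(n.+1) -> Cl R n) C x :
  (forall k A, dff (bcomp (F k) A)) ->
  CR (fun x => \sum_(k <- r | P k) F k x) C x = \sum_(k <- r | P k) CR (F k) C x.
Proof.
move=> dF; rewrite /CR big_split /= exchange_big /=; congr (_ + _).
  by rewrite comp_sum /pd (Dv_sum _ _ _ _ (fun k => dF k C)).
apply: eq_bigr => j _; rewrite comp_sum /pd (Dv_sum _ _ _ _ (fun k => dF k (flip j C))).
by rewrite mulr_sumr.
Qed.

Lemma monogenic_expansion f : monogenic f ->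
  exists F : nat -> 'rV[R]_(n.+1) -> Cl R n,
  [/\ forall k A, hpoly k (bcomp (F k) A), forall k x C, CR (F k) C x = 0,
   forall r : R, 0 < r -> exists2 M : R, 0 <= M &
     forall k A v, cube 0 1 v -> `|bcomp (F k) A v| <= M / r ^+ k &
   forall A, luc_lim (fun N x => \sum_(k < N) bcomp (F k) A x) (bcomp f A)].
Proof.
move=> mf; have /monogenicE[c1 H] := mf.
have /choice[G HG] A := entire_expansion (ltn0Sn n) (cont1_continuous (c1 A)) (@monogenic_approxharm f A mf).
pose F k x : Cl R n := [ffun A => G A k x].
have cE k A : bcomp (F k) A = G A k by apply/funext => x; rewrite /bcomp ffunE.
have hF k A : hpoly k (bcomp (F k) A) by rewrite cE; case: (HG A).
have lF A : luc_lim (fun N x => \sum_(k < N) bcomp (F k) A x) (bcomp f A).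
  have [_ _ _] := HG A; apply: luc_lim_eq => N x; by apply: eq_bigr => k _; rewrite cE.
exists F; split => //; last first.
  move=> r r0; have /choice[M HM] A : exists M : R, 0 <= M /\ forall k v, cube 0 1 v -> `|G A k v| <= M / r ^+ k.
    by have [_ _ /(_ r r0)[M M0 HM] _] := HG A; exists M.
  exists (\sum_A M A); first by apply: sumr_ge0 => A _; case: (HM A).
  move=> k A v cv; rewrite cE; have [_ h] := HM A; apply: le_trans (h k v cv) _.
  rewrite ler_wpM2r ?invr_ge0 ?exprn_ge0 ?(ltW r0)// (bigD1 A)//= lerDl.
  by apply: sumr_ge0 => B _; case: (HM B).
move=> k x C.
pose u N x := \sum_(k < N) F k x.
have uE N A : bcomp (u N) A = fun x => \sum_(k < N) bcomp (F k) A x by rewrite comp_sum.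
have pu N A : pol (bcomp (u N) A).
  by rewrite uE; apply: pol_sum => l _; exact: pol_hpoly (hF l A).
have hu N A : harmfun (bcomp (u N) A).
  rewrite uE => y; rewrite (lap_sum N y (fun l => pol_hpoly (hF l A))) big1// => l _.
  by rewrite cE; have [_ h _ _] := HG A; exact: h.
have l1 : luc_lim (fun N => CR (u N) C) (fun=> 0).
  have := luc_lim_CR C pu hu (f := f); rewrite (_ : CR f C = fun=> 0).
    by apply => A; apply: luc_lim_eq (lF A) => N y; rewrite uE.
  by apply/funext => y; exact: H.
have dF l A := hpoly_dff (hF l A).
case: k => [|k].
  have D (i : 'I_n.+1) A : pd i (bcomp (F 0) A) x = 0 by exact: hpoly0_Dv (hF 0 A).
  by rewrite /CR D add0r big1// => j _; rewrite D mulr0.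
(* [CR] lowers the degree by one, so along a ray the values of [CR (F k.+1)] are the coefficients of
   a power series; the term [F 0] is constant and drops out. *)
apply: (series_unique (b := fun k => CR (F k.+1) C x)) => t e t1 e0.
have [s s0 cx] := cube_exists x.
have [N HN] := l1 s e s0 e0; exists N => d dN.
have ct : cube 0 s (t *: x).
  move=> i; have := cx i; rewrite !mxE !subr0 normrM => h.
  by apply: le_trans h; rewrite ler_piMl.
have := HN d.+1 (leqW dN) _ ct; rewrite subr0 /u CR_sum; last by move=> l A; exact: dF.
have D0 : CR (F 0) C (t *: x) = 0.
  have D (i : 'I_n.+1) A : pd i (bcomp (F 0) A) (t *: x) = 0 by exact: hpoly0_Dv (hF 0 A).
  by rewrite /CR D add0r big1// => j _; rewrite D mulr0.
rewrite big_ord_recl D0 add0r; congr (`|_| <= _); apply: eq_bigr => l _.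
by rewrite mulrC -(hpoly_hom x t (hpoly_CR C (hF l.+1))).
Qed.
End Monogenic.

(** * Fischer decomposition *)

Section Fischer.
Variables (R : realType) (n : nat).
Hypothesis n0 : (0 < n)%N.
Implicit Types (A B C : {set 'I_n}) (P Q q : 'rV[R]_n -> Cl R n) (x v : 'rV[R]_n) (c : R).
Local Notation flip := (@flip n).

Definition xm P x : Cl R n := cl_mul (vecCl x) (P x).
Definition hC m k (P : 'rV[R]_m -> Cl R n) := forall A, hpoly k (bcomp P A).
Definition dffC m (P : 'rV[R]_m -> Cl R n) := forall A, dff (bcomp P A).

Lemma hC_dffC m k (P : 'rV[R]_m -> Cl R n) : hC k P -> dffC P.
Proof. by move=> hP A; exact: hpoly_dff (hP A). Qed.

Lemma comp_xm P C x : bcomp (xm P) C x = \sum_j x 0 j * (sg R j C * bcomp P (flip j C) x).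
Proof.
rewrite /bcomp /xm /vecCl cl_mul_suml sum_ffunE; apply: eq_bigr => j _.
by rewrite cl_mulZl ffunE -[_ *: _]/(_ * _) cl_mul_e.
Qed.

Lemma comp_dirac P C x : bcomp (dirac_x P) C x = \sum_j sg R j C * pd j (bcomp P (flip j C)) x.
Proof.
rewrite /bcomp /dirac_x sum_ffunE; apply: eq_bigr => j _.
by rewrite cl_mul_e ffunE.
Qed.

Lemma compD m (P Q : 'rV[R]_m -> Cl R n) A : bcomp (fun z => P z + Q z) A = fun z => bcomp P A z + bcomp Q A z.
Proof. by apply/funext => z; rewrite /bcomp ffunE. Qed.

Lemma compZ m (a : 'rV[R]_m -> R) (P : 'rV[R]_m -> Cl R n) A : bcomp (fun z => a z *: P z) A = fun z => a z * bcomp P A z.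
Proof. by apply/funext => z; rewrite /bcomp ffunE. Qed.

Lemma hC_xm k P : hC k P -> hC k.+1 (xm P).
Proof.
move=> hP A; rewrite (_ : bcomp _ _ = fun x => \sum_j x 0 j * (sg R j A * bcomp P (flip j A) x)).
  by apply: hpoly_sum => j _; apply: hpolyX; exact: hpolyZ.
by apply/funext => x; rewrite comp_xm.
Qed.

Lemma hC_dirac k P : hC k P -> hC k.-1 (dirac_x P).
Proof.
move=> hP A; rewrite (_ : bcomp _ _ = fun x => \sum_j sg R j A * pd j (bcomp P (flip j A)) x).
  by apply: hpoly_sum => j _; apply: hpolyZ; exact: hpoly_pd.
by apply/funext => x; rewrite comp_dirac.
Qed.

Lemma hCZ m k c (P : 'rV[R]_m -> Cl R n) : hC k P -> hC k (fun z => c *: P z).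
Proof. by move=> hP A; rewrite (compZ (fun=> c)); exact: hpolyZ. Qed.

Lemma hC_sum m k (I : Type) (r : seq I) (p : pred I) (F : I -> 'rV[R]_m -> Cl R n) :
  (forall a, p a -> hC k (F a)) -> hC k (fun z => \sum_(a <- r | p a) F a z).
Proof. by move=> hF A; rewrite comp_sum; apply: hpoly_sum => a pa; exact: hF. Qed.

Lemma hC0 m k : hC k (fun _ : 'rV[R]_m => (0 : Cl R n)).
Proof. by move=> A; rewrite (_ : bcomp _ _ = fun=> 0); [exact: hpoly0|apply/funext => z; rewrite /bcomp ffunE]. Qed.

Lemma xmZ c P x : xm (fun y => c *: P y) x = c *: xm P x.
Proof.
apply/ffunP => A; rewrite [RHS]ffunE -[RHS]/(c * _) -!/(bcomp _ _ x) !comp_xm mulr_sumr.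
by apply: eq_bigr => j _; rewrite (compZ (fun=> c)); ring.
Qed.

Lemma xm_sum (I : Type) (r : seq I) (p : pred I) (F : I -> 'rV[R]_n -> Cl R n) x :
  xm (fun y => \sum_(a <- r | p a) F a y) x = \sum_(a <- r | p a) xm (F a) x.
Proof.
apply/ffunP => A; rewrite sum_ffunE -/(bcomp _ _ x) comp_xm.
under [RHS]eq_bigr do rewrite -/(bcomp _ _ x) comp_xm.
rewrite exchange_big; apply: eq_bigr => j _; rewrite comp_sum.
by rewrite mulr_sumr mulr_sumr; apply: eq_bigr => a _.
Qed.

Lemma diracZ c P x : dffC P -> dirac_x (fun y => c *: P y) x = c *: dirac_x P x.
Proof.
move=> dP; apply/ffunP => A; rewrite [RHS]ffunE -[RHS]/(c * _) -!/(bcomp _ _ x) !comp_dirac mulr_sumr.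
by apply: eq_bigr => j _; rewrite (compZ (fun=> c)) /pd (DvZ _ _ _ (dP _)); ring.
Qed.

Lemma dirac_sum (I : Type) (r : seq I) (p : pred I) (F : I -> 'rV[R]_n -> Cl R n) x :
  (forall a, dffC (F a)) ->
  dirac_x (fun y => \sum_(a <- r | p a) F a y) x = \sum_(a <- r | p a) dirac_x (F a) x.
Proof.
move=> dF; apply/ffunP => A; rewrite [RHS]sum_ffunE -/(bcomp _ _ x) comp_dirac.
under [RHS]eq_bigr do rewrite -/(bcomp _ _ x) comp_dirac.
rewrite exchange_big; apply: eq_bigr => j _; rewrite comp_sum /pd (Dv_sum _ _ _ _ (fun a => dF a _)).
by rewrite mulr_sumr; apply: eq_bigr => a _.
Qed.

Lemma xm_xm P x : xm (xm P) x = - r2 x *: P x.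
Proof.
apply/ffunP => C; rewrite [RHS]ffunE -[RHS]/(_ * bcomp P C x) -/(bcomp _ _ x) comp_xm.
under eq_bigr do rewrite comp_xm.
have H := sg_anti_sum (fun j l D => x 0 j * x 0 l * bcomp P D x) C.
have E : \sum_j \sum_l sg R j C * sg R l (flip j C) * (x 0 l * x 0 j * bcomp P (flip l (flip j C)) x)
  = \sum_j \sum_l sg R j C * sg R l (flip j C) * (x 0 j * x 0 l * bcomp P (flip l (flip j C)) x).
  by apply: eq_bigr => j _; apply: eq_bigr => l _; ring.
have E2 : \sum_j x 0 j * (sg R j C * (\sum_l x 0 l * (sg R l (flip j C) * bcomp P (flip l (flip j C)) x)))
  = \sum_j \sum_l sg R j C * sg R l (flip j C) * (x 0 j * x 0 l * bcomp P (flip l (flip j C)) x).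
  by apply: eq_bigr => j _; rewrite !mulr_sumr; apply: eq_bigr => l _; ring.
have E3 : \sum_j x 0 j * x 0 j * bcomp P C x = r2 x * bcomp P C x.
  by rewrite mulr_suml; apply: eq_bigr => j _; rewrite expr2.
rewrite E2; move: H; rewrite E E3; set S := \sum_j _ => H; lra.
Qed.

(** Differentiating the factors [x_j] gives [- n]. The remaining terms fall under [sg_anti_sum],
    whose diagonal is the Euler operator. *)
Lemma dirac_xm k P x : hC k P ->
  dirac_x (xm P) x = - (n%:R + 2 * k%:R) *: P x - xm (dirac_x P) x.
Proof.
move=> hP; have dP := hC_dffC hP.
apply/ffunP => C; rewrite [RHS]ffunE [in X in X + _]ffunE [in X in _ + X]ffunE.
rewrite -[_ *: _]/(_ * bcomp P C x) -!/(bcomp _ _ x) comp_dirac comp_xm.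
have E1 (j : 'I_n) D : pd j (bcomp (xm P) D) x =
   sg R j D * bcomp P (flip j D) x + \sum_l x 0 l * (sg R l D * pd j (bcomp P (flip l D)) x).
  have -> : bcomp (xm P) D = fun y => \sum_l y 0 l * (sg R l D * bcomp P (flip l D) y).
    by apply/funext => y; rewrite comp_xm.
  have dt (l : 'I_n) := dffM (@dff_coord R n l) (dffM (@dff_cst R n (sg R l D)) (dP (flip l D))).
  rewrite /pd (Dv_sum _ _ _ _ dt).
  under eq_bigr => l _ do rewrite (DvM _ x (@dff_coord R n l) (dffM (@dff_cst R n (sg R l D)) (dP (flip l D))))
     (DvZ _ _ x (dP (flip l D))) Dv_coord unitvE.
  rewrite big_split /= addrC; congr (_ + _).
  rewrite (bigD1 j)//= eqxx mulr1 big1 ?addr0// => l lj.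
  by rewrite eq_sym (negbTE lj) mulr0.
under eq_bigr do rewrite E1 mulrDr.
rewrite big_split /=.
have -> : \sum_(j < n) sg R j C * (sg R j (flip j C) * bcomp P (flip j (flip j C)) x) = - n%:R * bcomp P C x.
  rewrite (eq_bigr (fun=> - bcomp P C x)) => [|j _]; last by rewrite mulrA sg_flip flipK mulN1r.
  by rewrite sumr_const card_ord mulNrn mulNr mulr_natl.
have [b bE] : exists b : 'I_n -> 'I_n -> {set 'I_n} -> R,
    forall j l D, b j l D = x 0 l * pd j (bcomp P D) x by eexists.
have H := sg_anti_sum b C.
have Eu : \sum_j b j j C = k%:R * bcomp P C x.
  rewrite -(hpoly_euler x (hP C)) (Dv_pd x x (dP C)).
  by apply: eq_bigr => j _; rewrite bE.
have E2 : \sum_j sg R j C * (\sum_l x 0 l * (sg R l (flip j C) * pd j (bcomp P (flip l (flip j C))) x))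
  = \sum_j \sum_l sg R j C * sg R l (flip j C) * b j l (flip l (flip j C)).
  by apply: eq_bigr => j _; rewrite !mulr_sumr; apply: eq_bigr => l _; rewrite bE; ring.
have E3 : \sum_j x 0 j * (sg R j C * bcomp (dirac_x P) (flip j C) x)
  = \sum_j \sum_l sg R j C * sg R l (flip j C) * b l j (flip l (flip j C)).
  apply: eq_bigr => j _; rewrite comp_dirac !mulr_sumr; apply: eq_bigr => l _.
  by rewrite bE; ring.
rewrite E2 E3; move: H; rewrite Eu.
set S1 := \sum_j \sum_l _; set S2 := \sum_j \sum_l _ => H; lra.
Qed.

Definition xmn s P := iter s xm P.
Definition dn s P := iter s (@dirac_x R n) P.

Lemma hC_xmn k s P : hC k P -> hC (k + s) (xmn s P).
Proof. by move=> hP; elim: s => [|s IH]; rewrite ?addn0// addnS; exact: hC_xm. Qed.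

Lemma hC_dn k s P : hC k P -> hC (k - s) (dn s P).
Proof. by move=> hP; elim: s => [|s IH]; rewrite ?subn0// subnS; exact: hC_dirac. Qed.

(* For a spherical monogenic [P] of degree [k], [dirac (x^s P) = - beta k s x^(s-1) P]. *)
Definition beta k s : R := if odd s then n%:R + 2 * k%:R + s%:R - 1 else s%:R.

Lemma betaS k s : beta k s.+1 = n%:R + 2 * k%:R + 2 * s%:R - beta k s.
Proof. by rewrite /beta /= -natr1; case: (odd s) => /=; ring. Qed.

Lemma beta_ge k s : s%:R <= beta k s.
Proof.
rewrite /beta; case: ifP => // _; have : 1 <= n%:R :> R by rewrite ler1n.
have : 0 <= k%:R :> R by []; lra.
Qed.

Lemma beta_gt0 k s : 0 < beta k s.+1.
Proof. by apply: lt_le_trans (beta_ge k s.+1); rewrite ltr0n. Qed.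

Lemma xmnZ s c P x : xmn s (fun y => c *: P y) x = c *: xmn s P x.
Proof.
elim: s x => [//|s IH] x; rewrite /xmn /= -/(xmn s _) -xmZ.
by congr (xm _ x); apply/funext => y; exact: IH.
Qed.

Lemma xmn_sum s (I : Type) (r : seq I) (p : pred I) (F : I -> 'rV[R]_n -> Cl R n) x :
  xmn s (fun y => \sum_(a <- r | p a) F a y) x = \sum_(a <- r | p a) xmn s (F a) x.
Proof.
elim: s x => [//|s IH] x; rewrite /xmn /= -/(xmn s _) -xm_sum.
by congr (xm _ x); apply/funext => y; exact: IH.
Qed.

Lemma xm0 x : xm (fun=> 0) x = 0.
Proof. by apply/ffunP => A; rewrite -/(bcomp _ _ x) comp_xm ffunE big1// => j _; rewrite /bcomp ffunE !mulr0. Qed.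

Lemma xmn0 s x : xmn s (fun=> 0) x = 0.
Proof.
elim: s x => [//|s IH] x; rewrite /xmn /= -/(xmn s _) (_ : xmn s _ = fun=> 0) ?xm0//.
by apply/funext => y; exact: IH.
Qed.

Lemma dirac0 x : dirac_x (fun=> 0) x = 0 :> Cl R n.
Proof.
apply/ffunP => A; rewrite -/(bcomp _ _ x) comp_dirac ffunE big1// => j _.
rewrite (_ : bcomp _ _ = fun=> 0) ?/pd ?DvC ?mulr0//.
by apply/funext => y; rewrite /bcomp ffunE.
Qed.

Lemma dn_sum s (I : Type) (r : seq I) (p : pred I) (F : I -> 'rV[R]_n -> Cl R n) (k : I -> nat) x :
  (forall a, hC (k a) (F a)) ->
  dn s (fun y => \sum_(a <- r | p a) F a y) x = \sum_(a <- r | p a) dn s (F a) x.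
Proof.
move=> hF; elim: s x => [//|s IH] x; rewrite /dn /= -/(dn s _).
rewrite -(@dirac_sum _ r p (fun a => dn s (F a))); last by move=> a; exact: hC_dffC (hC_dn s (hF a)).
by congr (dirac_x _ x); apply/funext => y; exact: IH.
Qed.

Lemma dnZ s k c P x : hC k P -> dn s (fun y => c *: P y) x = c *: dn s P x.
Proof.
move=> hP; elim: s x => [//|s IH] x; rewrite /dn /= -/(dn s _).
rewrite -(diracZ _ _ (hC_dffC (hC_dn s hP))).
by congr (dirac_x _ x); apply/funext => y; exact: IH.
Qed.

Lemma dirac_xmn k s P x : hC k P ->
  dirac_x (xmn s P) x = - beta k s *: xmn s.-1 P x + (-1) ^+ s *: xmn s (dirac_x P) x.
Proof.
move=> hP; elim: s x => [|s IH] x; first by rewrite /beta /= oppr0 scale0r add0r expr0 scale1r.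
rewrite [xmn s.+1 P]/(xm (xmn s P)) (dirac_xm x (hC_xmn s hP)).
have -> : xm (dirac_x (xmn s P)) x = - beta k s *: xm (xmn s.-1 P) x + (-1) ^+ s *: xmn s.+1 (dirac_x P) x.
  rewrite (_ : dirac_x (xmn s P) = fun y => \sum_(b : bool) (if b then - beta k s else (-1) ^+ s) *:
     (if b then xmn s.-1 P else xmn s (dirac_x P)) y); last first.
    by apply/funext => y; rewrite IH big_bool.
  by rewrite xm_sum big_bool /= !xmZ.
have X : beta k s *: xm (xmn s.-1 P) x = beta k s *: xmn s P x.
  by case: s {IH} => [|s] //; rewrite /beta /= !scale0r.
rewrite betaS exprS mulN1r !scaleNr opprD opprK X addrA; congr (_ - _).
by rewrite natrD mulrDr addrA scalerBl opprB addrC.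
Qed.

(* [Pi d] is the projection of d-homogeneous polynomials onto spherical
   monogenics, given by its action on powers of [x] and of the Dirac operator. *)
Fixpoint pa d i : R := if i is i'.+1 then (-1) ^+ i' * pa d i' / beta (d - i) i else 1.

Definition Pi d q x : Cl R n := \sum_(i < d.+1) pa d i *: xmn i (dn i q) x.

Lemma hC_Pi d q : hC d q -> hC d (Pi d q).
Proof.
move=> hq; apply: hC_sum => i _; apply: hCZ.
have := hC_xmn i (hC_dn i hq); by rewrite subnK// -ltnS.
Qed.

Lemma dn_0 d q x : hC d q -> dn d.+1 q x = 0.
Proof.
move=> hq; have h := hC_dn d hq; rewrite subnn in h.
apply/ffunP => A; rewrite -/(bcomp _ _ x) [dn d.+1 q]/(dirac_x (dn d q)) comp_dirac ffunE big1// => j _.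
by rewrite /pd (hpoly0_Dv _ _ (h _)) mulr0.
Qed.

(** The recursion for [pa] says that [pa (i+1) beta (d-i-1) (i+1)] equals [(-1)^i pa i]. Hence the
    two terms given by [dirac_xmn] telescope; the last one is 0 because [d + 1] Dirac operators
    annihilate degree [d]. *)
Lemma dirac_Pi d q x : hC d q -> dirac_x (Pi d q) x = 0.
Proof.
move=> hq; pose u i := (pa d i * beta (d - i) i) *: xmn i.-1 (dn i q) x.
have hx i := hC_xmn i (hC_dn i hq).
rewrite (@dirac_sum _ _ _ (fun (i : 'I_d.+1) y => pa d i *: xmn i (dn i q) y)); last first.
  by move=> i; exact: hC_dffC (hCZ _ (hx i)).
transitivity (\sum_(0 <= i < d.+1) (u i.+1 - u i)).
  rewrite big_mkord; apply: eq_bigr => i _.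
  rewrite (diracZ _ _ (hC_dffC (hx i))) (dirac_xmn i x (hC_dn i hq)) scalerDr !scalerA addrC.
  congr (_ + _); last by rewrite mulrN scaleNr.
  by rewrite /u /= divfK ?gt_eqF ?beta_gt0// mulrC.
have U0 : u 0%N = 0 by rewrite /u mulr0 scale0r.
have Ud : u d.+1 = 0.
  rewrite /u (_ : dn d.+1 q = fun=> 0) ?xmn0 ?scaler0//.
  by apply/funext => y; exact: dn_0.
by rewrite telescope_sumr// U0 Ud subr0.
Qed.

Lemma Pi_step d q x : q x = Pi d q x - xm (fun y => \sum_(i < d) pa d i.+1 *: xmn i (dn i.+1 q) y) x.
Proof.
rewrite /Pi big_ord_recl /= scale1r -addrA -[LHS]addr0; congr (_ + _).
rewrite xm_sum; apply/esym/eqP; rewrite subr_eq0; apply/eqP; apply: eq_bigr => i _.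
by rewrite xmZ.
Qed.

Definition mono k P := hC k P /\ forall x, dirac_x P x = 0.

(** By [Pi_step], [q] and [Pi d q] differ by a left multiple of [x], whose cofactor has degree one
    less. *)
Lemma fischer_exists d q : hC d q -> exists P : nat -> 'rV[R]_n -> Cl R n,
  (forall j, mono (d - j) (P j)) /\ forall x, q x = \sum_(j < d.+1) xmn j (P j) x.
Proof.
elim: d q => [|d IH] q hq.
  exists (fun j : nat => if j is 0 then Pi 0 q else (fun _ : 'rV[R]_n => (0 : Cl R n))); split.
    case=> [|j]; first by split; [exact: hC_Pi|move=> x; exact: dirac_Pi].
    by split; [exact: hC0|exact: dirac0].
  move=> x; rewrite big_ord1 /= {1}(Pi_step 0 q x) (_ : (fun y => _) = fun=> 0) ?xm0 ?subr0//.
  by apply/funext => y; rewrite big_ord0.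
pose q' y := \sum_(i < d.+1) (- pa d.+1 i.+1) *: xmn i (dn i.+1 q) y.
have hq' : hC d q'.
  apply: hC_sum => i _; apply: hCZ.
  have := hC_xmn i (hC_dn i.+1 hq); by rewrite subSS subnK// -ltnS.
have [P [hP E]] := IH q' hq'.
exists (fun j => if j is j'.+1 then P j' else Pi d.+1 q); split.
  case=> [|j]; first by split; [exact: hC_Pi|move=> x; exact: dirac_Pi].
  by rewrite subSS.
move=> x; rewrite big_ord_recl {1}(Pi_step d.+1 q x); congr (_ + _).
transitivity (xm q' x).
  rewrite -scaleN1r -xmZ; congr (xm _ x); apply/funext => y.
  rewrite scaler_sumr; apply: eq_bigr => i _; by rewrite scalerA mulN1r.
by rewrite (_ : q' = fun y => \sum_(j < d.+1) xmn j (P j) y) ?xm_sum//; apply/funext.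
Qed.

Lemma dirac_xmn_mono k s P x : mono k P -> dirac_x (xmn s P) x = - beta k s *: xmn s.-1 P x.
Proof.
move=> [hP mP]; rewrite (dirac_xmn s x hP) (_ : dirac_x P = fun=> 0) ?xmn0 ?scaler0 ?addr0//.
by apply/funext => y; exact: mP.
Qed.

(* [dirac^J (x^j P) = (-1)^J (bprod k j J) x^(j-J) P] for [P] as above. *)
Definition bprod k j J : R := \prod_(t < J) beta k (j - t).

Lemma dn_xmn k j J P x : mono k P ->
  dn J (xmn j P) x = ((-1) ^+ J * bprod k j J) *: xmn (j - J) P x.
Proof.
move=> mP; elim: J x => [|J IH] x; first by rewrite /bprod big_ord0 expr0 mulr1 scale1r subn0.
transitivity (dirac_x (fun y => ((-1) ^+ J * bprod k j J) *: xmn (j - J) P y) x).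
  by rewrite /dn /= -/(dn J _); congr (dirac_x _ x); apply/funext.
rewrite (diracZ _ _ (hC_dffC (hC_xmn _ mP.1))) (dirac_xmn_mono _ _ mP) scalerA -subnS.
by congr (_ *: _); rewrite /bprod big_ord_recr /= exprS; ring.
Qed.

Lemma bprod0 k j J : (j < J)%N -> bprod k j J = 0.
Proof. by move=> jJ; rewrite /bprod (bigD1 (Ordinal jJ))//= subnn /beta /= mul0r. Qed.

Lemma xmnD s t P : xmn s (xmn t P) = xmn (s + t) P.
Proof. by rewrite /xmn iterD. Qed.

Lemma Pi_id k P x : mono k P -> Pi k P x = P x.
Proof.
move=> [hP mP].
have Z l : dn l.+1 P = fun=> 0.
  elim: l => [|l IH]; first by apply/funext => y; exact: mP.
  by apply/funext => y; rewrite -[RHS](dirac0 y) -IH.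
rewrite /Pi big_ord_recl big1 => [|i _]; last by rewrite lift0 Z xmn0 scaler0.
by rewrite addr0 /= scale1r.
Qed.

(** The coefficient [c] is never computed. [Pi] returns [c x^(s+1) P], which the Dirac operator
    annihilates; this gives [c x^s P = 0] after division by a positive [beta], and one more
    multiplication by [x] concludes. *)
Lemma Pi_xmn k s P x : mono k P -> Pi (k + s.+1) (xmn s.+1 P) x = 0.
Proof.
move=> mP; pose d := (k + s.+1)%N.
pose c := \sum_(i < d.+1) (if (i <= s.+1)%N then pa d i * ((-1) ^+ i * bprod k s.+1 i) else 0).
have E y : Pi d (xmn s.+1 P) y = c *: xmn s.+1 P y.
  rewrite /Pi /c scaler_suml; apply: eq_bigr => i _.
  rewrite (_ : dn i _ = fun z => ((-1) ^+ i * bprod k s.+1 i) *: xmn (s.+1 - i) P z); last first.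
    by apply/funext => z; exact: dn_xmn.
  rewrite xmnZ xmnD scalerA; case: leqP => is1; first by rewrite addnC subnK.
  by rewrite bprod0// !mulr0 !scale0r.
have hx := hC_xmn s.+1 mP.1.
have D y := dirac_Pi y hx.
have D2 y : c *: xmn s P y = 0.
  have := D y; rewrite (_ : Pi _ _ = fun z => c *: xmn s.+1 P z); last by apply/funext => z; exact: E.
  rewrite (diracZ _ _ (hC_dffC hx)) (dirac_xmn_mono _ _ mP) scalerA mulrC -scalerA => /eqP.
  rewrite scaler_eq0 oppr_eq0 gt_eqF ?beta_gt0//= => /eqP //.
rewrite E [xmn s.+1 P]/(xm (xmn s P)) -xmZ (_ : (fun y => _) = fun=> 0) ?xm0//.
by apply/funext.
Qed.

Lemma Pi_sum d (I : finType) (F : I -> 'rV[R]_n -> Cl R n) (k : I -> nat) x :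
  (forall a, hC (k a) (F a)) ->
  Pi d (fun y => \sum_a F a y) x = \sum_a Pi d (F a) x.
Proof.
move=> hF; rewrite /Pi [RHS]exchange_big; apply: eq_bigr => i _ /=.
rewrite -scaler_sumr; congr (_ *: _); rewrite -xmn_sum; congr (xmn i _ x).
by apply/funext => y; exact: dn_sum.
Qed.

Lemma PiZ d k c P x : hC k P -> Pi d (fun y => c *: P y) x = c *: Pi d P x.
Proof.
move=> hP; rewrite /Pi scaler_sumr; apply: eq_bigr => i _.
transitivity (pa d i *: (c *: xmn i (dn i P) x)); last by rewrite !scalerA mulrC.
congr (_ *: _); rewrite -xmnZ; congr (xmn i _ x).
by apply/funext => y; exact: dnZ hP.
Qed.

(** [dn J] kills the components of index below [J], turns the J-th into a multiple of [P J], and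
    leaves a positive power of [x] on the later ones, which [Pi] kills. Both uniqueness and bounds
    come from this formula. *)
Lemma fischer_extract d q (P : nat -> 'rV[R]_n -> Cl R n) J x :
  (forall j, mono (d - j) (P j)) -> (forall x, q x = \sum_(j < d.+1) xmn j (P j) x) ->
  (J <= d)%N -> Pi (d - J) (dn J q) x = ((-1) ^+ J * bprod (d - J) J J) *: P J x.
Proof.
move=> mP qE Jd.
have E : dn J q = fun y => \sum_(j < d.+1) ((-1) ^+ J * bprod (d - j) j J) *: xmn (j - J) (P j) y.
  apply/funext => y; rewrite (_ : q = fun y => \sum_(j < d.+1) xmn j (P j) y); last by apply/funext.
  rewrite (@dn_sum J _ _ _ (fun j : 'I_d.+1 => xmn j (P j)) (fun j : 'I_d.+1 => d - j + j)%N); last first.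
    by move=> j; exact: hC_xmn (mP j).1.
  by apply: eq_bigr => j _; exact: dn_xmn (mP j).
rewrite E (@Pi_sum _ _ (fun j : 'I_d.+1 => fun y => ((-1) ^+ J * bprod (d - j) j J) *: xmn (j - J) (P j) y)
   (fun j : 'I_d.+1 => d - j + (j - J))%N); last first.
  by move=> j; apply: hCZ; exact: hC_xmn (mP j).1.
have Jd1 : (J < d.+1)%N by [].
rewrite (bigD1 (Ordinal Jd1))//= big1 ?addr0 => [|j /eqP jJ].
  by rewrite (PiZ _ _ _ (hC_xmn _ (mP J).1)) subnn /= (Pi_id _ (mP J)).
rewrite (PiZ _ _ _ (hC_xmn _ (mP j).1)); have [jJ'|jJ'] := ltnP j J.
  by rewrite bprod0// mulr0 scale0r.
have Jj : (J < j)%N by rewrite ltn_neqAle jJ' andbT; apply/eqP => e; apply: jJ; exact: val_inj.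
have jd : (j <= d)%N by rewrite -ltnS.
have -> : (d - J = d - j + (j - J).-1.+1)%N by rewrite prednK ?subn_gt0// addnBA// subnK.
by rewrite -{2}(@prednK (j - J)) ?subn_gt0// (Pi_xmn _ _ (mP j)) scaler0.
Qed.

Lemma bprod_ge k J : J`!%:R <= bprod k J J.
Proof.
rewrite /bprod; elim: J => [|J IH]; first by rewrite big_ord0 fact0.
rewrite big_ord_recl subn0 factS natrM ler_pM//; first exact: beta_ge.
Qed.

Lemma pa_le d i : `|pa d i| <= (i`!)%:R^-1.
Proof.
elim: i => [|i IH]; first by rewrite fact0 invr1 normr1.
rewrite /= !normrM normrX normrN1 expr1n mul1r normfV (gtr0_norm (beta_gt0 _ _)).
rewrite factS natrM invfM [leRHS]mulrC; apply: ler_pM => //; first by rewrite invr_ge0 ltW// beta_gt0.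
by rewrite lef_pV2 ?posrE ?beta_gt0// ?ltr0n// beta_ge.
Qed.

Lemma xm_bound P (K : R) x : (forall A, `|bcomp P A x| <= K) -> cube 0 1 x ->
  forall A, `|bcomp (xm P) A x| <= n%:R * K.
Proof.
move=> bP cx A; rewrite comp_xm; apply: le_trans (ler_norm_sum _ _ _) _.
apply: (le_trans (y := \sum_(j < n) K)); last by rewrite sumr_const card_ord mulr_natl.
apply: ler_sum => j _; rewrite !normrM sg_norm mul1r -[leRHS]mul1r ler_pM//.
by have := cx j; rewrite mxE subr0.
Qed.

Lemma xmn_bound P (K : R) s x : (forall A, `|bcomp P A x| <= K) -> cube 0 1 x ->
  forall A, `|bcomp (xmn s P) A x| <= n%:R ^+ s * K.
Proof.
move=> bP cx; elim: s => [|s IH] A; first by rewrite expr0 mul1r.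
by rewrite exprS -mulrA; exact: xm_bound.
Qed.

Lemma bin_le2 a b : 'C(a + b, a)%:R <= 2 ^+ (a + b) :> R.
Proof.
rewrite -natrX ler_nat (_ : (2 ^ (a + b))%N = ((1 + 1) ^ (a + b))%N)// expnDn (bigD1 (inord a))//=.
rewrite !exp1n !mul1n muln1 inordK ?leq_addr// ltnS leq_addr//.
Qed.

(** Factorials of the order are allowed in the bound for derivatives of [q]. The [1 / i!] of [pa]
    and the [1 / J!] of [bprod] reduce [(i+J)!] to a binomial coefficient, so only geometric factors
    remain. *)
Lemma fischer_bound d q (P : nat -> 'rV[R]_n -> Cl R n) (K : R) J x A :
  (forall j, mono (d - j) (P j)) -> (forall x, q x = \sum_(j < d.+1) xmn j (P j) x) ->
  (J <= d)%N -> 0 <= K -> cube 0 1 x ->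
  (forall i B, (i <= d)%N -> `|bcomp (dn i q) B x| <= i`!%:R * K) ->
  `|bcomp (P J) A x| <= d.+1%:R * (2 * n%:R) ^+ d * K.
Proof.
move=> mP qE Jd K0 cx bq.
have bp : 0 < bprod (d - J) J J.
  by apply: lt_le_trans (bprod_ge _ _); rewrite ltr0n fact_gt0.
have H : J`!%:R * `|bcomp (P J) A x| <= `|bcomp (Pi (d - J) (dn J q)) A x|.
  rewrite /bcomp (fischer_extract x mP qE Jd) ffunE -[_ *: _]/(_ * _) !normrM normrX normrN1 expr1n mul1r.
  by rewrite (gtr0_norm bp) ler_wpM2r// bprod_ge.
have F0 (i : nat) : 0 < i`!%:R :> R by rewrite ltr0n fact_gt0.
rewrite -(ler_pM2l (F0 J)); apply: le_trans H _.
rewrite [bcomp _ _ _]sum_ffunE; apply: le_trans (ler_norm_sum _ _ _) _.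
apply: (le_trans (y := \sum_(i < (d - J).+1) J`!%:R * ((2 * n%:R) ^+ d * K))); last first.
  rewrite sumr_const card_ord -[leLHS]mulr_natl mulrCA; apply: ler_wpM2l; first exact: ltW.
  rewrite mulrA; apply: ler_wpM2r => //.
  by rewrite ler_wpM2r ?exprn_ge0 ?mulr_ge0// ler_nat ltnS leq_subr.
apply: ler_sum => i _.
have iJd : (i + J <= d)%N by rewrite addnC -leq_subRL// -ltnS.
rewrite ffunE normrM -/(bcomp _ A x).
have h : forall B, `|bcomp (dn i (dn J q)) B x| <= (i + J)`!%:R * K.
  by move=> B; rewrite /dn -iterD; exact: bq.
apply: le_trans (ler_pM (normr_ge0 _) (normr_ge0 _) (pa_le _ _) (xmn_bound i h cx A)) _.
have nR : 1 <= n%:R :> R by rewrite ler1n.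
have E : (i + J)`!%:R = 'C(i + J, i)%:R * (i`!%:R * J`!%:R) :> R.
  by rewrite -!natrM -(bin_fact (leq_addr J i)) addKn.
have -> : (i`!)%:R^-1 * (n%:R ^+ i * ((i + J)`!%:R * K)) = J`!%:R * (n%:R ^+ i * 'C(i + J, i)%:R * K).
  rewrite E; field; by rewrite gt_eqF.
rewrite ler_wpM2l ?(ltW (F0 _))// ler_wpM2r// exprMn mulrC ler_pM ?exprn_ge0//.
  apply: le_trans (bin_le2 _ _) _; rewrite ler_eXn2l ?ltr1n//.
rewrite ler_weXn2l//; exact: leq_trans (leq_addr _ _) iJd.
Qed.
End Fischer.

(** * The polynomials X_k^j P as Cauchy-Kovalevskaya extensions *)

Section HomogeneousGegenbauer.
Variable R : realType.
Implicit Types (nu z r : R) (s i l : nat).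

Definition hcoef nu s i : R := (-1) ^+ i * poch nu (s - i) / ((i`!)%:R * ((s - 2 * i)`!)%:R).

(* [hgeg_z], [hgeg_r]: partial derivatives of [hgeg nu s z r] in [z] and [r]. *)
Definition hgeg_z nu s z r : R :=
  \sum_(i < (s./2).+1) hcoef nu s i * ((s - 2 * i)%:R * 2 * (2 * z) ^+ (s - 2 * i).-1) * r ^+ i.

Definition hgeg_r nu s z r : R :=
  \sum_(i < (s./2).+1) hcoef nu s i * (2 * z) ^+ (s - 2 * i) * (i%:R * r ^+ i.-1).

(** Brings sums of different lengths to a common range; the guard discards the indices at which
    [s - 2 * i] would be truncated. *)
Lemma sum_half_guard (F : nat -> R) s N : (s./2 < N)%N ->
  \sum_(i < (s./2).+1) F i = \sum_(i < N) (if (2 * i <= s)%N then F i else 0).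
Proof.
move=> sN; rewrite (big_ord_widen N F sN) big_mkcond.
by apply: eq_bigr => i _; rewrite ltnS geq_half_double mul2n.
Qed.

Lemma pochSl nu m : poch nu m.+1 = nu * poch (nu + 1) m.
Proof.
rewrite /poch big_ord_recl addr0; congr (_ * _); apply: eq_bigr => i _.
by rewrite lift0 -natr1; ring.
Qed.

Lemma pochSr nu m : poch nu m.+1 = poch nu m * (nu + m%:R).
Proof. by rewrite /poch big_ord_recr. Qed.

Lemma poch_gt0 nu m : 0 < nu -> 0 < poch nu m.
Proof. by move=> nu0; apply: prodr_gt0 => i _; rewrite ltr_wpDr. Qed.

Lemma fact_neq0 m : (m`!)%:R != 0 :> R.
Proof. by rewrite pnatr_eq0 -lt0n fact_gt0. Qed.

Lemma hgeg_zS nu s z r : hgeg_z nu s.+1 z r = 2 * nu * hgeg (nu + 1) s z r.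
Proof.
have sN : (s.+1./2 < s.+2)%N by rewrite ltnS -{2}(half_double s.+1) half_leq// -addnn leq_addr.
have sN' : (s./2 < s.+2)%N by apply: leq_ltn_trans sN; exact: half_leq.
rewrite /hgeg_z (@sum_half_guard (fun i => hcoef nu s.+1 i * ((s.+1 - 2 * i)%:R * 2 * (2 * z) ^+ (s.+1 - 2 * i).-1) * r ^+ i) _ _ sN).
rewrite /hgeg (@sum_half_guard (fun i => (-1) ^+ i * poch (nu + 1) (s - i) / ((i`!)%:R * ((s - 2 * i)`!)%:R) * (2 * z) ^+ (s - 2 * i) * r ^+ i) _ _ sN').
rewrite mulr_sumr; apply: eq_bigr => i _.
have [is1|is1] := leqP (2 * i) s.
  have is2 : (i <= s)%N by apply: leq_trans is1; rewrite mul2n -addnn leq_addr.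
  rewrite (leq_trans is1 (leqnSn _)) /hcoef !subSn// pochSl factS natrM /=.
  field; rewrite ?fact_neq0//= -natr1 gt_eqF// ltr_wpDl.
case: ifP => is2; last by rewrite mulr0.
have -> : (s.+1 - 2 * i = 0)%N by apply/eqP; rewrite subn_eq0.
by rewrite !mul0r mulr0 mul0r mulr0.
Qed.

Lemma hgeg_euler nu s z r : s%:R * hgeg nu s z r = z * hgeg_z nu s z r + 2 * r * hgeg_r nu s z r.
Proof.
rewrite /hgeg /hgeg_z /hgeg_r !mulr_sumr -big_split; apply: eq_bigr => i _ /=.
rewrite -/(hcoef nu s i); have is1 : (2 * i <= s)%N by rewrite mul2n -geq_half_double -ltnS.
have -> : s%:R = (s - 2 * i)%:R + 2 * i%:R :> R by rewrite natrB// natrM; ring.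
move: (s - 2 * i)%N (hcoef nu s i) => a c; case: a => [|a]; case: (i : nat) => [|j] /=;
  rewrite ?expr0 ?exprS; ring.
Qed.

(** The contiguity relation behind the vanishing of the coefficient of [x P] in the Cauchy-Riemann
    system for [X_k^j P], with [r] in the role of the squared norm. It is checked on each power of
    [r]. *)
Lemma hgeg_contig nu s z r :
  nu * (hgeg_z (nu + 1) s z r + 2 * z * hgeg_r (nu + 1) s z r) =
  - (2 * nu + s%:R + 1) * hgeg_r nu s.+1 z r.
Proof.
case: s => [|s].
  by rewrite /hgeg_z /hgeg_r !big_ord1 /= !mul0r !mulr0 mul0r addr0 !mulr0.
have N1 : (s.+1./2 < s.+2)%N by rewrite ltn_half_double; lia.
have N2 : (s.+1./2 < s.+3)%N by rewrite ltn_half_double; lia.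
have N3 : (s.+2./2 < s.+3)%N by rewrite ltn_half_double; lia.
rewrite /hgeg_z /hgeg_r.
rewrite (@sum_half_guard (fun i => hcoef (nu + 1) s.+1 i * ((s.+1 - 2 * i)%:R * 2 * (2 * z) ^+ (s.+1 - 2 * i).-1) * r ^+ i) _ _ N1).
rewrite (@sum_half_guard (fun i => hcoef (nu + 1) s.+1 i * (2 * z) ^+ (s.+1 - 2 * i) * (i%:R * r ^+ i.-1)) _ _ N2).
rewrite (@sum_half_guard (fun i => hcoef nu s.+2 i * (2 * z) ^+ (s.+2 - 2 * i) * (i%:R * r ^+ i.-1)) _ _ N3).
rewrite [X in 2 * z * X]big_ord_recl [X in _ = _ * X]big_ord_recl /= !mul0r !mulr0 !add0r.
rewrite mulrDr !mulr_sumr -big_split; apply: eq_bigr => b _.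
rewrite ?lift0 /bump ?leq0n ?add1n; have [bs|bs] := leqP (2 * b) s; last first.
  have -> : (2 * b.+1 <= s.+1)%N = false by lia.
  have -> : (2 * b.+1 <= s.+2)%N = false by lia.
  case: ifP => b1; rewrite /= !mulr0 addr0//.
  have -> : (s.+1 - 2 * b = 0)%N by lia.
  by rewrite !mul0r mulr0 mul0r mulr0.
move: (nat_of_ord b) bs => {b}b bs.
have [a sE] : exists a, s = (2 * b + a)%N by exists (s - 2 * b)%N; lia.
have -> : (2 * b <= s.+1)%N by lia.
have -> : (2 * b.+1 <= s.+2)%N by lia.
have -> : (2 * b.+1 <= s.+1)%N = (0 < a)%N by lia.
rewrite /hcoef.
have -> : (s.+1 - 2 * b = a.+1)%N by lia.
have -> : (s.+1 - b = (b + a).+1)%N by lia.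
have -> : (s.+1 - 2 * b.+1 = a.-1)%N by lia.
have -> : (s.+1 - b.+1 = b + a)%N by lia.
have -> : (s.+2 - 2 * b.+1 = a)%N by lia.
have -> : (s.+2 - b.+1 = (b + a).+1)%N by lia.
have -> : (s.+1)%:R = 2 * b%:R + a%:R + 1 :> R by rewrite -natr1 sE natrD natrM.
rewrite pochSr pochSl !factS !natrM !exprS -!natr1 natrD /=.
have nzb := fact_neq0 b; have nb1 : b%:R + 1 != 0 :> R by rewrite gt_eqF// ltr_wpDl.
move: (poch (nu + 1) (b + a)) ((-1) ^+ b) (b`!%:R) nzb (r ^+ b) => p e fb nzb rb.
case: a {sE} => [|a] /=.
  by rewrite fact0 expr0; field; rewrite nzb nb1 //= add0r oner_neq0.
rewrite factS natrM exprS -natr1.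
have nza := fact_neq0 a; have na1 : a%:R + 1 != 0 :> R by rewrite gt_eqF// ltr_wpDl.
have na2 : a%:R + 1 + 1 != 0 :> R by rewrite gt_eqF// !ltr_wpDl// addr_ge0.
move: (a`!%:R) nza ((2 * z) ^+ a) => fa nza za; field; rewrite ?nzb ?nb1 ?nza ?na1 ?na2//.
Qed.

Lemma hgeg_at0 nu s r : hgeg nu s 0 r = if odd s then 0 else gegenbauer nu s 0 * r ^+ s./2.
Proof.
rewrite /hgeg /gegenbauer mulr0 !big_ord_recr /= mulrDl.
have Z (i : nat) : (i < s./2)%N -> (0 : R) ^+ (s - 2 * i) = 0.
  by move=> h; rewrite expr0n; have -> : (s - 2 * i == 0)%N = false by lia.
rewrite !big1 => [||i _]; last 2 first.
- by move=> i _; rewrite Z// mulr0.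
- by rewrite Z// mulr0 mul0r.
case: ifP => os; last by rewrite mul0r !add0r.
have -> : (s - 2 * s./2 = 1)%N by have := odd_double_half s; rewrite os; lia.
by rewrite expr1 mulr0 mul0r addr0.
Qed.

Lemma gegenbauer_at0_neq0 nu l : 0 < nu -> gegenbauer nu (2 * l) 0 != 0.
Proof.
move=> nu0; rewrite /gegenbauer mulr0 mul2n doubleK big_ord_recr /= big1 => [|i _]; last first.
  rewrite expr0n; have := ltn_ord i; have -> : (l.*2 - 2 * i == 0)%N = false by have := ltn_ord i; lia.
  by rewrite mulr0.
have -> : (l.*2 - 2 * l = 0)%N by lia.
rewrite expr0 mulr1 add0r mulf_neq0 ?mulf_neq0 ?invr_neq0 ?mulf_neq0 ?fact_neq0 ?signr_eq0//.
by rewrite gt_eqF// poch_gt0.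
Qed.
End HomogeneousGegenbauer.

(** * Cauchy-Kovalevskaya extensions: existence, uniqueness and bounds *)

Section CauchyKovalevskaya.
Variables (R : realType) (n : nat).
Hypothesis n0 : (0 < n)%N.
Local Notation flip := (@flip n).
Local Notation lft j := (lift ord0 j : 'I_n.+1).
Implicit Types (A B C : {set 'I_n}) (P Q q : 'rV[R]_n -> Cl R n) (F : 'rV[R]_(n.+1) -> Cl R n).
Implicit Types (x : 'rV[R]_(n.+1)).

Lemma xvec_line0 x (t : R) : xvec (x + t *: unitv R ord0) = xvec x.
Proof. by apply/rowP => j; rewrite !mxE /= mulr0 addr0. Qed.

Lemma xvec_line x (t : R) (j : 'I_n) : xvec (x + t *: unitv R (lft j)) = xvec x + t *: unitv R j.
Proof. by apply/rowP => i; rewrite !mxE eqxx /= (inj_eq lift_inj). Qed.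

Lemma pd_xvec0 (p : 'rV[R]_n -> R) x : pd ord0 (fun y => p (xvec y)) x = 0.
Proof.
have xE : x = x + (0 : R) *: unitv R ord0 by rewrite scale0r addr0.
rewrite {1}xE /pd derive_line (_ : (fun _ => _) = fun=> p (xvec x)); first exact: derive_cst.
by apply/funext => t; rewrite xvec_line0.
Qed.

Lemma pd_xvec (p : 'rV[R]_n -> R) x (j : 'I_n) : pd (lft j) (fun y => p (xvec y)) x = pd j p (xvec x).
Proof.
have xE : x = x + (0 : R) *: unitv R (lft j) by rewrite scale0r addr0.
have vE : xvec x = xvec x + (0 : R) *: unitv R j by rewrite scale0r addr0.
rewrite {1}xE [in RHS]vE /pd !derive_line; congr ('D_1 _ (0 : R)).
by apply/funext => t; rewrite xvec_line.
Qed.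

Lemma hpoly_xvec k (p : 'rV[R]_n -> R) : hpoly k p -> hpoly k (fun x => p (xvec x)).
Proof.
elim: k p => [p [c ->]|k IH p [q hq ->]]; first by exists c.
apply: hpoly_sum => i _; rewrite (_ : (fun x => _) = fun x => x 0 (lft i) * q i (xvec x)).
  exact: hpolyX (IH _ (hq i)).
by apply/funext => x; rewrite mxE.
Qed.

Lemma CR_mul (a : 'rV[R]_(n.+1) -> R) k Q C x : dff a -> hC k Q ->
  CR (fun y => a y *: Q (xvec y)) C x =
  pd ord0 a x * bcomp Q C (xvec x) +
  \sum_(j < n) sg R j C * (pd (lft j) a x * bcomp Q (flip j C) (xvec x)) +
  a x * bcomp (dirac_x Q) C (xvec x).
Proof.
move=> da hQ.
have cE D : bcomp (fun y => a y *: Q (xvec y)) D = fun y => a y * bcomp Q D (xvec y).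
  by apply/funext => y; rewrite /bcomp ffunE.
have dQ D : dff (fun y => bcomp Q D (xvec y)) := hpoly_dff (hpoly_xvec (hQ D)).
rewrite /CR cE {1}/pd (DvM _ x da (dQ C)) -![X in _ * X + _]/(pd _ _ x) pd_xvec0 mulr0 add0r mulrC.
rewrite -addrA; congr (_ + _); rewrite comp_dirac mulr_sumr -big_split; apply: eq_bigr => j _ /=.
rewrite cE {1}/pd (DvM _ x da (dQ _)) -[X in a x * X]/(pd (lft j) (fun y => bcomp Q (flip j C) (xvec y)) x) pd_xvec.
rewrite -[X in _ + _ * X]/(pd (lft j) a x); ring.
Qed.

Lemma pd_scaleX (c : R) i (s : nat) x :
  pd i (fun y => c * y 0 ord0 ^+ s) x = c * (s%:R * x 0 ord0 ^+ s.-1 * (i == ord0)%:R).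
Proof.
have dc := @dff_coord R n.+1 ord0.
have dX t : dff (fun y : 'rV[R]_n.+1 => y 0 ord0 ^+ t) := hpoly_dff (@hpolyXn R n.+1 ord0 t).
rewrite /pd (DvZ c _ x (dX s)); congr (_ * _); elim: s => [|s IH].
  by rewrite mul0r mul0r (_ : (fun y => _) = fun=> 1) ?DvC//; apply/funext => y; rewrite expr0.
rewrite (_ : (fun y => _) = fun y : 'rV[R]_n.+1 => y 0 ord0 * y 0 ord0 ^+ s).
  rewrite (DvM _ x dc (dX s)) IH Dv_coord unitvE /= -natr1.
  by case: s {IH} => [|s] /=; rewrite ?expr0 ?exprS; ring.
by apply/funext => y; rewrite exprS.
Qed.

(* The Cauchy-Kovalevskaya extension [\sum_i (x_0^i / i!) (- dirac)^i (x^j P)]. *)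
Definition CK j k P x : Cl R n :=
  \sum_(i < j.+1) ((bprod R n k j i / i`!%:R) * x 0 ord0 ^+ i) *: xmn (j - i) P (xvec x).

Lemma hC_CKterm j k P i : hC k P -> (i <= j)%N ->
  hC (k + j) (fun x => ((bprod R n k j i / i`!%:R) * x 0 ord0 ^+ i) *: xmn (j - i) P (xvec x)).
Proof.
move=> hP ij A; rewrite (compZ (fun x => (bprod R n k j i / i`!%:R) * x 0 ord0 ^+ i) (fun x => xmn (j - i) P (xvec x))).
have -> : (k + j = i + (k + (j - i)))%N by lia.
by apply: hpolyM; [apply: hpolyZ; exact: hpolyXn|exact: hpoly_xvec (hC_xmn (j - i) hP A)].
Qed.

Lemma hC_CK j k P : hC k P -> hC (k + j) (CK j k P).
Proof. by move=> hP; apply: hC_sum => i _; apply: hC_CKterm => //; rewrite -ltnS. Qed.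

Lemma CR_CK j k P x C : mono k P -> CR (CK j k P) C x = 0.
Proof.
move=> mP; have hP := mP.1.
rewrite CR_sum; last first.
  by move=> i A; apply: hpoly_dff (hC_CKterm hP _ A); rewrite -ltnS.
(* [w i] comes from the x_0-derivative of the i-th summand and [- w (i+1)] from its Dirac
   derivative. Both ends are 0, the last because [bprod] with more than [j] factors contains
   [beta k 0]. *)
pose w i := if i is i'.+1 then bprod R n k j i / i'`!%:R * x 0 ord0 ^+ i' * bcomp (xmn (j - i) P) C (xvec x) else 0.
transitivity (\sum_(0 <= i < j.+1) (w i - w i.+1)).
  rewrite big_mkord; apply: eq_bigr => i _.
  have da : dff (fun y : 'rV[R]_n.+1 => bprod R n k j i / i`!%:R * y 0 ord0 ^+ i) :=
    hpoly_dff (hpolyZ _ (@hpolyXn R n.+1 ord0 i)).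
  rewrite (CR_mul C x da (hC_xmn (j - i) hP)) pd_scaleX eqxx mulr1.
  rewrite [X in _ + X + _]big1 ?addr0 => [|l _]; last first.
    by rewrite pd_scaleX /= !mulr0 mul0r mulr0.
  have -> : bcomp (dirac_x (xmn (j - i) P)) C (xvec x) = - beta R n k (j - i) * bcomp (xmn (j - i.+1) P) C (xvec x).
    by rewrite /bcomp (dirac_xmn_mono _ _ mP) ffunE subnS.
  congr (_ + _).
    rewrite /w; case: (i : nat) => [|l]; first by rewrite mul0r mulr0 mul0r.
    rewrite factS natrM /=; have := fact_neq0 R l; have : (l.+1)%:R != 0 :> R by rewrite pnatr_eq0.
    by move: (l.+1%:R) (l`!%:R) => a b a0 b0; field; rewrite a0 b0.
  rewrite /w /bprod big_ord_recr /= -/(bprod R n k j i); ring.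
rewrite -[LHS]opprK -sumrN; under eq_bigr do rewrite opprB.
by rewrite telescope_sumr// /w bprod0// !mul0r subrr oppr0.
Qed.

Lemma CK_at0 j k P x : x 0 ord0 = 0 -> CK j k P x = xmn j P (xvec x).
Proof.
move=> x00; rewrite /CK big_ord_recl big1 => [|i _]; last by rewrite x00 lift0 expr0n mulr0 scale0r.
by rewrite addr0 /bprod big_ord0 fact0 invr1 expr0 !mulr1 scale1r subn0.
Qed.

Lemma CR_pd0 F k x C : hC k F -> (forall x C, CR F C x = 0) ->
  CR (fun y => [ffun A => pd ord0 (bcomp F A) y]) C x = 0.
Proof.
move=> hF H; pose G y : Cl R n := [ffun A => pd ord0 (bcomp F A) y].
have cE A : bcomp G A = pd ord0 (bcomp F A) by apply/funext => y; rewrite /bcomp ffunE.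
have dp i A : dff (pd i (bcomp F A)) := hpoly_dff (hpoly_pd i (hF A)).
have E : CR F C = fun=> 0 by apply/funext => y; exact: H.
have : pd ord0 (CR F C) x = 0 by rewrite E /pd DvC.
have ds : dff (fun y => \sum_(j < n) sg R j C * pd (lft j) (bcomp F (flip j C)) y).
  by apply: dff_sum => j; exact: (dffM (dff_cst _) (dp _ _)).
rewrite /CR {1}/pd (DvD _ x (dp ord0 C) ds).
rewrite (Dv_sum _ _ _ _ (fun j : 'I_n => dffM (@dff_cst R n.+1 (sg R j C)) (dp (lft j) (flip j C)))) => H0; apply: etrans H0.
rewrite /CR cE; congr (_ + _); apply: eq_bigr => j _.
have E1 : pd ord0 (fun y => sg R j C * pd (lft j) (bcomp F (flip j C)) y) x =
   sg R j C * pd ord0 (pd (lft j) (bcomp F (flip j C))) x := DvZ _ _ x (dp (lft j) (flip j C)).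
apply: (etrans _ (esym E1)); congr (_ * _).
apply: (etrans (congr1 (fun u => pd (lft j) u x) (cE (flip j C)))).
exact: (hpoly_DvC (unitv R (lft j)) (unitv R ord0) x (hF (flip j C))).
Qed.

(** If [F] vanishes on [x_0 = 0], so do its tangential derivatives, and by the system also its
    x_0-derivative. The latter is monogenic of lower degree, hence 0 everywhere by induction, and
    [F] does not depend on [x_0]. *)
Lemma CR_unique d F : hC d F -> (forall x C, CR F C x = 0) ->
  (forall x, x 0 ord0 = 0 -> F x = 0) -> forall x, F x = 0.
Proof.
elim: d F => [|d IH] F hF H F0 x.
  have F00 := F0 0 ltac:(by rewrite mxE).
  apply/ffunP => A; have [c E] := hF A; rewrite -/(bcomp F A x) E.
  by move/ffunP: F00 => /(_ A); rewrite -/(bcomp F A 0) E.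
pose G y : Cl R n := [ffun A => pd ord0 (bcomp F A) y].
have cE A : bcomp G A = pd ord0 (bcomp F A) by apply/funext => y; rewrite /bcomp ffunE.
have hG : hC d G by move=> A; rewrite cE; exact: hpoly_pd (hF A).
have G0 y : G y = 0.
  apply: IH => // [z C|z z0]; first exact: CR_pd0 hF H.
  apply/ffunP => C; rewrite ffunE [RHS]ffunE; have /eqP := H z C; rewrite addr_eq0 => /eqP ->.
  rewrite big1 ?oppr0// => j _.
  have zE : z = z + (0 : R) *: unitv R (lft j) by rewrite scale0r addr0.
  rewrite {1}zE /pd derive_line (_ : (fun _ => _) = fun=> 0) ?derive_cst ?mulr0//.
  apply/funext => t; rewrite /bcomp F0 ?ffunE// !mxE z0 /= mulr0 addr0//.
apply/ffunP => A; rewrite [RHS]ffunE -/(bcomp F A x).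
pose y := x + (- x 0 ord0) *: unitv R ord0.
have y0 : y 0 ord0 = 0 by rewrite !mxE !eqxx mulr1 subrr.
have [c _] := @mvt_line R n.+1 (bcomp F A) (unitv R ord0) x (- x 0 ord0) (fun=> dff_derivable (hpoly_dff (hF A))).
rewrite -/y -/(pd ord0 (bcomp F A) _) -cE /bcomp (F0 y y0) G0 !ffunE mulr0 sub0r => /eqP.
by rewrite oppr_eq0 => /eqP.
Qed.

Lemma beta_le k j t : (t <= j)%N -> beta R n k t <= (n + 2 * k + 2 * j)%:R.
Proof.
move=> tj; have tR : t%:R <= j%:R :> R by rewrite ler_nat.
have j0 : 0 <= j%:R :> R by []. have k0 : 0 <= k%:R :> R by []. have nR : 0 <= n%:R :> R by [].
by rewrite /beta (natrD _ (n + 2 * k)%N) (natrD _ n) !natrM; case: ifP => _; lra.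
Qed.

Lemma bprod_le k j i : 0 <= bprod R n k j i <= (n + 2 * k + 2 * j)%:R ^+ i.
Proof.
rewrite /bprod; elim: i => [|i /andP[h1 h2]]; first by rewrite big_ord0 expr0 ler01 lexx.
have b0 : 0 <= beta R n k (j - i) by apply: le_trans (beta_ge R n0 _ _).
rewrite big_ord_recr exprSr /= mulr_ge0//= ler_pM// beta_le// leq_subr//.
Qed.

Lemma CK_bound j k P (K : R) x A : mono k P -> 0 <= K ->
  (forall v B, cube 0 1 v -> `|bcomp P B v| <= K) -> cube 0 1 x ->
  `|bcomp (CK j k P) A x| <= expR n%:R * (2 * n%:R * expR 2) ^+ (k + j) * K.
Proof.
move=> mP K0 bP cx.
have cv : cube 0 1 (xvec x) by move=> i; rewrite !mxE; have := cx (lft i); rewrite !mxE.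
have nR : 1 <= n%:R :> R by rewrite ler1n.
rewrite /bcomp /CK sum_ffunE; apply: le_trans (ler_norm_sum _ _ _) _.
(* With N = n + 2k + 2j, the quotient [bprod / i!] is at most [N^i / i!] and hence at most [e^N],
   which is geometric in [k + j]. *)
pose E := expR (n + 2 * k + 2 * j)%:R : R.
apply: (le_trans (y := \sum_(i < j.+1) E * (n%:R ^+ j * K))).
  apply: ler_sum => i _; rewrite ffunE -[_ *: _]/(_ * _) normrM; apply: ler_pM => //; last first.
    apply: le_trans (xmn_bound (j - i) (fun B => bP _ B cv) cv A) _.
    by rewrite ler_wpM2r// ler_weXn2l// leq_subr.
  have /andP[b0 b1] := bprod_le k j i.
  rewrite normrM normf_div (ger0_norm b0) normr_nat normrX.
  apply: (le_trans (y := bprod R n k j i / i`!%:R)).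
    rewrite ler_piMr ?divr_ge0// exprn_ile1//; by have := cx ord0; rewrite mxE subr0.
  rewrite ler_pdivrMr ?ltr0n ?fact_gt0// mulrC; apply: le_trans b1 _.
  exact: expX_fact.
rewrite sumr_const card_ord -[leLHS]mulr_natl.
have -> : E = expR n%:R * expR 2 ^+ (k + j).
  rewrite /E -expRM_natl -expRD; congr expR; rewrite (natrD _ (n + 2 * k)%N) (natrD _ n) !natrM (natrD _ k); ring.
have h1 : (j.+1)%:R <= 2 ^+ (k + j) :> R.
  rewrite -natrX ler_nat; apply: leq_trans (ltn_expl j (ltnSn 1)) _.
  by rewrite leq_exp2l// leq_addl.
have h2 : n%:R ^+ j <= n%:R ^+ (k + j) :> R by rewrite ler_weXn2l// leq_addl.
have e0 : 0 <= expR n%:R * expR 2 ^+ (k + j) :> R by rewrite mulr_ge0 ?exprn_ge0 ?expR_ge0.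
rewrite !exprMn !mulrA ler_wpM2r//.
have -> : j.+1%:R * expR n%:R * expR 2 ^+ (k + j) * n%:R ^+ j =
  (expR n%:R * expR 2 ^+ (k + j)) * (j.+1%:R * n%:R ^+ j) :> R by ring.
have -> : expR n%:R * 2 ^+ (k + j) * n%:R ^+ (k + j) * expR 2 ^+ (k + j) =
  (expR n%:R * expR 2 ^+ (k + j)) * (2 ^+ (k + j) * n%:R ^+ (k + j)) :> R by ring.
by rewrite ler_wpM2l// ler_pM.
Qed.
End CauchyKovalevskaya.

(** * Monogenicity and normalization of X_k^j P *)

Section XMonogenic.
Variables (R : realType) (n : nat).
Hypothesis n2 : (2 <= n)%N.
Let n0 : (0 < n)%N := ltnW n2.
Local Notation flip := (@flip n).
Local Notation lft j := (lift ord0 j : 'I_n.+1).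
Implicit Types (A B C : {set 'I_n}) (P Q q : 'rV[R]_n -> Cl R n) (F : 'rV[R]_(n.+1) -> Cl R n).
Implicit Types (x : 'rV[R]_(n.+1)).

Lemma dffX m (u : 'rV[R]_m -> R) s : dff u -> dff (fun y => u y ^+ s).
Proof.
move=> du; elim: s => [|s IH].
  by rewrite (_ : (fun z => _) = fun=> 1); [exact: dff_cst|apply/funext => y; rewrite expr0].
by under eq_fun do rewrite exprS; exact: dffM.
Qed.

Lemma DvX m (u : 'rV[R]_m -> R) s v y : dff u ->
  'D_v (fun z => u z ^+ s) y = s%:R * u y ^+ s.-1 * 'D_v u y.
Proof.
move=> du; elim: s => [|s IH].
  by rewrite !mul0r (_ : (fun z => _) = fun=> 1) ?DvC//; apply/funext => z; rewrite expr0.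
rewrite (_ : (fun z => _) = fun z : 'rV[R]_m => u z * u z ^+ s); last by apply/funext => z; rewrite exprS.
rewrite (DvM v y du (dffX s du)) IH -natr1.
by case: s {IH} => [|s] /=; rewrite ?expr0 ?exprS; ring.
Qed.

Lemma dff_hgeg m (nu : R) s (Z S : 'rV[R]_m -> R) : dff Z -> dff S -> dff (fun y => hgeg nu s (Z y) (S y)).
Proof.
move=> dZ dS; apply: dff_sum => i.
exact: (dffM (dffM (dff_cst _) (dffX _ (dffM (dff_cst 2) dZ))) (dffX _ dS)).
Qed.

Lemma Dv_hgeg m (nu : R) s (Z S : 'rV[R]_m -> R) v y : dff Z -> dff S ->
  'D_v (fun z => hgeg nu s (Z z) (S z)) y =
  hgeg_z nu s (Z y) (S y) * 'D_v Z y + hgeg_r nu s (Z y) (S y) * 'D_v S y.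
Proof.
move=> dZ dS; have d2 := dffM (@dff_cst R m 2) dZ.
have dt (i : 'I_(s./2).+1) := dffM (dffM (@dff_cst R m (hcoef nu s i)) (dffX (s - 2 * i) d2)) (dffX i dS).
rewrite [LHS](Dv_sum _ _ v y dt) /hgeg_z /hgeg_r !mulr_suml -big_split; apply: eq_bigr => i _ /=.
rewrite (DvM v y (dffM (@dff_cst R m (hcoef nu s i)) (dffX (s - 2 * i) d2)) (dffX i dS)).
rewrite (DvZ _ v y (dffX (s - 2 * i) d2)) (DvX _ v y d2) (DvX _ v y dS) (DvZ 2 v y dZ); ring.
Qed.

Lemma hpoly_hgeg (nu : R) s : hpoly s (fun x => hgeg nu s (x 0 ord0) (r2 x)).
Proof.
apply: hpoly_sum => i _; have sE : ((s - 2 * i) + 2 * i)%N = s by have := ltn_ord i; lia.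
rewrite -[X in hpoly X]sE; apply: hpolyM; last exact: hpoly_r2X.
apply: hpolyZ; under eq_fun do rewrite exprMn; apply: hpolyZ.
exact: hpolyXn.
Qed.

Lemma eucl_sq m (y : 'rV[R]_m) : eucl y ^+ 2 = r2 y.
Proof. by rewrite /eucl sqr_sqrtr// sumr_ge0// => i _; exact: sqr_ge0. Qed.

Lemma r2_xvec x : r2 x = x 0 ord0 ^+ 2 + r2 (xvec x).
Proof. by rewrite /r2 big_ord_recl; congr (_ + _); apply: eq_bigr => j _; rewrite mxE. Qed.

Lemma CRZ (c : R) F C x : dffC F -> CR (fun y => c *: F y) C x = c * CR F C x.
Proof.
move=> dF; rewrite /CR mulrDr mulr_sumr (compZ (fun=> c)) /pd (DvZ _ _ _ (dF C)); congr (_ + _).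
by apply: eq_bigr => j _; rewrite (compZ (fun=> c)) (DvZ _ _ _ (dF _)) mulrCA.
Qed.

Lemma CRD F G C x : dffC F -> dffC G -> CR (fun y => F y + G y) C x = CR F C x + CR G C x.
Proof.
move=> dF dG; rewrite /CR addrACA -big_split compD /pd (DvD _ _ (dF C) (dG C)); congr (_ + _).
by apply: eq_bigr => j _; rewrite compD (DvD _ _ (dF _) (dG _)) mulrDr.
Qed.

Definition XP k j P x : Cl R n := cl_mul (Xjk k j x) (P (xvec x)).

Section Fixed.
Variables (k s : nat) (P : 'rV[R]_n -> Cl R n).
Hypothesis mP : mono k P.
Let nu : R := (n%:R - 1) / 2 + k%:R.
Let kap : R := (n + 2 * k - 1)%:R / (n + 2 * k + s.+1 - 1)%:R.
Let hA x := hgeg nu s.+1 (x 0 ord0) (r2 x).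
Let hB x := kap * hgeg (nu + 1) s (x 0 ord0) (r2 x).

Lemma nuE2 : 2 * nu = (n + 2 * k - 1)%:R.
Proof. by rewrite /nu natrB ?(natrD _ n) ?natrM; [field|lia]. Qed.

(** This is where [2 <= n] enters: for n = 1 and k = 0 the parameter would be 0, and so would the
    Gegenbauer values in the denominators of [mu]. *)
Lemma nu_gt0 : 0 < nu.
Proof. have := nuE2; have : (0:R) < (n + 2 * k - 1)%:R by rewrite ltr0n; lia. by move=> ? ?; lra. Qed.

Lemma kapE : kap = 2 * nu / (2 * nu + s%:R + 1).
Proof.
rewrite /kap nuE2; congr (_ / _); rewrite -[1]/(1%:R) -!natrD; congr (_%:R); lia.
Qed.

Lemma XPE x : XP k s.+1 P x =
  mu R n k s.+1 *: (hA x *: P (xvec x) + hB x *: xm P (xvec x)).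
Proof.
rewrite /XP /Xjk eucl_sq cl_mulZl cl_mulDl !cl_mulZl cl_mul1; congr (_ *: (_ + _ *: _)).
rewrite /hB (_ : (n%:R + 1) / 2 + k%:R = nu + 1 :> R) /hA /kap //.
by rewrite /nu; field.
Qed.

Let dA : dff hA. Proof. exact: hpoly_dff (hpoly_hgeg nu s.+1). Qed.
Let dB : dff hB. Proof. exact: hpoly_dff (hpolyZ kap (hpoly_hgeg (nu + 1) s)). Qed.

Lemma hC_XP : hC (k + s.+1) (XP k s.+1 P).
Proof.
move=> A; rewrite (_ : bcomp _ A = fun x => mu R n k s.+1 * (hA x * bcomp P A (xvec x) + hB x * bcomp (xm P) A (xvec x))); last first.
  by apply/funext => x; rewrite /bcomp XPE !ffunE.
apply: hpolyZ; apply: hpolyD.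
  by rewrite addnC; exact: hpolyM (hpoly_hgeg nu s.+1) (hpoly_xvec (mP.1 A)).
have -> : (k + s.+1 = s + k.+1)%N by lia.
exact: hpolyM (hpolyZ kap (hpoly_hgeg (nu + 1) s)) (hpoly_xvec (hC_xm mP.1 A)).
Qed.

Lemma CR_XP x C : CR (XP k s.+1 P) C x = 0.
Proof.
have hP := mP.1; have hX := hC_xm hP.
have d1 : dffC (fun y : 'rV[R]_n.+1 => hA y *: P (xvec y)).
  by move=> A; rewrite (compZ hA (fun y => P (xvec y))); exact: (dffM dA (hpoly_dff (hpoly_xvec (hP A)))).
have d2 : dffC (fun y : 'rV[R]_n.+1 => hB y *: xm P (xvec y)).
  by move=> A; rewrite (compZ hB (fun y => xm P (xvec y))); exact: (dffM dB (hpoly_dff (hpoly_xvec (hX A)))).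
have d12 : dffC (fun y : 'rV[R]_n.+1 => hA y *: P (xvec y) + hB y *: xm P (xvec y)).
  by move=> A; rewrite compD; exact: dffD (d1 A) (d2 A).
rewrite (_ : XP k s.+1 P = fun y => mu R n k s.+1 *: (hA y *: P (xvec y) + hB y *: xm P (xvec y))); last first.
  by apply/funext => y; exact: XPE.
rewrite (CRZ _ _ _ d12) (CRD _ _ d1 d2) (CR_mul C x dA hP) (CR_mul C x dB hX).
have dr := hpoly_dff (@hpoly_r2 R n.+1).
have dc := @dff_coord R n.+1 ord0.
pose z := x 0 ord0; pose r := r2 x.
have pA i : pd i hA x = hgeg_z nu s.+1 z r * (i == ord0)%:R + hgeg_r nu s.+1 z r * (2 * x 0 i).
  by rewrite /pd (Dv_hgeg _ _ _ x dc dr) Dv_coord unitvE -pd_r2.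
have pB i : pd i hB x = kap * (hgeg_z (nu + 1) s z r * (i == ord0)%:R + hgeg_r (nu + 1) s z r * (2 * x 0 i)).
  rewrite /pd (DvZ kap _ x (dff_hgeg (nu + 1) s dc dr)) (Dv_hgeg _ _ _ x dc dr).
  by rewrite Dv_coord unitvE -pd_r2.
have S1 (c : R) (Q : 'rV[R]_n -> Cl R n) : \sum_(j < n) sg R j C * (c * (2 * x 0 (lft j)) * bcomp Q (flip j C) (xvec x)) =
    2 * c * bcomp (xm Q) C (xvec x).
  by rewrite comp_xm mulr_sumr; apply: eq_bigr => j _; rewrite mxE; ring.
have -> : \sum_(j < n) sg R j C * (pd (lft j) hA x * bcomp P (flip j C) (xvec x)) =
    2 * hgeg_r nu s.+1 z r * bcomp (xm P) C (xvec x).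
  by rewrite -S1; apply: eq_bigr => j _; rewrite pA /= mulr0 add0r.
have -> : \sum_(j < n) sg R j C * (pd (lft j) hB x * bcomp (xm P) (flip j C) (xvec x)) =
    2 * (kap * hgeg_r (nu + 1) s z r) * bcomp (xm (xm P)) C (xvec x).
  by rewrite -S1; apply: eq_bigr => j _; rewrite pB /= mulr0 add0r; ring.
have -> : bcomp (dirac_x P) C (xvec x) = 0 by rewrite /bcomp mP.2 ffunE.
have -> : bcomp (xm (xm P)) C (xvec x) = - (r - z ^+ 2) * bcomp P C (xvec x).
  by rewrite /bcomp xm_xm ffunE -[_ *: _]/(_ * _) /r r2_xvec /z; congr (- _ * _); ring.
have -> : bcomp (dirac_x (xm P)) C (xvec x) = - (2 * nu + 1) * bcomp P C (xvec x).
  rewrite /bcomp (dirac_xm _ hP) (_ : dirac_x P = fun=> 0) ?xm0 ?subr0; last by apply/funext => y; exact: mP.2.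
  by rewrite ffunE -[_ *: _]/(_ * _) nuE2; congr (- _ * _); rewrite natrB ?(natrD _ n) ?natrM; [ring|lia].
rewrite pA pB eqxx !mulr1 mulr0 addr0 -/z /hB -/z -/r.
have nz : 2 * nu + s%:R + 1 != 0 by rewrite gt_eqF// !ltr_wpDr// mulr_gt0// nu_gt0.
have HZ := hgeg_zS nu s z r.
have HE := hgeg_euler (nu + 1) s z r.
have HC := hgeg_contig nu s z r.
(* The coefficient of [x P] is [2 hgeg_r nu (s+1)] plus [kap] times the bracket on the right, so
   this form of the contiguity relation makes it vanish. *)
have Hr : hgeg_r nu s.+1 z r = - (kap / 2) * (hgeg_z (nu + 1) s z r + 2 * z * hgeg_r (nu + 1) s z r).
  rewrite kapE; apply: (mulfI nz); rewrite -[LHS]opprK -mulNr -HC; field.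
  by move: nz; rewrite -addrA.
rewrite HZ Hr; set PC := bcomp P C _; set XC := bcomp (xm P) C _.
have K1 : kap * (2 * nu + s%:R + 1) = 2 * nu by rewrite kapE divfK.
move: (hgeg (nu + 1) s z r) (hgeg_z (nu + 1) s z r) (hgeg_r (nu + 1) s z r) HE => h hz hr HE.
have HE2 : z * hz = s%:R * h - 2 * r * hr by rewrite HE; ring.
(* Only the coefficient of [P] is left. Euler's relation makes it a multiple of
   [2 nu - kap (2 nu + s + 1)], which is 0 by the value of [kap]. *)
transitivity (mu R n k s.+1 * (PC * (2 * nu * h - kap * (z * hz) - 2 * r * kap * hr - kap * (2 * nu + 1) * h))); first by field.
rewrite HE2.
have -> : 2 * nu * h - kap * (s%:R * h - 2 * r * hr) - 2 * r * kap * hr - kap * (2 * nu + 1) * h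
  = (2 * nu - kap * (2 * nu + s%:R + 1)) * h by ring.
by rewrite K1 subrr mul0r !mulr0.
Qed.

Lemma xmn_even l y : xmn (2 * l) P y = ((-1) ^+ l * r2 y ^+ l) *: P y.
Proof.
elim: l => [|l IH]; first by rewrite muln0 !expr0 mulr1 scale1r.
rewrite mulnS; change (xm (xm (xmn (2 * l) P)) y = ((-1) ^+ l.+1 * r2 y ^+ l.+1) *: P y).
rewrite xm_xm IH scalerA !exprS; congr (_ *: _); ring.
Qed.

(** By parity only one of the two Gegenbauer terms survives at [x_0 = 0]. The constant [mu] inverts
    its value, including [kap] in the odd case, and supplies the sign in
    [x^(2l) = (-1)^l |x|^(2l)]. *)
Lemma XP_at0 x : x 0 ord0 = 0 -> XP k s.+1 P x = xmn s.+1 P (xvec x).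
Proof.
move=> x00; rewrite XPE /hA /hB x00 !hgeg_at0.
have rE : r2 x = r2 (xvec x) by rewrite r2_xvec x00 expr0n add0r.
have np1 : 0 < nu + 1 by rewrite addr_gt0// nu_gt0.
have [os|es] := boolP (odd s.+1).
  have es : odd s = false by move: os => /= /negbTE.
  have sE : s = (2 * s./2)%N by have := odd_double_half s; rewrite es; lia.
  rewrite es scale0r add0r scalerA /mu os.
  have -> : (n%:R + 1) / 2 + k%:R = nu + 1 by rewrite /nu; field.
  have -> : (s.+1)./2 = s./2 by lia.
  have g0 := gegenbauer_at0_neq0 s./2 np1.
  have -> : xmn s.+1 P (xvec x) = ((-1) ^+ s./2 * r2 (xvec x) ^+ s./2) *: xm P (xvec x).
    rewrite -xmZ; change (cl_mul (vecCl (xvec x)) (xmn s P (xvec x)) =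
      cl_mul (vecCl (xvec x)) (((-1) ^+ s./2 * r2 (xvec x) ^+ s./2) *: P (xvec x))).
    by congr (cl_mul _ _); rewrite {1}sE xmn_even.
  rewrite rE.
  congr (_ *: _); rewrite -sE /kap.
  have -> : (n + 2 * k + s.+1 - 1 = n + 2 * k + s)%N by lia.
  have a0 : (n + 2 * k - 1)%:R != 0 :> R by rewrite pnatr_eq0; lia.
  have b0 : (n + 2 * k + s)%:R != 0 :> R by rewrite pnatr_eq0; lia.
  rewrite -sE in g0.
  by move: ((n + 2 * k + s)%:R) b0 ((n + 2 * k - 1)%:R) a0 => b b0 a a0; field; rewrite a0 b0 g0.
have os : odd s by move: es; rewrite /= negbK.
have sE : s.+1 = (2 * s.+1./2)%N by have := odd_double_half s.+1; rewrite (negbTE es); lia.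
rewrite /mu (negbTE es) os mulr0 scale0r addr0 scalerA.
have g0 := gegenbauer_at0_neq0 s.+1./2 nu_gt0.
have -> : xmn s.+1 P (xvec x) = xmn (2 * s.+1./2) P (xvec x) by rewrite -sE.
rewrite xmn_even rE -/nu; congr (_ *: _); rewrite -sE in g0.
by field.
Qed.
End Fixed.

(* Both sides are monogenic and agree on [x_0 = 0]. *)
Lemma XP_CK k j P x : mono k P -> XP k j P x = CK j k P x.
Proof.
move=> mP; case: j => [|s].
  by rewrite /XP /= cl_mul1 /CK big_ord1 /bprod big_ord0 fact0 invr1 expr0 !mulr1 scale1r.
apply/eqP; rewrite -subr_eq0; apply/eqP.
pose F x := XP k s.+1 P x + (-1) *: CK s.+1 k P x.
have cE A : bcomp F A = fun y => bcomp (XP k s.+1 P) A y + -1 * bcomp (CK s.+1 k P) A y.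
  by rewrite compD (compZ (fun=> -1)).
have hX := hC_XP s mP; have hK := hC_CK n0 s.+1 mP.1.
have := @CR_unique R n (k + s.+1) F _ _ _ x; rewrite /F scaleN1r; apply.
- by move=> A; rewrite cE; apply: hpolyD (hX A) (hpolyZ _ (hK A)).
- move=> y C; rewrite CRD; [|exact: hC_dffC hX|exact: hC_dffC (hCZ _ hK)].
  by rewrite (CRZ _ _ _ (hC_dffC hK)) (CR_XP s mP) CR_CK// mulr0 addr0.
- by move=> y y0; rewrite XP_at0 ?CK_at0// scaleN1r subrr.
Qed.
End XMonogenic.

(** * Recursive and monomial forms of homogeneous polynomials *)

Section HomPoly.
Variables (R : realType) (n : nat).
Implicit Types (x : 'rV[R]_n) (p : 'rV[R]_n -> R) (P : 'rV[R]_n -> Cl R n).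

Definition monom (b : 'I_n -> nat) x : R := \prod_(j < n) x 0 j ^+ b j.

Lemma hpoly_monom b : hpoly (\sum_(j < n) b j)%N (monom b).
Proof.
rewrite /monom; elim: (index_enum _) => [|j r IH] /=.
  by rewrite big_nil; exists 1; apply/funext => x; rewrite big_nil.
rewrite big_cons (_ : (fun x => _) = fun x => x 0 j ^+ b j * \prod_(i <- r) x 0 i ^+ b i); last first.
  by apply/funext => x; rewrite big_cons.
exact: (hpolyM (hpolyXn R j (b j)) IH).
Qed.

Definition sform k p := exists c : {ffun {ffun 'I_n -> 'I_k.+1} -> R},
  forall x, p x = \sum_(a : {ffun 'I_n -> 'I_k.+1} | (\sum_(j < n) (a j : nat))%N == k)
    monom (fun j => a j) x * c a.

Lemma sform_sum k (I : Type) (r : seq I) (F : I -> 'rV[R]_n -> R) :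
  (forall i, sform k (F i)) -> sform k (fun x => \sum_(i <- r) F i x).
Proof.
move=> hF; elim: r => [|i r [c hc]].
  by exists [ffun=> 0] => x; rewrite big_nil big1// => a _; rewrite ffunE mulr0.
have [d hd] := hF i; exists [ffun a => d a + c a] => x.
rewrite big_cons hc hd -big_split; apply: eq_bigr => a _ /=; by rewrite ffunE mulrDr.
Qed.

Lemma sform_monom k (c : R) (b : 'I_n -> nat) : (\sum_(j < n) b j)%N = k -> sform k (fun x => monom b x * c).
Proof.
move=> bk; pose a0 : {ffun 'I_n -> 'I_k.+1} := [ffun j => inord (b j)].
have aE j : (a0 j : nat) = b j.
  by rewrite ffunE inordK// ltnS -bk (bigD1 j)//= leq_addr.
exists [ffun a => if a == a0 then c else 0] => x.
rewrite (bigD1 a0)/=; last by apply/eqP; rewrite -[RHS]bk; apply: eq_bigr.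
rewrite ffunE eqxx big1 ?addr0 => [|a /andP[_ /negbTE aa]]; last by rewrite ffunE aa mulr0.
by congr (_ * _); apply: eq_bigr => j _; rewrite aE.
Qed.

(** The monomial in front is an accumulator: each variable peeled off [p] moves into the exponent
    [b], until a constant remains. *)
Lemma hpoly_sform k p (b : 'I_n -> nat) : hpoly k p ->
  sform (k + \sum_(j < n) b j)%N (fun x => monom b x * p x).
Proof.
elim: k p b => [p b [c ->]|k IH p b [q hq ->]]; first exact: sform_monom.
rewrite (_ : (fun x => _) = fun x => \sum_(i < n) monom b x * (x 0 i * q i x)); last first.
  by apply/funext => x; rewrite mulr_sumr.
apply: sform_sum => i; pose b' j := (b j + (i == j))%N.
have -> : (k.+1 + \sum_(j < n) b j = k + \sum_(j < n) b' j)%N.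
  rewrite /b' big_split /=.
  have -> : (\sum_(j < n) (i == j) = 1)%N.
    by rewrite (bigD1 i)//= eqxx big1 ?addn0// => j; rewrite eq_sym => /negbTE ->.
  by rewrite addn1 addSnnS.
rewrite (_ : (fun x => _) = fun x => monom b' x * q i x); first exact: (IH (q i) b' (hq i)).
apply/funext => x; rewrite mulrA; congr (_ * _).
rewrite /monom /b' (bigD1 i)//= [in RHS](bigD1 i)//= eqxx addn1 exprS mulrC mulrA; congr (_ * _).
by apply: eq_bigr => j; rewrite eq_sym => /negbTE ->; rewrite addn0.
Qed.

Lemma hom_polyP k P : hom_poly k P <-> hC k P.
Proof.
split=> [[c cE] A|hP].
  rewrite (_ : bcomp P A = fun x => \sum_(a : {ffun 'I_n -> 'I_k.+1} | (\sum_(j < n) (a j : nat))%N == k)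
     c a A * monom (fun j => a j) x).
    by apply: hpoly_sum => a /eqP ak; apply: hpolyZ; rewrite -{1}ak; exact: hpoly_monom.
  apply/funext => x; rewrite /bcomp cE sum_ffunE; apply: eq_bigr => a _.
  by rewrite ffunE -[LHS]/(_ * _) mulrC.
have /choice[c Hc] A : sform k (bcomp P A).
  have := hpoly_sform (fun=> 0%N) (hP A); rewrite big1// addn0.
  rewrite (_ : (fun x => _) = bcomp P A)//; apply/funext => x.
  by rewrite /monom big1 ?mul1r.
exists [ffun a => [ffun A => c A a]] => x; apply/ffunP => A.
rewrite sum_ffunE -/(bcomp P A x) Hc; apply: eq_bigr => a _.
by rewrite ffunE ffunE ffunE.
Qed.

Lemma spherical_monogenicP k P : spherical_monogenic k P <-> mono k P.
Proof. by split=> -[h d]; split=> //; exact/hom_polyP. Qed.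
End HomPoly.

(** * Comparison of the norms *)

Section IteratedIntegral.
Variable R : realType.
Implicit Types (s y : nat -> R) (m : nat).

(* No measurability is needed for monotonicity, as the integral of a nonnegative
   function is a supremum over the simple functions below it. *)
Lemma ge0_integral_mono (f g : R -> \bar R) : (forall x, (0 <= f x)%E) -> (forall x, (f x <= g x)%E) ->
  (\int[@lebesgue_measure R]_(t in setT) f t <= \int[@lebesgue_measure R]_(t in setT) g t)%E.
Proof.
move=> f0 fg; rewrite !ge0_integralTE//; last by move=> x; exact: le_trans (f0 x) (fg x).
apply: ereal_sup_le => _ [h hf <-]; exists h => // x; exact: le_trans (hf x) (fg x).
Qed.

Lemma iint_ge0 m (g : (nat -> R) -> \bar R) : (forall s, (0 <= g s)%E) -> (0 <= iint m g)%E.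
Proof.
elim: m g => [|m IH] g g0 /=; first exact: g0.
by apply: integral_ge0 => t _; apply: IH => s; exact: g0.
Qed.

Lemma iint_mono m (f g : (nat -> R) -> \bar R) : (forall s, (0 <= f s)%E) ->
  (forall s, (f s <= g s)%E) -> (iint m f <= iint m g)%E.
Proof.
elim: m f g => [|m IH] f g f0 fg /=; first exact: fg.
apply: ge0_integral_mono => t; first by apply: iint_ge0 => s; exact: f0.
by apply: IH => s; [exact: f0|exact: fg].
Qed.

(** The indicator of a box, written as a product so that each integration splits off one factor. *)
Definition boxind y (r : R) m s : R := \prod_(i < m) (`|s i - y i| <= r)%R%:R.

Lemma boxind01 y r m s : 0 <= boxind y r m s <= 1.
Proof. by apply/andP; split; [apply: prodr_ge0 => i _; exact: ler0n|apply: prodr_ile1 => i _; rewrite ler0n lern1 leq_b1]. Qed.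

Lemma iint_boxind (c r : R) y m : 0 <= r -> 0 <= c ->
  iint m (fun s => (c * boxind y r m s)%:E) = (c * (2 * r) ^+ m)%:E.
Proof.
move=> r0; elim: m c => [|m IH] c c0 /=; first by rewrite /boxind big_ord0 expr0.
have E t : iint m (fun s => (c * boxind y r m.+1 (fun i => if i == m then t else s i))%:E) =
    ((c * (2 * r) ^+ m)%:E * (\1_(`[y m - r, y m + r]) t)%:E)%E.
  rewrite -EFinM mulrAC -IH ?mulr_ge0//; congr (iint m _); apply/funext => s; congr (_%:E).
  rewrite -mulrA; congr (_ * _); rewrite /boxind big_ord_recr /= eqxx mulrC; congr (_ * _).
    rewrite indicE; congr (_%:R); congr nat_of_bool; apply/idP/idP.
      by rewrite ler_norml => /andP[? ?]; rewrite inE /= in_itv /=; apply/andP; split; lra.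
    by rewrite inE /= in_itv /= ler_norml => /andP[? ?]; apply/andP; split; lra.
  by apply: eq_bigr => i _; rewrite (ltn_eqF (ltn_ord i)).
under eq_integral do rewrite E.
rewrite ge0_integralZl_EFin//.
- rewrite integral_indic// setIT.
  transitivity ((c * (2 * r) ^+ m)%:E * (2 * r)%:E)%E; last by rewrite -EFinM exprSr mulrA.
  congr (_ * _)%E; rewrite [LHS](lebesgue_measure_itv (Interval (BLeft (y m - r)) (BRight (y m + r)))) /= lte_fin; case: ltP => h.
    by rewrite -EFinD; congr (_%:E); ring.
  by rewrite (_ : r = 0) ?mulr0//; lra.
- by apply/measurable_EFinP; exact: measurable_indic.
- by rewrite mulr_ge0// exprn_ge0// mulr_ge0.
Qed.
End IteratedIntegral.

(** * Bounds for the sup norm and for averages over the sphere *)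

Section Norms.
Variables (R : realType) (n : nat).
Hypothesis n2 : (2 <= n)%N.
Let n0 : (0 < n)%N := ltnW n2.
Implicit Types (A : {set 'I_n}) (P : 'rV[R]_n -> Cl R n) (v w : 'rV[R]_n) (a : Cl R n).

Lemma cl_norm_ge0 a : 0 <= cl_norm a. Proof. exact: sqrtr_ge0. Qed.

Lemma cl_norm_sq a : cl_norm a ^+ 2 = \sum_(A : {set 'I_n}) a A ^+ 2.
Proof. by rewrite sqr_sqrtr// sumr_ge0// => A _; exact: sqr_ge0. Qed.

Lemma cl_norm_comp_sq a A : a A ^+ 2 <= cl_norm a ^+ 2.
Proof. by rewrite cl_norm_sq (bigD1 A)//= lerDl sumr_ge0// => B _; exact: sqr_ge0. Qed.

Lemma cl_norm_comp a A : `|a A| <= cl_norm a.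
Proof. by rewrite -ler_sqr ?nnegrE ?cl_norm_ge0 ?normr_ge0// real_normK ?num_real// cl_norm_comp_sq. Qed.

Lemma cl_norm_le a (K : R) : (forall A, `|a A| <= K) -> cl_norm a <= #|{set 'I_n}|%:R * K.
Proof.
move=> aK; have K0 : 0 <= K := le_trans (normr_ge0 _) (aK finset.set0).
rewrite -ler_sqr ?nnegrE ?cl_norm_ge0 ?mulr_ge0// cl_norm_sq.
apply: (@le_trans _ _ (\sum_(A : {set 'I_n}) K ^+ 2)).
  by apply: ler_sum => A _; rewrite -real_normK ?num_real// ler_sqr ?nnegrE.
rewrite sumr_const -[X in X <= _]mulr_natl exprMn ler_wpM2r ?sqr_ge0// -natrX ler_nat.
by case: #|_| => // k; rewrite expnS expn1 leq_pmulr.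
Qed.

Lemma eucl_ge0 m (v : 'rV[R]_m) : 0 <= eucl v. Proof. exact: sqrtr_ge0. Qed.

Lemma coord_eucl m (v : 'rV[R]_m) i : `|v 0 i| <= eucl v.
Proof.
rewrite -ler_sqr ?nnegrE ?eucl_ge0 ?normr_ge0// real_normK ?num_real// eucl_sq /r2 (bigD1 i)//= lerDl.
by rewrite sumr_ge0// => j _; exact: sqr_ge0.
Qed.

Lemma euclZ m (t : R) (v : 'rV[R]_m) : 0 <= t -> eucl (t *: v) = t * eucl v.
Proof.
move=> t0; rewrite /eucl; under eq_bigr do rewrite mxE exprMn.
by rewrite -mulr_sumr sqrtrM ?sqr_ge0// sqrtr_sqr ger0_norm.
Qed.

Lemma eucl_eq0 m (v : 'rV[R]_m) : eucl v = 0 -> v = 0.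
Proof.
move=> v0; apply/rowP => i; rewrite mxE; apply/eqP; rewrite -normr_le0 -v0; exact: coord_eucl.
Qed.

Lemma eucl_cube m (v : 'rV[R]_m) (r : R) : 0 <= r -> cube 0 r v -> eucl v <= m%:R * r.
Proof.
move=> r0 cv; rewrite -ler_sqr ?nnegrE ?eucl_ge0 ?mulr_ge0// eucl_sq /r2.
apply: (@le_trans _ _ (m%:R * r ^+ 2)).
  have -> : m%:R * r ^+ 2 = \sum_(i < m) r ^+ 2 by rewrite sumr_const card_ord mulr_natl.
  apply: ler_sum => i _; have := cv i; rewrite mxE subr0 => h.
  by rewrite -real_normK ?num_real// ler_sqr ?nnegrE.
rewrite exprMn ler_wpM2r ?sqr_ge0// -natrX ler_nat; case: (m) => // k.
by rewrite expnS expn1 leq_pmulr.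
Qed.

Lemma eucl1_cube m (v : 'rV[R]_m) : eucl v <= 1 -> cube 0 1 v.
Proof. by move=> v1 i; rewrite mxE subr0; exact: le_trans (coord_eucl _ _) v1. Qed.

Lemma eucl_normalize_le m (v : 'rV[R]_m) : eucl ((eucl v)^-1 *: v) <= 1.
Proof.
rewrite euclZ ?invr_ge0 ?eucl_ge0//; have [->|h] := eqVneq (eucl v) 0; first by rewrite mulr0.
by rewrite mulVf.
Qed.

Lemma polar v : exists2 w, eucl w = 1 & v = eucl v *: w.
Proof.
have [v0|h] := eqVneq (eucl v) 0; last first.
  exists ((eucl v)^-1 *: v); last by rewrite scalerA divff// scale1r.
  by rewrite euclZ ?invr_ge0 ?eucl_ge0// mulVf.
exists (unitv R (Ordinal n0)); last by rewrite v0 scale0r; exact: eucl_eq0.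
rewrite /eucl (bigD1 (Ordinal n0))//= unitvE eqxx big1 ?addr0 ?expr1n ?sqrtr1//.
by move=> i /negbTE ni; rewrite unitvE eq_sym ni expr0n.
Qed.

Lemma hpoly_max m k (p : 'rV[R]_m -> R) : hpoly k p ->
  exists2 c, cube 0 1 c & forall y, cube 0 1 y -> `|p y| <= `|p c|.
Proof.
move=> hp; have cp := dff_continuous (hpoly_dff hp).
have [|||c cc H] := @EVT_max_rV R m (fun y => `|p y|) (cube 0 1).
- by exists 0 => i; rewrite subrr normr0.
- exact: cube_compact.
- apply: continuous_subspaceT => y; exact: (cvg_norm (cp y)).
by exists c; [move: cc; rewrite inE|move=> y cy; apply: H; rewrite inE].
Qed.

Lemma unit_vector_exists : exists w : 'rV[R]_n, eucl w = 1.
Proof. by have [w w1 _] := polar 0; exists w. Qed.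

Lemma supnorm_le P (K : R) : (forall A v, cube 0 1 v -> `|bcomp P A v| <= K) ->
  supnorm P <= #|{set 'I_n}|%:R * K.
Proof.
move=> bP; apply: ge_sup.
  by have [w w1] := unit_vector_exists; exists (cl_norm (P w)), w.
move=> _ [w /= w1 <-]; apply: cl_norm_le => A; apply: bP; apply: eucl1_cube; by rewrite w1.
Qed.

Lemma hC_bounded k P : hC k P -> exists2 K : R, 0 <= K & forall A v, cube 0 1 v -> `|bcomp P A v| <= K.
Proof.
move=> hP; have /choice[c Hc] A : exists c, forall v, cube 0 1 v -> `|bcomp P A v| <= `|bcomp P A c|.
  by have [c _ H] := hpoly_max (hP A); exists c.
exists (\sum_A `|bcomp P A (c A)|) => [|A v cv]; first exact: sumr_ge0.
by apply: (le_trans (Hc A v cv)); rewrite (bigD1 A)//= lerDl sumr_ge0.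
Qed.

Lemma supnorm_ge k P A w : hC k P -> eucl w = 1 -> `|bcomp P A w| <= supnorm P.
Proof.
move=> hP w1; have [K K0 bP] := hC_bounded hP.
apply: (le_trans (cl_norm_comp (P w) A)).
apply: (@sup_upper_bound R [set cl_norm (P w) | w in [set w : 'rV[R]_n | eucl w = 1]]); last by exists w.
  split; first by exists (cl_norm (P w)), w.
  exists (#|{set 'I_n}|%:R * K) => _ [z /= z1 <-]; apply: cl_norm_le => B; apply: bP.
by apply: eucl1_cube; rewrite z1.
Qed.

Lemma supnorm_ge_cube k P A v : hC k P -> cube 0 1 v -> `|bcomp P A v| <= n%:R ^+ k * supnorm P.
Proof.
move=> hP cv; have [w w1 ->] := polar v.
rewrite (hpoly_hom _ _ (hP A)) normrM normrX (ger0_norm (eucl_ge0 v)).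
apply: ler_pM => //; first by rewrite exprn_ge0// eucl_ge0.
  by rewrite lerXn2r ?nnegrE ?eucl_ge0//; have := eucl_cube ler01 cv; rewrite mulr1.
exact: supnorm_ge w1.
Qed.

Lemma boxind_cases (y s : nat -> R) (r : R) m :
  (forall i : 'I_m, `|s i - y i| <= r) /\ boxind y r m s = 1 \/ boxind y r m s = 0.
Proof.
have [h|] := boolP [forall i : 'I_m, `|s i - y i| <= r].
  left; split; first exact/forallP.
  by rewrite /boxind big1// => i _; move/forallP: h => ->.
rewrite negb_forall => /existsP[i ni]; right.
by rewrite /boxind (bigD1 i)//= (negbTE ni) mul0r.
Qed.

Lemma boxind1 (y s : nat -> R) (r : R) m : (forall i : 'I_m, `|s i - y i| <= r) -> boxind y r m s = 1.
Proof. by move=> h; rewrite /boxind big1// => i _; rewrite h. Qed.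

Section Sphere.
Variables (g : 'rV[R]_n -> R) (M : R).
(** The bound is on the closed ball rather than the sphere because normalizing the zero vector gives
    0. *)
Hypothesis gM : forall w, eucl w <= 1 -> 0 <= g w <= M.
(** Comparison with box indicators makes both integrals finite, so that [fine] loses nothing, and
    the denominator positive: the ball contains the cube of half-side 1/n and lies in that of
    half-side 1. *)
Let num := iint n (fun s => (((eucl (row_of n s) <= 1)%R)%:R * g ((eucl (row_of n s))^-1 *: row_of n s))%:E).
Let den := iint n (fun s => (((eucl (row_of n s) <= 1)%R)%:R : R)%:E).

Let M0 : 0 <= M.
Proof. have [w w1] := unit_vector_exists; have /andP[? ?] : 0 <= g w <= M by apply: gM; rewrite w1.
exact: (@le_trans _ _ (g w)). Qed.

Let ball_le (s : nat -> R) : ((eucl (row_of n s) <= 1)%R)%:R <= boxind (fun=> 0) 1 n s :> R.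
Proof.
have [h|h] := leP (eucl (row_of n s)) 1; last by have /andP[] := boxind01 (fun=> 0) 1 n s.
rewrite boxind1// => i; rewrite subr0; apply: le_trans h.
by have := coord_eucl (row_of n s) i; rewrite mxE.
Qed.

Let box_le (s : nat -> R) : boxind (fun=> 0) n%:R^-1 n s <= ((eucl (row_of n s) <= 1)%R)%:R :> R.
Proof.
have [[h ->]|->] := boxind_cases (fun=> 0) s n%:R^-1 n; last exact: ler0n.
rewrite (_ : eucl _ <= 1)//; have -> : 1 = n%:R * n%:R^-1 :> R by rewrite divff// pnatr_eq0 -lt0n.
apply: eucl_cube => [|i]; first by rewrite invr_ge0.
by rewrite !mxE; exact: h.
Qed.

Let num_ge0 : (0 <= num)%E.
Proof.
by apply: iint_ge0 => s; rewrite lee_fin mulr_ge0//; have /andP[] := gM (eucl_normalize_le (row_of n s)).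
Qed.

Let num_le : (num <= (M * 2 ^+ n)%:E)%E.
Proof.
rewrite -[2]mulr1 -(iint_boxind (fun=> 0) n ler01 M0); apply: iint_mono => s.
  by rewrite lee_fin mulr_ge0//; have /andP[] := gM (eucl_normalize_le (row_of n s)).
by rewrite lee_fin mulrC ler_pM//; have /andP[] := gM (eucl_normalize_le (row_of n s)).
Qed.

Let den_le : (den <= (2 ^+ n)%:E)%E.
Proof.
have -> : (2 ^+ n : R) = 1 * (2 * 1) ^+ n by rewrite mul1r mulr1.
rewrite -(iint_boxind (fun=> 0) n ler01 ler01); apply: iint_mono => s; rewrite lee_fin//.
by rewrite mul1r.
Qed.

Let den_ge : (((2 * n%:R^-1) ^+ n)%:E <= den)%E.
Proof.
have n1 : 0 <= n%:R^-1 :> R by rewrite invr_ge0.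
rewrite -[X in X%:E]mul1r -(iint_boxind (fun=> 0) n n1 ler01); apply: iint_mono => s; rewrite lee_fin mul1r//.
by have /andP[] := boxind01 (fun=> 0) n%:R^-1 n s.
Qed.

Let numE : exists2 a : R, num = a%:E & 0 <= a <= M * 2 ^+ n.
Proof. by move: num_ge0 num_le; case: num => [a| |]// a0 a1; exists a => //; rewrite -!lee_fin a0 a1. Qed.

Let denE : exists2 a : R, den = a%:E & (2 * n%:R^-1) ^+ n <= a <= 2 ^+ n.
Proof. by move: den_ge den_le; case: den => [a| |]// a0 a1; exists a => //; rewrite -!lee_fin a0 a1. Qed.

Lemma sphere_avg_ge0 : 0 <= sphere_avg g.
Proof.
rewrite /sphere_avg -/num -/den; have [a -> /andP[a0 _]] := numE; have [b -> /andP[b0 _]] := denE.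
by rewrite divr_ge0//; apply: le_trans b0; rewrite exprn_ge0// mulr_ge0// invr_ge0.
Qed.

Lemma sphere_avg_le : sphere_avg g <= M * n%:R ^+ n.
Proof.
rewrite /sphere_avg -/num -/den; have [a -> /andP[_ a1]] := numE; have [b -> /andP[b0 _]] := denE.
have p0 : 0 < (2 * n%:R^-1) ^+ n :> R by rewrite exprn_gt0// mulr_gt0// invr_gt0 ltr0n.
rewrite /= ler_pdivrMr ?(lt_le_trans p0)//; apply: (le_trans a1).
rewrite -mulrA ler_wpM2l//; apply: (@le_trans _ _ (n%:R ^+ n * (2 * n%:R^-1) ^+ n)); last by rewrite ler_wpM2l ?exprn_ge0.
by rewrite -exprMn mulrCA divff ?mulr1// pnatr_eq0 -lt0n.
Qed.

Lemma sphere_avg_ge (y : nat -> R) (r c : R) : 0 <= r -> 0 <= c ->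
  (forall v : 'rV[R]_n, (forall i, `|v 0 i - y i| <= r) -> eucl v <= 1 /\ c <= g ((eucl v)^-1 *: v)) ->
  c * (2 * r) ^+ n <= sphere_avg g * 2 ^+ n.
Proof.
move=> r0 c0 H; have g0 v : 0 <= g ((eucl v)^-1 *: v) by have /andP[] := gM (eucl_normalize_le v).
have : ((c * (2 * r) ^+ n)%:E <= num)%E.
  rewrite -(iint_boxind y n r0 c0); apply: iint_mono => s; rewrite lee_fin.
    by rewrite mulr_ge0//; have /andP[] := boxind01 y r n s.
  have [[h ->]|->] := boxind_cases y s r n; last by rewrite mulr0 mulr_ge0.
  have [|e1 cg] := H (row_of n s); first by move=> i; rewrite mxE; exact: h.
  by rewrite e1 mulr1 mul1r.
rewrite /sphere_avg -/num -/den; have [a -> /andP[a0 _]] := numE; have [b -> /andP[b0 b1]] := denE.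
rewrite lee_fin => h; apply: (le_trans h) => /=.
have bp : 0 < b by apply: lt_le_trans b0; rewrite exprn_gt0// mulr_gt0// invr_gt0 ltr0n.
by rewrite mulrAC ler_pdivlMr// ler_wpM2l.
Qed.
End Sphere.
End Norms.

(** * Equivalence of the norms up to geometric factors *)

Section NormEquiv.
Variables (R : realType) (n : nat).
Hypothesis n2 : (2 <= n)%N.
Let n0 : (0 < n)%N := ltnW n2.
Implicit Types (A : {set 'I_n}) (P : 'rV[R]_n -> Cl R n) (v w : 'rV[R]_n).

Definition emb v : 'rV[R]_n.+1 := \row_j (if unlift ord0 j is Some i then v 0 i else 0).

Lemma xvec_emb v : xvec (emb v) = v.
Proof. by apply/rowP => j; rewrite !mxE liftK. Qed.

Lemma emb_ord0 v : emb v 0 ord0 = 0.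
Proof. by rewrite mxE unlift_none. Qed.

Lemma emb_cube (r : R) v : cube 0 r v -> cube 0 r (emb v).
Proof.
move=> cv i; rewrite !mxE; case: unliftP => [j _|_]; first by have := cv j; rewrite !mxE.
by rewrite subrr normr0; apply: le_trans (cv (Ordinal n0)).
Qed.

Lemma xvec_cube y (r : R) (z : 'rV[R]_n.+1) : cube y r z -> cube (xvec y) r (xvec z).
Proof. by move=> cz i; rewrite !mxE; exact: cz. Qed.

(** As a function of [n + 1] variables that ignores [x_0], [P] is its own extension [CK 0 k P],
    hence monogenic and so harmonic. *)
Lemma mono_harm k P A : mono k P -> harmfun (fun z => bcomp P A (xvec z)).
Proof.
move=> mP; pose G (z : 'rV[R]_n.+1) := P (xvec z).
have GE : G = CK 0 k P.
  apply/funext => z; rewrite /CK big_ord1 /bprod big_ord0 fact0 invr1 expr0 !mulr1 scale1r.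
  by [].
apply: (@CR_harm_pol R n G) => [B|z C].
  by apply: (@pol_hpoly _ _ k); exact: (hpoly_xvec (mP.1 B)).
by rewrite GE CR_CK.
Qed.

Lemma mono_grad k P A (S r : R) c v : mono k P -> 0 <= r <= 1 ->
  (forall w, cube 0 1 w -> `|bcomp P A w| <= S) -> cube 0 1 c ->
  (forall i, `|v 0 i - c 0 i| <= r) ->
  `|bcomp P A v - bcomp P A c| <= r * (n.+1%:R ^+ 2 * (3 ^+ k * S)).
Proof.
move=> mP /andP[r0 r1] bS cc cv; pose F (z : 'rV[R]_n.+1) := bcomp P A (xvec z).
have hF : hpoly k F by exact: (hpoly_xvec (mP.1 A)).
have [rE|rn] := eqVneq r 0.
  rewrite rE mul0r (_ : v = c) ?subrr ?normr0//; apply/rowP => i.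
  by apply/eqP; rewrite -subr_eq0 -normr_le0; have := cv i; rewrite rE.
have rp : 0 < r by rewrite lt_def rn r0.
pose w := r^-1 *: (v - c).
have vE : v = xvec (emb c + r *: emb w).
  apply/rowP => j; rewrite !mxE liftK !mxE mulrA divff// mul1r; ring.
have w1 : cube 0 1 w.
  move=> i; rewrite !mxE subr0 normrM ger0_norm ?invr_ge0// mulrC ler_pdivrMr// mul1r; exact: cv.
have [s sr E] := @mvt_line R n.+1 F (emb w) (emb c) r (fun s => dff_derivable (hpoly_dff hF)).
rewrite {1}vE -{2}(xvec_emb c) -!/(F _) E normrM ger0_norm//; apply: ler_wpM2l => //.
rewrite -[_ ^+ 2]divr1; apply: Dv_bound => //.
- exact: (pol_hpoly hF).
- exact: mono_harm mP.
- by move=> i; have := emb_cube w1 i; rewrite [(0 : 'rV_n.+1) _ _]mxE subr0.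
(* A coordinate of [c], a displacement along the segment and the radius of the gradient estimate are
   at most 1 each, so [z] lies in the cube of half-side 3. *)
move=> z cz; apply: (hpoly_cube_scale hF) => //.
  by move=> y cy; apply: bS; have := xvec_cube cy; rewrite (_ : xvec 0 = 0)//; apply/rowP => i; rewrite !mxE.
move=> i; have zE : (emb c + s *: emb w) 0 i = emb c 0 i + s * emb w 0 i by rewrite mxE [X in _ + X]mxE.
have h1 : `|emb w 0 i| <= 1 by have := emb_cube w1 i; rewrite [X in _ - X]mxE subr0.
have h2 : `|emb c 0 i| <= 1 by have := emb_cube cc i; rewrite [X in _ - X]mxE subr0.
have h3 := cz i; rewrite zE in h3; rewrite [X in _ - X]mxE subr0.
have h4 : `|s * emb w 0 i| <= 1 by rewrite normrM -[1]mulr1 ler_pM// (le_trans sr)// ger0_norm.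
have -> : z 0 i = (z 0 i - (emb c 0 i + s * emb w 0 i)) + emb c 0 i + s * emb w 0 i by ring.
apply: (le_trans (ler_normD _ _)); have := ler_normD (z 0 i - (emb c 0 i + s * emb w 0 i)) (emb c 0 i); lra.
Qed.

Lemma L2norm_sq k P : hC k P -> L2norm P ^+ 2 = sphere_avg (fun w => cl_norm (P w) ^+ 2) /\
  exists M, forall w, eucl w <= 1 -> 0 <= cl_norm (P w) ^+ 2 <= M.
Proof.
move=> hP; have [K K0 bP] := hC_bounded hP.
have H w : eucl w <= 1 -> 0 <= cl_norm (P w) ^+ 2 <= (#|{set 'I_n}|%:R * K) ^+ 2.
  move=> w1; rewrite sqr_ge0 lerXn2r ?nnegrE ?cl_norm_ge0 ?mulr_ge0//.
  by apply: cl_norm_le => A; apply: bP; exact: eucl1_cube.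
by split; [rewrite sqr_sqrtr//; exact: sphere_avg_ge0 H|eexists; exact: H].
Qed.

Lemma L2norm_le k P (K : R) : hC k P -> (forall A v, cube 0 1 v -> `|bcomp P A v| <= K) ->
  L2norm P <= #|{set 'I_n}|%:R * K * n%:R ^+ n.
Proof.
move=> hP bP; have K0 : 0 <= K.
  by apply: le_trans (bP finset.set0 0 _) => // i; rewrite subrr normr0.
rewrite -ler_sqr ?nnegrE ?sqrtr_ge0 ?mulr_ge0 ?exprn_ge0// (L2norm_sq hP).1.
apply: (@le_trans _ _ ((#|{set 'I_n}|%:R * K) ^+ 2 * n%:R ^+ n)).
  apply: (sphere_avg_le n2) => w w1; rewrite sqr_ge0 lerXn2r ?nnegrE ?cl_norm_ge0 ?mulr_ge0//.
  by apply: cl_norm_le => A; apply: bP; exact: eucl1_cube.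
rewrite [leRHS]exprMn ler_wpM2l ?sqr_ge0// -exprM ler_weXn2l ?ler1n//; lia.
Qed.

(* Around a maximum point of [|P_A|] on the unit cube, the gradient estimate
   gives a small cube where [|P_A|] is at least half the maximum; after scaling
   by [1 / (2 n)] this cube lies in the unit ball. *)
Lemma L2norm_ge k P A v : mono k P -> cube 0 1 v ->
  bcomp P A v ^+ 2 <= (4 * (4 * n%:R * n.+1%:R ^+ 2) ^+ n) * ((2 * n%:R) ^+ 2 * 3 ^+ n) ^+ k * L2norm P ^+ 2.
Proof.
move=> mP cv; have [c cc bc] := hpoly_max (mP.1 A).
set S := `|bcomp P A c|.
have [E [M bM]] := L2norm_sq mP.1; rewrite E.
have nR : (2 : R) <= n%:R by rewrite ler_nat.
have nn : (n%:R : R) != 0 by rewrite pnatr_eq0 -lt0n.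
have n2R : 0 < 2 * n%:R :> R by lra.
have c1 : 1 <= (n.+1%:R ^+ 2 * 3 ^+ k) :> R.
  by rewrite -[X in X <= _]mulr1 ler_pM ?exprn_ege1 ?ler1n.
set d := n.+1%:R ^+ 2 * 3 ^+ k in c1.
have d0 : 0 < d by lra.
(* By [mono_grad] the value changes by at most [r d S = S / 2] within distance [r] of the maximum
   point. *)
pose r : R := (2 * d)^-1.
have r0 : 0 <= r by rewrite invr_ge0; lra.
have r1 : r <= 1 by rewrite invf_le1; lra.
(* The variables of the iterated integral are indexed by all naturals; the centre [c / (2 n)] is
   continued by 0. *)
pose y i : R := if insub i is Some j then c 0 j / (2 * n%:R) else 0.
have yE (j : 'I_n) : y j = c 0 j / (2 * n%:R) by rewrite /y valK.
have H : ((2 * n%:R) ^- k * (S / 2)) ^+ 2 * (2 * (r / (2 * n%:R))) ^+ n <=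
    sphere_avg (fun w => cl_norm (P w) ^+ 2) * 2 ^+ n.
  apply: (sphere_avg_ge n2 bM (y := y)) => [||u bu].
  - by rewrite divr_ge0// ltW.
  - exact: sqr_ge0.
  have bu2 i : `|((2 * n%:R) *: u) 0 i - c 0 i| <= r.
    have := bu i; rewrite yE mxE.
    have -> : u 0 i - c 0 i / (2 * n%:R) = (2 * n%:R * u 0 i - c 0 i) / (2 * n%:R) by field.
    by rewrite normrM normfV (ger0_norm (ltW n2R)) ler_pM2r ?invr_gt0.
  have u1 : eucl u <= 1.
    have -> : (1 : R) = n%:R * n%:R^-1 by rewrite divff.
    apply: eucl_cube; first by rewrite invr_ge0; lra.
    move=> i; rewrite mxE subr0; have := bu2 i; rewrite mxE => h.
    have := cc i; rewrite mxE subr0 => hc.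
    have hh : `|2 * n%:R * u 0 i| <= 2.
      have -> : 2 * n%:R * u 0 i = (2 * n%:R * u 0 i - c 0 i) + c 0 i by ring.
      by apply: (le_trans (ler_normD _ _)); lra.
    move: hh; rewrite normrM (ger0_norm (ltW n2R)) => hh.
    rewrite -(ler_pM2l n2R) (_ : 2 * n%:R * n%:R^-1 = 2)//; by field.
  split=> //; have G := mono_grad mP (introT andP (conj r0 r1)) bc cc bu2.
  have rd : r * (n.+1%:R ^+ 2 * (3 ^+ k * S)) = S / 2.
    by rewrite mulrA mulrA -(mulrA r) -/d /r; field; rewrite gt_eqF.
  have G2 : S / 2 <= `|bcomp P A ((2 * n%:R) *: u)|.
    have := lerB_dist (bcomp P A c) (bcomp P A ((2 * n%:R) *: u)).
    rewrite distrC -/S; move: G; rewrite rd; lra.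
  have G3 : (2 * n%:R) ^- k * (S / 2) <= `|bcomp P A u|.
    move: G2; rewrite (hpoly_hom _ _ (mP.1 A)) normrM normrX (ger0_norm (ltW n2R)).
    by move=> G2; rewrite mulrC ler_pdivrMr ?exprn_gt0// [leRHS]mulrC.
  apply: le_trans (cl_norm_comp_sq _ A).
  rewrite -[X in _ <= X]real_normK ?num_real// lerXn2r ?nnegrE//.
    by rewrite mulr_ge0 ?invr_ge0 ?exprn_ge0 ?(ltW n2R)// divr_ge0// /S normr_ge0.
  apply: (le_trans G3); have [u0|un] := eqVneq (eucl u) 0.
    by rewrite (eucl_eq0 u0) scaler0.
  have uE : u = eucl u *: ((eucl u)^-1 *: u) by rewrite scalerA divff// scale1r.
  rewrite {1}uE (hpoly_hom _ _ (mP.1 A)) normrM normrX (ger0_norm (eucl_ge0 u)).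
  rewrite -/(bcomp P A _) ler_piMl// exprn_ile1 ?eucl_ge0//.
apply: (@le_trans _ _ (S ^+ 2)).
  by rewrite -[X in X <= _]real_normK ?num_real// lerXn2r ?nnegrE ?normr_ge0//; exact: bc.
set Q := sphere_avg _ in H *.
set a := (2 * n%:R) ^+ k in H; set e := 2 * (r / (2 * n%:R)) in H.
have a0 : a != 0 by rewrite expf_neq0// mulf_neq0.
have ef : e ^+ n * (2 * n%:R * d) ^+ n = 1.
  by rewrite -exprMn /e /r (_ : _ * _ = 1) ?expr1n//; field; rewrite nn gt_eqF.
have SE : S ^+ 2 = (a^-1 * (S / 2)) ^+ 2 * e ^+ n * (4 * a ^+ 2 * (2 * n%:R * d) ^+ n).
  transitivity (S ^+ 2 * (e ^+ n * (2 * n%:R * d) ^+ n)); first by rewrite ef mulr1.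
  by move: (e ^+ n) ((2 * n%:R * d) ^+ n) => E1 E2; field.
have -> : 4 * (4 * n%:R * n.+1%:R ^+ 2) ^+ n * ((2 * n%:R) ^+ 2 * 3 ^+ n) ^+ k * Q =
    (Q * 2 ^+ n) * (4 * a ^+ 2 * (2 * n%:R * d) ^+ n).
  have : (4 * n%:R * n.+1%:R ^+ 2) ^+ n * (3 ^+ n) ^+ k = 2 ^+ n * (2 * n%:R * d) ^+ n :> R.
    by rewrite -exprM mulnC exprM -!exprMn /d; congr (_ ^+ n); ring.
  have aE : ((2 * n%:R) ^+ 2) ^+ k = a ^+ 2 by rewrite /a -!exprM mulnC.
  rewrite (exprMn k) aE.
  move: ((4 * n%:R * n.+1%:R ^+ 2) ^+ n) ((3 ^+ n) ^+ k) (2 ^+ n) ((2 * n%:R * d) ^+ n) => X1 X2 X3 X4 HX.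
  transitivity (4 * (X1 * X2) * a ^+ 2 * Q); [ring|rewrite HX; ring].
rewrite SE ler_wpM2r// mulr_ge0 ?mulr_ge0 ?sqr_ge0// exprn_ge0// mulr_ge0// ltW//.
Qed.

Lemma sph_norm_ge0 nm k P : hC k P -> 0 <= sph_normf nm P.
Proof.
move=> hP; case: nm => /=; first exact: sqrtr_ge0.
have [w w1] := unit_vector_exists R n2.
by have := supnorm_ge finset.set0 hP w1; apply: le_trans.
Qed.

Lemma sph_norm_equiv nm : exists2 C : R, 1 <= C & forall k P, mono k P ->
  (forall A v, cube 0 1 v -> `|bcomp P A v| <= C ^+ k.+1 * sph_normf nm P) /\
  (forall K, (forall A v, cube 0 1 v -> `|bcomp P A v| <= K) -> sph_normf nm P <= C * K).
Proof.
have n1 : 1 <= n%:R :> R by rewrite ler1n.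
case: nm => /=; last first.
  exists (1 + n%:R + #|{set 'I_n}|%:R) => [|k P mP]; first by rewrite -addrA lerDl addr_ge0.
  have N0 := sph_norm_ge0 NormSup mP.1; split=> [A v cv|K bP].
    apply: (le_trans (supnorm_ge_cube n2 A mP.1 cv)); rewrite ler_wpM2r//.
    apply: (@le_trans _ _ ((1 + n%:R + #|{set 'I_n}|%:R) ^+ k)).
      by rewrite lerXn2r ?nnegrE ?addr_ge0// addrAC lerDr addr_ge0.
    by apply: ler_weXn2l; rewrite // -addrA lerDl addr_ge0.
  have K0 : 0 <= K by apply: le_trans (bP finset.set0 0 _) => // i; rewrite subrr normr0.
  by apply: (le_trans (supnorm_le n2 bP)); rewrite ler_wpM2r//; lra.
pose C1 : R := 4 * (4 * n%:R * n.+1%:R ^+ 2) ^+ n.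
pose C2 : R := (2 * n%:R) ^+ 2 * 3 ^+ n.
pose C3 : R := #|{set 'I_n}|%:R * n%:R ^+ n.
have c1 : 0 <= C1 by rewrite mulr_ge0// exprn_ge0// mulr_ge0// ?mulr_ge0// sqr_ge0.
have c2 : 0 <= C2 by rewrite mulr_ge0 ?sqr_ge0// exprn_ge0.
have c3 : 0 <= C3 by rewrite mulr_ge0// exprn_ge0.
exists (1 + C1 + C2 + C3) => [|k P mP]; first by lra.
set C := 1 + C1 + C2 + C3; have C1' : 1 <= C by rewrite /C; lra.
have N0 := sph_norm_ge0 NormL2 mP.1; rewrite /= in N0; split=> [A v cv|K bP].
  have Ck : 1 <= C ^+ k.+1 by exact: exprn_ege1.
  rewrite -ler_sqr ?nnegrE ?mulr_ge0// ?(le_trans ler01)// real_normK ?num_real//.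
  apply: (le_trans (L2norm_ge A mP cv)); rewrite -/C1 -/C2 [leRHS]exprMn ler_wpM2r ?sqr_ge0//.
  apply: (@le_trans _ _ (C ^+ k.+1)); last by rewrite expr2 ler_peMl// (le_trans ler01).
  rewrite exprS; apply: ler_pM => //; [exact: exprn_ge0|rewrite /C; lra|].
  by rewrite lerXn2r ?nnegrE//; rewrite /C; lra.
have K0 : 0 <= K by apply: le_trans (bP finset.set0 0 _) => // i; rewrite subrr normr0.
apply: (le_trans (L2norm_le mP.1 bP)); rewrite mulrAC -/C3 ler_wpM2r// /C; lra.
Qed.

(** The decay condition freed of roots and of the choice of norm. Any geometric loss can be absorbed
    by shrinking [e]. *)
Definition decays (P : nat -> nat -> 'rV[R]_n -> Cl R n) := forall e : R, 0 < e ->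
  exists2 K : R, 0 <= K & forall k j A v, cube 0 1 v -> `|bcomp (P k j) A v| <= K * e ^+ (j + k).

Lemma root_decayP nm (P : nat -> nat -> 'rV[R]_n -> Cl R n) : (forall k j, mono k (P k j)) ->
  root_decay nm P <-> decays P.
Proof.
move=> mP; have [C C1 HC] := sph_norm_equiv nm.
have C0 : 0 < C by lra.
split=> [D e e0|D e e0].
  (* The division by [C] pays for the factor [C ^+ k.+1] of the norm comparison, up to a single
     [C]. *)
  have [N HN] := D (e / C) (divr_gt0 e0 C0).
  have /choice[B HB] kj : exists B : R, 0 <= B /\ forall A v, cube 0 1 v -> `|bcomp (P kj.1 kj.2) A v| <= B.
    by have [K K0 HK] := hC_bounded (mP kj.1 kj.2).1; exists K.
  (* The finitely many terms with [j + k <= N] escape the root condition; [T] dominates all of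
     them. *)
  pose T : R := \sum_(k < N.+1) \sum_(j < N.+1) B (k : nat, j : nat) / e ^+ (j + k).
  have t0 k j : 0 <= B (k : nat, j : nat) / e ^+ (j + k).
    by rewrite divr_ge0 ?(HB (k, j)).1// exprn_ge0// ltW.
  have T0 : 0 <= T by apply: sumr_ge0 => k _; apply: sumr_ge0 => j _; exact: t0.
  exists (C + T) => [|k j A v cv]; first by lra.
  have ek : 0 < e ^+ (j + k) by exact: exprn_gt0.
  have [h|h] := leqP (j + k) N.
    apply: (le_trans ((HB (k, j)).2 A v cv)).
    have hk : (k < N.+1)%N by lia.
    have hj : (j < N.+1)%N by lia.
    rewrite -ler_pdivrMr//; apply: (@le_trans _ _ T); last by lra.
    rewrite /T (bigD1 (Ordinal hk))//= (bigD1 (Ordinal hj))//= -addrA lerDl; apply: addr_ge0.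
      by apply: sumr_ge0 => i _; exact: t0.
    by apply: sumr_ge0 => i _; apply: sumr_ge0 => l _; exact: t0.
  have := HN k j (ltnW h); have N0 := sph_norm_ge0 nm (mP k j).1.
  set nn := sph_normf nm (P k j) in N0 *; move=> H.
  have H2 : nn <= (e / C) ^+ (j + k).
    have jk : (j + k)%:R != 0 :> R by rewrite pnatr_eq0; lia.
    have -> : nn = (nn `^ (j + k)%:R^-1) `^ (j + k)%:R by rewrite -powRrM mulVf// powRr1.
    by rewrite powR_mulrn ?powR_ge0// lerXn2r ?nnegrE ?powR_ge0// divr_ge0 ?ltW.
  apply: (le_trans ((HC k (P k j) (mP k j)).1 A v cv)); rewrite -/nn.
  apply: (@le_trans _ _ (C * e ^+ (j + k))); last by apply: ler_wpM2r; [exact: ltW|lra].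
  apply: (@le_trans _ _ (C ^+ k.+1 * (e / C) ^+ (j + k))).
    by rewrite ler_wpM2l// exprn_ge0// ltW.
  rewrite exprS expr_div_n -mulrA; apply: ler_wpM2l; first exact: ltW.
  rewrite mulrCA -[leRHS]mulr1.
  apply: ler_wpM2l; first exact: ltW.
  rewrite ler_pdivrMr ?exprn_gt0// mul1r; apply: ler_weXn2l => //; lia.
have e2 : 0 < e / 2 by lra.
have [K K0 HK] := D (e / 2) e2.
have CK0 : 0 <= C * K by rewrite mulr_ge0// ltW.
have [N HN] : exists N : nat, C * K <= 2 ^+ N.
  exists (Num.bound (C * K)); have := archi_boundP CK0.
  move=> h; apply: (le_trans (ltW h)); rewrite -natrX ler_nat; exact: ltnW (ltn_expl _ _).
(* The successor excludes [j + k = 0], where the exponent would be the inverse of 0. *)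
exists N.+1 => k j h; set nn := sph_normf nm (P k j).
have N0 : 0 <= nn := sph_norm_ge0 nm (mP k j).1.
have H : nn <= e ^+ (j + k).
  apply: (le_trans ((HC k (P k j) (mP k j)).2 _ (HK k j))).
  rewrite expr_div_n !mulrA ler_pdivrMr ?exprn_gt0// [leLHS]mulrC ler_wpM2l ?exprn_ge0 ?(ltW e0)//.
  by apply: (le_trans HN); apply: ler_weXn2l; [lra|lia].
have jk : (j + k)%:R != 0 :> R by rewrite pnatr_eq0; lia.
apply: (@le_trans _ _ ((e ^+ (j + k)) `^ (j + k)%:R^-1)).
  by apply: ge0_ler_powR; rewrite ?nnegrE ?invr_ge0 ?exprn_ge0 ?(ltW e0).
by rewrite -powR_mulrn ?(ltW e0)// -powRrM mulfV// powRr1 ?(ltW e0).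
Qed.
End NormEquiv.

(** * Expansion of monogenic functions *)

Section Sums.
Variable R : realType.
Implicit Types (a : nat -> nat -> R) (b u : nat -> R).

Lemma cvg_epsP u (l : R) : (u @ \oo --> l) <->
  forall e : R, 0 < e -> exists N, forall n, (N <= n)%N -> `|u n - l| <= e.
Proof.
split=> [/cvgrPdist_le H e e0|H].
  by have [N _ HN] := H e e0; exists N => n Nn; rewrite distrC; exact: HN.
by apply/cvgrPdist_le => e e0; have [N HN] := H e e0; exists N => // n /= Nn; rewrite distrC; exact: HN.
Qed.

Lemma sum_cst (c : R) N : \sum_(i < N) c = N%:R * c.
Proof. by rewrite sumr_const card_ord mulr_natl. Qed.

Lemma triangle_sum a N : \sum_(m < N) \sum_(j < m.+1) a j (m - j)%N =
  \sum_(j < N) \sum_(k < N | (j + k < N)%N) a j k.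
Proof.
transitivity (\sum_(m < N) \sum_(j < N) if (j <= m)%N then a j (m - j)%N else 0).
  apply: eq_bigr => m _; rewrite (big_ord_widen N (fun j => a j (m - j)%N)) ?ltn_ord//.
  by rewrite big_mkcond.
rewrite exchange_big; apply: eq_bigr => j _ /=.
rewrite -big_mkcond -(big_geq_mkord j N xpredT (fun m => a j (m - j)%N)).
rewrite -{1}(add0n (j : nat)) big_addn big_mkord /=.
under eq_bigr do rewrite addnK.
rewrite (big_ord_widen N (fun k => a j k)) ?leq_subr//.
by apply: eq_bigl => k; rewrite ltn_subRL.
Qed.

(** The square and the triangle differ by at most [N^2 <= 4^N] terms with [j + k >= N]. The ratio
    1/8 is taken so that a factor [2^-N] is left. *)
Lemma square_triangle a (B : R) N : 0 <= B -> (forall j k, `|a j k| <= B * 8^-1 ^+ (j + k)) ->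
  `|\sum_(j < N) \sum_(k < N) a j k - \sum_(m < N) \sum_(j < m.+1) a j (m - j)%N| <= B * 2^-1 ^+ N.
Proof.
move=> B0 ab; rewrite triangle_sum -sumrB.
have q0 : 0 <= 8^-1 :> R by rewrite invr_ge0.
apply: (@le_trans _ _ (\sum_(j < N) \sum_(k < N) B * 8^-1 ^+ N)).
  apply: (le_trans (ler_norm_sum _ _ _)); apply: ler_sum => j _.
  rewrite (bigID (fun k : 'I_N => (j + k < N)%N)) /= addrAC subrr add0r big_mkcond.
  apply: (le_trans (ler_norm_sum _ _ _)); apply: ler_sum => k _.
  have B8 : 0 <= B * 8^-1 ^+ N by rewrite mulr_ge0// exprn_ge0.
  case: ltnP => h /=; first by rewrite normr0.
  apply: (le_trans (ab _ _)); rewrite ler_wpM2l//.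
  by apply: ler_wiXn2l => //; rewrite invf_le1; lra.
rewrite !sum_cst mulrA -natrM mulrCA; apply: ler_wpM2l => //.
have -> : 2^-1 ^+ N = 4 ^+ N * 8^-1 ^+ N :> R by rewrite -exprMn; congr (_ ^+ N); field.
rewrite ler_wpM2r ?exprn_ge0// -natrX ler_nat.
by rewrite (_ : 4 = 2 * 2)%N// expnMn leq_mul// ltnW// ltn_expl.
Qed.

Lemma square_cauchy a (B : R) N N' : 0 <= B -> (forall j k, `|a j k| <= B * 8^-1 ^+ (j + k)) -> (N <= N')%N ->
  `|\sum_(j < N') \sum_(k < N') a j k - \sum_(j < N) \sum_(k < N) a j k| <= 4 * B * 2^-1 ^+ N.
Proof.
move=> B0 ab NN'; pose s M := \sum_(j < M) \sum_(k < M) a j k; rewrite -!/(s _).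
have q0 : 0 <= 8^-1 :> R by rewrite invr_ge0.
have H M : `|s M.+1 - s M| <= 2 * B * 2^-1 ^+ M.
  have -> : s M.+1 - s M = \sum_(k < M.+1) a M k + \sum_(j < M) a j M.
    rewrite /s big_ord_recr /=; under eq_bigr do rewrite big_ord_recr /=.
    by rewrite big_split /=; ring.
  have t j k : (M <= j + k)%N -> `|a j k| <= B * 8^-1 ^+ M.
    move=> h; apply: (le_trans (ab _ _)); rewrite ler_wpM2l//.
    by apply: ler_wiXn2l => //; rewrite invf_le1; lra.
  apply: (@le_trans _ _ (M.+1%:R * (B * 8^-1 ^+ M) + M%:R * (B * 8^-1 ^+ M))).
    apply: (le_trans (ler_normD _ _)); apply: lerD.
      apply: (le_trans (ler_norm_sum _ _ _)).
      rewrite -sum_cst; apply: ler_sum => k _; apply: t; exact: leq_addr.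
    apply: (le_trans (ler_norm_sum _ _ _)).
    rewrite -sum_cst; apply: ler_sum => k _; apply: t; exact: leq_addl.
  rewrite -mulrDl -natrD mulrCA [2 * B]mulrC -[leRHS]mulrA; apply: ler_wpM2l => //.
  have -> : 2^-1 ^+ M = 4 ^+ M * 8^-1 ^+ M :> R by rewrite -exprMn; congr (_ ^+ M); field.
  rewrite mulrA ler_wpM2r ?exprn_ge0// -natrX -natrM ler_nat.
  have : (M < 2 ^ M)%N := ltn_expl _ _.
  have : (2 ^ M <= 4 ^ M)%N by rewrite (_ : 4 = 2 * 2)%N// expnMn leq_pmulr// expn_gt0.
  lia.
have -> : s N' - s N = \sum_(N <= i < N') (s i.+1 - s i) by rewrite telescope_sumr.
apply: (le_trans (ler_norm_sum _ _ _)).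
apply: (@le_trans _ _ (\sum_(N <= i < N') 2 * B * 2^-1 ^+ i)); first by apply: ler_sum => i _; exact: H.
rewrite -mulr_sumr (_ : 4 * B = 2 * B * 2); last by ring.
rewrite -[leRHS]mulrA; apply: ler_wpM2l; first by rewrite mulr_ge0.
apply: geo_tail_le; rewrite invr_ge0 lexx andbT; exact: ler0n.
Qed.
End Sums.

(** * Existence, convergence and uniqueness of the expansion *)

Section Main.
Variables (R : realType) (n : nat).
Hypothesis n2 : (2 <= n)%N.
Let n0 : (0 < n)%N := ltnW n2.
Local Notation lft j := (lift ord0 j : 'I_n.+1).
Implicit Types (A B C : {set 'I_n}) (P q : 'rV[R]_n -> Cl R n) (F G : 'rV[R]_(n.+1) -> Cl R n).
Implicit Types (x : 'rV[R]_(n.+1)) (v w : 'rV[R]_n).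

Lemma hpoly_emb k (p : 'rV[R]_n.+1 -> R) : hpoly k p -> hpoly k (fun v : 'rV[R]_n => p (emb v)).
Proof.
elim: k p => [p [c ->]|k IH p [q hq ->]]; first by exists c.
exists (fun i v => q (lft i) (emb v)) => [i|]; first exact: (IH _ (hq (lft i))).
apply/funext => v; rewrite big_ord_recl emb_ord0 mul0r add0r; apply: eq_bigr => j _.
by rewrite mxE liftK.
Qed.

Lemma emb_line v (j : 'I_n) (t : R) : emb (v + t *: unitv R j) = emb v + t *: unitv R (lft j).
Proof.
apply/rowP => i; rewrite !mxE; case: unliftP => [i' ->|->]; rewrite ?mxE ?(inj_eq lift_inj)//.
by rewrite add0r (negbTE (neq_lift _ _)) andbF mulr0.
Qed.

Lemma pd_emb (p : 'rV[R]_n.+1 -> R) v (j : 'I_n) : pd j (fun w => p (emb w)) v = pd (lft j) p (emb v).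
Proof.
have xE : emb v = emb v + (0 : R) *: unitv R (lft j) by rewrite scale0r addr0.
have vE : v = v + (0 : R) *: unitv R j by rewrite scale0r addr0.
rewrite {1}vE [in RHS]xE /pd !derive_line; congr ('D_1 _ (0 : R)).
by apply/funext => t; rewrite emb_line.
Qed.

Definition D0 F x : Cl R n := [ffun A => - pd ord0 (bcomp F A) x].

Lemma comp_D0 F A : bcomp (D0 F) A = fun x => -1 * pd ord0 (bcomp F A) x.
Proof. by apply/funext => x; rewrite /bcomp ffunE mulN1r. Qed.

Lemma hC_D0 k F : hC k F -> hC k.-1 (D0 F).
Proof. by move=> hF A; rewrite comp_D0; apply: hpolyZ; exact: hpoly_pd (hF A). Qed.

Lemma CR_D0 k F x C : hC k F -> (forall y B, CR F B y = 0) -> CR (D0 F) C x = 0.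
Proof.
move=> hF H; pose G y : Cl R n := [ffun A => pd ord0 (bcomp F A) y].
have -> : D0 F = fun y => -1 *: G y.
  by apply/funext => y; apply/ffunP => A; rewrite !ffunE -[RHS]/(_ * _) mulN1r.
have dG : dffC G.
  move=> A; have -> : bcomp G A = pd ord0 (bcomp F A) by apply/funext => y; rewrite /bcomp ffunE.
  exact: hpoly_dff (hpoly_pd _ (hF A)).
by rewrite (CRZ _ _ _ dG) (CR_pd0 _ _ hF H) mulr0.
Qed.

Lemma dirac_emb F v : (forall y B, CR F B y = 0) ->
  dirac_x (fun w => F (emb w)) v = D0 F (emb v).
Proof.
move=> H; apply/ffunP => C; rewrite -/(bcomp _ C v) comp_dirac [RHS]ffunE.
apply/eqP; rewrite -addr_eq0 addrC; apply/eqP; apply: (etrans _ (H (emb v) C)); rewrite /CR; congr (_ + _).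
by apply: eq_bigr => j _; congr (_ * _); exact: pd_emb.
Qed.

(** [D0 F] is again monogenic, so the exchange of the Dirac operator for [- d/dx_0] can be iterated.
    Powers of the Dirac operator thus become directional derivatives, to which [Dn_bound]
    applies. *)
Lemma iter_D0 i k F : hC k F -> (forall y B, CR F B y = 0) ->
  [/\ hC (k - i) (iter i D0 F), forall y B, CR (iter i D0 F) B y = 0,
      forall A, bcomp (iter i D0 F) A = fun x => (-1) ^+ i * Dn i (unitv R ord0) (bcomp F A) x &
      dn i (fun w => F (emb w)) = fun v => iter i D0 F (emb v)].
Proof.
move=> hF H; elim: i => [|i [h1 h2 h3 h4]].
  by split=> // [|A]; [rewrite subn0|apply/funext => x; rewrite expr0 mul1r].
split.
- by rewrite subnS; exact: hC_D0 h1.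
- by move=> y B; exact: (CR_D0 _ _ h1 h2).
- move=> A; rewrite iterS comp_D0 h3; apply/funext => x.
  rewrite /pd (DvZ _ _ _ (hpoly_dff (hpoly_Dn i _ (hF A)))) exprS mulrA; congr (_ * _).
- rewrite /dn iterS -/(dn i _) h4; apply/funext => v; exact: dirac_emb.
Qed.

(** Both constants collect the losses of the next lemma: [m + 1 <= 2 * 2^m], the factor [(2 n)^m] of
    the Fischer bound, [(n+1)^2] per gradient estimate, [e^(m+1)] from powers against factorials,
    and [2^m] from the cube of half-side 2. *)
Definition decompA : R := 2 * expR 1.
Definition decompB : R := 8 * n%:R * n.+1%:R ^+ 2 * expR 1.

(* Fischer decomposition of [F] on [x_0 = 0]; the Dirac operator acts there as
   [- d/dx_0], so the gradient estimate bounds the components. *)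
Lemma hom_decomp m F : hC m F -> (forall y B, CR F B y = 0) ->
  exists P : nat -> 'rV[R]_n -> Cl R n, [/\ forall j, mono (m - j) (P j),
    forall x, F x = \sum_(j < m.+1) XP (m - j) j (P j) x &
    forall K : R, 0 <= K -> (forall A x, cube 0 1 x -> `|bcomp F A x| <= K) ->
      forall j A v, (j <= m)%N -> cube 0 1 v -> `|bcomp (P j) A v| <= decompA * decompB ^+ m * K].
Proof.
move=> hF H; pose q v := F (emb v).
have hq : hC m q by move=> A; exact: (hpoly_emb (hF A)).
have [P [mP qE]] := fischer_exists n0 hq.
exists P; split=> // [x|K K0 bF j A v jm cv].
  pose S x := \sum_(j < m.+1) CK j (m - j) (P j) x.
  have SE : S x = \sum_(j < m.+1) XP (m - j) j (P j) x.
    by apply: eq_bigr => j _; rewrite XP_CK.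
  rewrite -SE; apply/eqP; rewrite -subr_eq0; apply/eqP.
  have hc (j : 'I_m.+1) : hC m (CK j (m - j) (P j)).
    by have := hC_CK n0 j (mP j).1; rewrite subnK// -ltnS.
  have hS : hC m S by apply: hC_sum => j _; exact: hc.
  have := @CR_unique R n m (fun x => F x + -1 *: S x) _ _ _ x; rewrite scaleN1r; apply.
  - by move=> B; rewrite (compD F) (compZ (fun=> -1)); apply: hpolyD (hF B) (hpolyZ _ (hS B)).
  - move=> y B; rewrite CRD; [|exact: hC_dffC hF|exact: hC_dffC (hCZ _ hS)].
    rewrite (CRZ _ _ _ (hC_dffC hS)) H add0r CR_sum; last by move=> j C; exact: hpoly_dff (hc j C).
    by rewrite big1 ?mulr0// => j _; rewrite CR_CK.
  - move=> y y0; rewrite scaleN1r /S; under eq_bigr do rewrite (CK_at0 _ _ _ y0).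
    rewrite -qE /q (_ : emb (xvec y) = y) ?subrr//.
    apply/rowP => i; rewrite mxE; case: unliftP => [i' ->|->]; by rewrite ?mxE.
pose K' := (n.+1%:R ^+ 2) ^+ m * (expR 1 ^+ m.+1) * (2 ^+ m * K).
have e1 : 1 <= expR 1 :> R by rewrite -expR0 ler_expR.
have K'0 : 0 <= K' by rewrite !mulr_ge0// ?exprn_ge0// expR_ge0.
have bd i B : (i <= m)%N -> `|bcomp (dn i q) B v| <= i`!%:R * K'.
  move=> im; have [h1 h2 h3 h4] := iter_D0 i hF H.
  rewrite /bcomp h4 -/(bcomp (iter i D0 F) B (emb v)) h3 normrM normrX normrN1 expr1n mul1r.
  (* Steps of size 1/(i+1) keep the total displacement below 1, within the cube of half-side 2, and
     stay meaningful for [i = 0]. *)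
  have i0 : 0 < i.+1%:R^-1 :> R by rewrite invr_gt0.
  have hH : harmfun (bcomp F B) := CR_harm_pol (fun C => pol_hpoly (hF C)) H B.
  have u1 l : `|unitv R (ord0 : 'I_n.+1) 0 l| <= 1 by rewrite unitvE normr_nat lern1 leq_b1.
  have bb z : cube (emb v) (i%:R * i.+1%:R^-1) z -> `|bcomp F B z| <= 2 ^+ m * K.
    move=> cz; apply: (hpoly_cube_scale (hF B)) => // [y|l]; first exact: bF.
    have := cz l; have := emb_cube n2 cv l; rewrite [X in _ - X]mxE subr0 => h1' h2'.
    have i1 : i%:R * i.+1%:R^-1 <= 1 :> R by rewrite ler_pdivrMr// mul1r ler_nat.
    rewrite mxE subr0; have -> : z 0 l = (z 0 l - emb v 0 l) + emb v 0 l by ring.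
    apply: (le_trans (ler_normD _ _)); rewrite (_ : 2 = 1 + 1)//.
    exact: lerD (le_trans h2' i1) h1'.
  apply: (le_trans (Dn_bound (ltn0Sn n) i0 (pol_hpoly (hF B)) hH u1 bb)).
  rewrite invrK exprMn /K' !mulrA; apply: ler_wpM2r => //; apply: ler_wpM2r; first exact: exprn_ge0.
  have E1 : i.+1%:R ^+ i <= i`!%:R * expR 1 ^+ m.+1 :> R.
    apply: (le_trans (expX_fact i (ler0n _ _))); apply: ler_wpM2l => //.
    by rewrite -[i.+1%:R]mulr1 expRM_natl; apply: ler_weXn2l.
  have E2 : (n.+1%:R ^+ 2) ^+ i <= (n.+1%:R ^+ 2) ^+ m :> R by rewrite ler_weXn2l// exprn_ege1 ?ler1n.
  rewrite [leRHS](_ : _ = (n.+1%:R ^+ 2) ^+ m * (i`!%:R * expR 1 ^+ m.+1)); last by ring.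
  by apply: ler_pM => //; rewrite !exprn_ge0.
apply: (le_trans (fischer_bound n0 A mP qE jm K'0 cv bd)).
have E : decompB ^+ m = 2 ^+ m * (2 * n%:R) ^+ m * (n.+1%:R ^+ 2) ^+ m * expR 1 ^+ m * 2 ^+ m.
  by rewrite -!exprMn; congr (_ ^+ m); rewrite /decompB; ring.
have E3 : m.+1%:R <= 2 * 2 ^+ m :> R by rewrite -exprS -natrX ler_nat; exact: ltnW (ltn_expl _ _).
rewrite E /decompA /K' (exprS (expR 1) m).
rewrite [leRHS](_ : _ = (2 * 2 ^+ m) * ((2 * n%:R) ^+ m * ((n.+1%:R ^+ 2) ^+ m * (expR 1 * expR 1 ^+ m) * (2 ^+ m * K)))); last by ring.
rewrite -[leLHS]mulrA; apply: ler_wpM2r => //.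
by rewrite !mulr_ge0// ?exprn_ge0// ?mulr_ge0// expR_ge0.
Qed.

Lemma term_bound (P : nat -> nat -> 'rV[R]_n -> Cl R n) (r : R) : (forall k j, mono k (P k j)) ->
  decays P ->
  0 < r -> exists2 B : R, 0 <= B & forall k j A x, cube 0 r x ->
    `|bcomp (XP k j (P k j)) A x| <= B * 8^-1 ^+ (j + k).
Proof.
move=> mP D r0; pose L : R := r * (2 * n%:R * expR 2).
have L0 : 0 < L by rewrite /L !mulr_gt0// ?expR_gt0// ltr0n.
(* [L] is the growth rate of the extensions on the cube of half-side [r]; decay at rate [1 / (8 L)]
   leaves the ratio 1/8 required by the summation lemmas. *)
have e0 : 0 < (8 * L)^-1 by rewrite invr_gt0 mulr_gt0.
have [K K0 HK] := D _ e0.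
exists (expR n%:R * K) => [|k j A x cx]; first by rewrite mulr_ge0// expR_ge0.
have b1 y : cube 0 1 y -> `|bcomp (CK j k (P k j)) A y| <=
    expR n%:R * (2 * n%:R * expR 2) ^+ (k + j) * (K * (8 * L)^-1 ^+ (j + k)).
  move=> cy; apply: (CK_bound n0) => // [|v B cv]; last exact: HK.
  by rewrite mulr_ge0// exprn_ge0// ltW.
rewrite (_ : bcomp _ A = bcomp (CK j k (P k j)) A); last first.
  by apply/funext => y; rewrite /bcomp XP_CK.
apply: (le_trans (hpoly_cube_scale (hC_CK n0 j (mP k j).1 A) r0 b1 cx)).
rewrite [leLHS](_ : _ = expR n%:R * K * ((r ^+ (k + j) * (2 * n%:R * expR 2) ^+ (k + j)) * (8 * L)^-1 ^+ (j + k))); last by ring.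
rewrite -exprMn -/L addnC -exprMn invfM mulrCA divff ?mulr1//.
by rewrite gt_eqF.
Qed.

Lemma expansion_eps (P : nat -> nat -> 'rV[R]_n -> Cl R n) f : expansion P f <->
  forall A x (e : R), 0 < e -> exists N0, forall N, (N0 <= N)%N ->
    `|\sum_(j < N) \sum_(k < N) bcomp (XP k j (P k j)) A x - bcomp f A x| <= e.
Proof.
have E N A x : (\sum_(j < N) \sum_(k < N) cl_mul (Xjk k j x) (P k j (xvec x))) A =
    \sum_(j < N) \sum_(k < N) bcomp (XP k j (P k j)) A x.
  by rewrite sum_ffunE; apply: eq_bigr => j _; rewrite sum_ffunE.
split=> [H A x|H x A /=]; last by apply/cvg_epsP => e e0; have [N HN] := H A x e e0; exists N => M NM; rewrite E; exact: HN.
have /cvg_epsP h := H x A; move=> e e0; have [N HN] := h e e0.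
by exists N => M NM; rewrite -E; exact: HN.
Qed.

Lemma expansion_monogenic (P : nat -> nat -> 'rV[R]_n -> Cl R n) f : (forall k j, mono k (P k j)) ->
  decays P ->
  expansion P f -> monogenic f.
Proof.
move=> mP D /expansion_eps H.
pose u N x := \sum_(j < N) \sum_(k < N) CK j k (P k j) x.
have hc k j : hC (k + j) (CK j k (P k j)) := hC_CK n0 j (mP k j).1.
have uE N A x : bcomp (u N) A x = \sum_(j < N) \sum_(k < N) bcomp (XP k j (P k j)) A x.
  rewrite /bcomp sum_ffunE; apply: eq_bigr => j _; rewrite sum_ffunE; apply: eq_bigr => k _.
  by rewrite XP_CK.
have pc N A (j : 'I_N) : pol (bcomp (fun x => \sum_(k < N) CK j k (P k j) x) A).
  by rewrite comp_sum; apply: pol_sum => k _; exact: (pol_hpoly (hc k j A)).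
apply: (@luc_lim_monogenic R n u).
- by move=> N A; rewrite comp_sum; apply: pol_sum => j _; exact: pc.
- move=> N x C; rewrite CR_sum; last by move=> j A; exact: (pol_dff (pc N A j)).
  rewrite big1// => j _; rewrite CR_sum; last by move=> k A; exact: (hpoly_dff (hc k j A)).
  by rewrite big1// => k _; rewrite CR_CK.
move=> A r e r0 e0; have [B B0 HB] := term_bound mP D r0.
have B4 : 0 <= 4 * B by rewrite mulr_ge0.
have [N HN] := half_pow_small B4 e0; exists N => M NM x cx.
apply: le_trans (HN M NM); rewrite uE distrC.
(* [expansion] gives only pointwise convergence. The Cauchy bound is uniform on the cube and, with
   [N'] sent to infinity, makes it locally uniform. *)
pose s N' := \sum_(j < N') \sum_(k < N') bcomp (XP k j (P k j)) A x.
apply: (@lim_bound R (fun N' => s N' - s M) _ _ M).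
  move=> d d0; have [N1 H1] := H A x d d0; exists N1 => N' NN'.
  rewrite (_ : s N' - s M - (bcomp f A x - s M) = s N' - bcomp f A x); last by ring.
  exact: H1.
move=> N' MN'; apply: (square_cauchy (a := fun j k => bcomp (XP k j (P k j)) A x) B0 _ MN') => j k.
exact: HB.
Qed.

Lemma monogenic_expands f : monogenic f -> exists P : nat -> nat -> 'rV[R]_n -> Cl R n,
  [/\ forall k j, mono k (P k j),
   decays P &
   expansion P f].
Proof.
move=> mf; have [F [hF cF bF lF]] := monogenic_expansion mf.
have /choice[p Hp] m := hom_decomp (hF m) (cF m).
pose P k j := p (k + j)%N j.
have mP k j : mono k (P k j) by have [h _ _] := Hp (k + j)%N; have := h j; rewrite addnK.
have dA : 0 < decompA by rewrite mulr_gt0// expR_gt0.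
have dB : 0 < decompB by rewrite !mulr_gt0 ?expR_gt0 ?exprn_gt0// ltr0n.
have D : decays P.
  (* The radius [decompB / e] cancels the loss [decompB ^+ m] of the decomposition and leaves
     [e ^+ m]. *)
  move=> e e0; have [M M0 HM] := bF _ (divr_gt0 dB e0).
  exists (decompA * M) => [|k j A v cv]; first by rewrite mulr_ge0// ltW.
  have [_ _ h] := Hp (k + j)%N.
  have r0 : 0 <= M / (decompB / e) ^+ (k + j) by rewrite divr_ge0// exprn_ge0// divr_ge0 ?ltW.
  apply: (le_trans (h _ r0 (fun B x cx => HM (k + j)%N B x cx) j A v (leq_addl _ _) cv)).
  rewrite expr_div_n invfM invrK [(j + k)%N]addnC le_eqVlt; apply/orP; left; apply/eqP.
  by field; rewrite ?expf_neq0 ?gt_eqF.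
exists P; split=> //; apply/expansion_eps => A x e e0.
have [r r0 cx] := cube_exists x.
have [B B0 HB] := term_bound mP D r0.
have e2 : 0 < e / 2 by lra.
have [N1 H1] := lF A r _ r0 e2; have [N2 H2] := half_pow_small B0 e2.
exists (maxn N1 N2) => N; rewrite geq_max => /andP[NN1 NN2].
have := H1 N NN1 x cx; have := H2 N NN2.
have := @square_triangle R (fun j k => bcomp (XP k j (P k j)) A x) B N B0 (fun j k => HB k j A x cx).
have -> : \sum_(m < N) bcomp (F m) A x = \sum_(m < N) \sum_(j < m.+1) bcomp (XP (m - j) j (P (m - j)%N j)) A x.
  apply: eq_bigr => m _; have [_ h _] := Hp m; rewrite /bcomp h sum_ffunE; apply: eq_bigr => j _.
  by rewrite /P subnK// -ltnS.
set X := \sum_(j < N) _; set Y := \sum_(m < N) _ => h1 h2 h3.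
rewrite (_ : X - _ = (X - Y) + (Y - bcomp f A x)); last by ring.
by apply: (le_trans (ler_normD _ _)); lra.
Qed.

Lemma expansion_unique (P Q : nat -> nat -> 'rV[R]_n -> Cl R n) f :
  (forall k j, mono k (P k j)) -> (forall k j, mono k (Q k j)) ->
  decays P ->
  decays Q ->
  expansion P f -> expansion Q f -> P = Q.
Proof.
move=> mP mQ DP DQ /expansion_eps EP /expansion_eps EQ.
pose c (S : nat -> nat -> 'rV[R]_n -> Cl R n) A x m :=
  \sum_(j < m.+1) bcomp (XP (m - j) j (S (m - j)%N j)) A x.
have cH S A x (t : R) m : (forall k j, mono k (S k j)) -> c S A (t *: x) m = c S A x m * t ^+ m.
  move=> mS; rewrite /c mulr_suml; apply: eq_bigr => j _.
  have jm : (j <= m)%N by rewrite -ltnS.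
  have hc : hpoly m (bcomp (XP (m - j) j (S (m - j)%N j)) A).
    rewrite -[X in hpoly X _](subnK jm).
    rewrite (_ : bcomp _ A = bcomp (CK j (m - j) (S (m - j)%N j)) A); first exact: (hC_CK n0 j (mS (m - j)%N j).1).
    by apply/funext => y; rewrite /bcomp (XP_CK n2 _ _ (mS (m - j)%N j)).
  by rewrite (hpoly_hom _ _ hc) mulrC.
have T S A x : (forall k j, mono k (S k j)) ->
    decays S ->
    expansion S f -> forall e : R, 0 < e -> exists N0, forall N, (N0 <= N)%N ->
      `|\sum_(m < N) c S A x m - bcomp f A x| <= e.
  move=> mS DS /expansion_eps ES e e0; have [r r0 cx] := cube_exists x.
  have [B B0 HB] := term_bound mS DS r0; have e2 : 0 < e / 2 by lra.
  have [N1 H1] := ES A x _ e2; have [N2 H2] := half_pow_small B0 e2.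
  exists (maxn N1 N2) => N; rewrite geq_max => /andP[NN1 NN2].
  have := H1 N NN1; have := H2 N NN2.
  have := @square_triangle R (fun j k => bcomp (XP k j (S k j)) A x) B N B0 (fun j k => HB k j A x cx).
  rewrite -/(c S A x _) distrC; set X := \sum_(j < N) \sum_(k < N) _; set Y := \sum_(m < N) _ => h1 h2 h3.
  rewrite (_ : Y - _ = (Y - X) + (X - bcomp f A x)); last by ring.
  by apply: (le_trans (ler_normD _ _)); lra.
have cE A x m : c P A x m = c Q A x m.
  apply/eqP; rewrite -subr_eq0; apply/eqP.
  move: m; apply: (@series_unique R (fun m => c P A x m - c Q A x m)) => t e _ e0.
  have e2 : 0 < e / 2 by lra.
  have [N1 H1] := T P A (t *: x) mP DP (iffRL (expansion_eps P f) EP) _ e2.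
  have [N2 H2] := T Q A (t *: x) mQ DQ (iffRL (expansion_eps Q f) EQ) _ e2.
  exists (maxn N1 N2) => N; rewrite geq_max => /andP[NN1 NN2].
  have h1 := H1 N NN1; have h2 := H2 N NN2.
  under eq_bigr do rewrite mulrBl -(cH P A x t _ mP) -(cH Q A x t _ mQ).
  rewrite sumrB; set X := \sum_(m < N) c P _ _ _ in h1 *; set Y := \sum_(m < N) _ in h2 *.
  rewrite (_ : X - Y = (X - bcomp f A (t *: x)) - (Y - bcomp f A (t *: x))); last by ring.
  by apply: (le_trans (ler_normB _ _)); lra.
apply/funext => k; apply/funext => j; apply/funext => v.
pose m := (k + j)%N.
pose q w : Cl R n := \sum_(i < m.+1) xmn i (P (m - i)%N i) w.
(* At [emb w] every term is a power of [x] times a spherical monogenic, so equality of the degree-m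
   parts gives two Fischer decompositions of the same [q]. *)
have qQ w : q w = \sum_(i < m.+1) xmn i (Q (m - i)%N i) w.
  apply/ffunP => A; have := cE A (emb w) m; rewrite /c /q !sum_ffunE.
  have X S i : (forall k j, mono k (S k j)) -> bcomp (XP (m - i) i (S (m - i)%N i)) A (emb w) = xmn i (S (m - i)%N i) w A.
    by move=> mS; rewrite /bcomp XP_CK// CK_at0 ?emb_ord0// xvec_emb.
  under eq_bigr do rewrite X//; under [in RHS]eq_bigr do rewrite X//.
  by [].
have jm : (j <= m)%N := leq_addl _ _.
have FP := fischer_extract n0 (q := q) (P := fun i => P (m - i)%N i) v (fun i => mP (m - i)%N i) (fun w => erefl (q w)) jm.
have FQ := fischer_extract n0 (q := q) (P := fun i => Q (m - i)%N i) v (fun i => mQ (m - i)%N i) qQ jm.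
have nz : (-1) ^+ j * bprod R n (m - j) j j != 0.
  rewrite mulf_neq0 ?expf_neq0 ?oppr_eq0 ?oner_eq0// gt_eqF//.
  by apply: lt_le_trans (bprod_ge _ _ _ _); rewrite ?ltr0n ?fact_gt0.
have : ((-1) ^+ j * bprod R n (m - j) j j) *: P (m - j)%N j v = ((-1) ^+ j * bprod R n (m - j) j j) *: Q (m - j)%N j v.
  by rewrite -FP -FQ.
by move/(scalerI nz); rewrite (addnK j k : (m - j = k)%N).
Qed.
End Main.

Theorem theorem3p4 (R : realType) (n : nat) (hn : (2 <= n)%N) (nm : sph_norm) :
  (forall f : 'rV[R]_(n.+1) -> Cl R n,
     f \in M0 (n := n) <->
     exists P : nat -> nat -> 'rV[R]_n -> Cl R n,
       (forall k j, spherical_monogenic k (P k j)) /\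
       root_decay nm P /\ expansion P f) /\
  (forall (f : 'rV[R]_(n.+1) -> Cl R n) (P Q : nat -> nat -> 'rV[R]_n -> Cl R n),
     (forall k j, spherical_monogenic k (P k j)) -> root_decay nm P -> expansion P f ->
     (forall k j, spherical_monogenic k (Q k j)) -> root_decay nm Q -> expansion Q f ->
     P = Q).
Proof.
have mono_of P : (forall k j, spherical_monogenic k (P k j)) -> forall k j, mono k (P k j).
  by move=> H k j; apply/spherical_monogenicP; exact: H.
split=> [f|f P Q /mono_of mP dP eP /mono_of mQ dQ eQ]; last first.
  by apply: (expansion_unique hn mP mQ _ _ eP eQ); apply/(root_decayP hn nm).
rewrite inE; split=> [mf|[P [/mono_of mP [dP eP]]]].
  have [P [mP D eP]] := monogenic_expands hn mf.
  exists P; split; first by move=> k j; apply/spherical_monogenicP.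
  by split=> //; apply/(root_decayP hn nm mP).
by apply: (expansion_monogenic hn mP _ eP); apply/(root_decayP hn nm mP).
Qed.
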